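(* For every two $\delta$-almost $k$-wise indistinguishable distributions $\mathcal D_1,\mathcal D_2$ on $m$ bits, such that $\mathcal D_1$ has min-entropy at least $m-r$, any $\mathsf{AC}$ circuit with size $s$ and depth $d$ cannot distinguish the two distributions with advantage $\varepsilon+4m^k\delta$, for certain $$k=(\log s)^{O(d)}\cdot\left(r+\log(1/\varepsilon)\right).$$
   Context: Two distributions on $\{0,1\}^m$ are $\delta$-almost $k$-wise indistinguishable if for every $k$ of the $m$ bits, the marginal distributions on these bits are within total variation distance $\delta$. A distribution $\mathcal D$ on $\{0,1\}^m$ has min-entropy at least $h$ if $\Pr_{\mathcal D}[x]\le2^{-h}$ for every $x\in\{0,1\}^m$. $\mathsf{AC}$ circuits are classical circuits with unbounded fan-in AND/OR gates and NOT gates. A circuit computing a Boolean function $F:\{0,1\}^m\to\{0,1\}$ distinguishes $\mathcal D_1$ from $\mathcal D_2$ with advantage $\eta$ if $\left|\mathbb{E}_{x\sim\mathcal D_1}[F(x)]-\mathbb{E}_{x\sim\mathcal D_2}[F(x)]\right|\ge\eta$. The phrase ''for certain $k$'' means that, given $s,d,r,\varepsilon$, there is a value of $k$ of the stated form (with the constant in $O(d)$ absolute) for which the assertion holds.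
   Formalization: Proved for s ≥ 2 and r + log(1/ε) ≥ 1 (the claim fails for r = 0 and ε near 1, where k = 1), with k rounded up to an integer and indistinguishability required on all sets of at most k bits, so that it is not vacuous when k > m. *)

(* Defs.v *)
From HB Require Import structures.
From mathcomp Require Import all_boot all_order all_algebra.
From mathcomp Require Import reals exp.

Set Implicit Arguments.
Unset Strict Implicit.
Unset Printing Implicit Defensive.
Import Order.TTheory GRing.Theory Num.Theory.
Local Open Scope ring_scope.

Definition log2 (R : realType) (x : R) : R := ln x / ln 2.

Record dist (R : realType) (T : finType) := Dist {
  pmf :> T -> R;
  pmf_ge0 : forall x, 0 <= pmf x;
  pmf_sum1 : \sum_x pmf x = 1 }.

Definition expectation (R : realType) (T : finType) (D : dist R T)
    (F : T -> R) : R :=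
  \sum_x D x * F x.

Section Pushforward.
Variables (R : realType) (T U : finType) (D : dist R T) (f : T -> U).

Definition push_pmf (y : U) : R := \sum_(x | f x == y) D x.

Lemma push_pmf_ge0 y : 0 <= push_pmf y.
Proof. by apply: sumr_ge0 => x _; apply: pmf_ge0. Qed.

Lemma push_pmf_sum1 : \sum_y push_pmf y = 1.
Proof.
rewrite -(pmf_sum1 D) [RHS](partition_big f predT) //=.
Qed.

Definition push : dist R U := Dist push_pmf_ge0 push_pmf_sum1.
End Pushforward.

Definition tv_dist (R : realType) (T : finType) (P Q : dist R T) : R :=
  2^-1 * \sum_x `|P x - Q x|.

Notation bits m := {ffun 'I_m -> bool}.

Definition restrict (m : nat) (S : {set 'I_m}) (x : bits m) :
    {ffun {i : 'I_m | i \in S} -> bool} :=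
  [ffun i => x (val i)].

Definition marginal (R : realType) (m : nat) (S : {set 'I_m})
    (D : dist R (bits m)) :=
  push D (restrict S).

(* For k <= m it is the same to ask this only of the sets of exactly k bits,
   since passing to a smaller set cannot increase the distance. With [<=] the
   condition is not vacuous when k > m: it then bounds the distance between
   D1 and D2 themselves. *)
Definition almost_indist (R : realType) (m k : nat) (delta : R)
    (D1 D2 : dist R (bits m)) : Prop :=
  forall S : {set 'I_m}, (#|S| <= k)%N ->
    tv_dist (marginal S D1) (marginal S D2) <= delta.

Definition min_entropy_ge (R : realType) (T : finType) (h : R)
    (D : dist R T) : Prop :=
  forall x, D x <= 2 `^ (- h).

(* A circuit on m inputs is a list of gates in topological order. Its nodes
   are numbered: node i < m is the i-th input and node m + j is the j-th gate,
   whose wires must come from nodes of smaller number. Fan-in is unbounded,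
   and so is fan-out. The empty And and Or are the constants. *)
Inductive gate := And of seq nat | Or of seq nat | Not of nat.

Definition gate_wires (g : gate) : seq nat :=
  match g with And ws => ws | Or ws => ws | Not w => [:: w] end.

Fixpoint wf_gates (n : nat) (gs : seq gate) : bool :=
  if gs is g :: gs' then
    all (fun w => (w < n)%N) (gate_wires g) && wf_gates n.+1 gs'
  else true.

Record circuit (m : nat) := Circuit {
  gates : seq gate;
  output : nat;
  gates_wf : wf_gates m gates;
  output_wf : (output < m + size gates)%N }.

Definition gate_eval (vs : seq bool) (g : gate) : bool :=
  match g with
  | And ws => all (nth false vs) ws
  | Or ws => has (nth false vs) ws
  | Not w => ~~ nth false vs w
  end.

Definition circuit_eval (m : nat) (c : circuit m) (x : bits m) : bool :=
  nth false
    (foldl (fun vs g => rcons vs (gate_eval vs g)) [seq x i | i <- enum 'I_m]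
       (gates c))
    (output c).

(* NOT gates are free, both in the size and in the depth. *)
Definition circuit_size (m : nat) (c : circuit m) : nat :=
  count (fun g => if g is Not _ then false else true) (gates c).

Definition gate_depth (ds : seq nat) (g : gate) : nat :=
  match g with
  | And ws => (\max_(w <- ws) nth 0 ds w).+1
  | Or ws => (\max_(w <- ws) nth 0 ds w).+1
  | Not w => nth 0 ds w
  end%N.

Definition circuit_depth (m : nat) (c : circuit m) : nat :=
  nth 0%N (foldl (fun ds g => rcons ds (gate_depth ds g)) (nseq m 0%N) (gates c))
    (output c).

Definition distinguishes (R : realType) (m : nat) (F : bits m -> bool)
    (D1 D2 : dist R (bits m)) (eta : R) : Prop :=
  eta <= `|expectation D1 (fun x => (F x)%:R)
           - expectation D2 (fun x => (F x)%:R)|.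

(* k has the form (log s)^{O(d)} * (r + log (1/eps)), rounded up to an
   integer, C being the constant in the O(d). *)
Definition k_form (R : realType) (C s d : nat) (r eps : R) (k : nat) : Prop :=
  exists2 e : nat, (e <= C * d)%N &
    k%:Z = Num.ceil (log2 (s%:R : R) ^+ e * (r + log2 eps^-1)).

(* Main.v *)
Require Import Defs.
From mathcomp Require Import all_boot all_order all_algebra.
From mathcomp Require Import reals exp.
From mathcomp Require Import ring lra zify.
Set Implicit Arguments.
Unset Strict Implicit.
Unset Printing Implicit Defensive.
Import Order.TTheory GRing.Theory Num.Theory.
Local Open Scope ring_scope.

(* Let F be the circuit. Following Braverman, we look for a polynomial P of
   low degree below F || E, where E is an error event of probability at most
   about eps under D2 and eps 2^-r under the uniform distribution: since D1 is
   at most 2^r times uniform and a polynomial of degree k cannot tell D1 from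
   D2, this bounds E_D1 F - E_D2 F, and the negation of F gives the other side.
   A Razborov-Smolensky polynomial f agrees with F outside E, and
   P = 1 - (1 - f (1 - Et))^2 with Et the low-degree part of E.
   The dependence on log (1 / eps) must be linear in two places.
   - f is the multilinear majority of about log (1 / eps) polynomials of constant
     error (Harsha-Srinivasan), picked one after the other as in boosting.
   - f is as large as 2^(polylog(s)^d log (1 / eps)), so E must be approximated
     very accurately by Et. The sum of lam^|S| hat E(S)^2, with
     lam = 1 + 1 / polylog(s)^d, is bounded by random restrictions and the
     multi-switching lemma; the latter is proved by conditioning on up-closed
     sets of restrictions.
   The number of inputs does not enter log s, so wide gates are first trimmed
   to about log (s / eps) inputs. When log (1 / eps) exceeds s, expanding F into
   2^O(s) conjunctions of literals is enough. *)

(** * Random restrictions and the multi-switching lemma *)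

(** Only [D1] has min-entropy, so an event that is rare for the uniform distribution may be frequent
    under [D2]. The polynomials are therefore picked for the measure [D2] plus [2 * R0] times
    uniform, with [R0 = 2 ^ r], while the Fourier tail bound holds for every choice of the sampled
    sets and so survives this dependence on [D2]. The square in P keeps P below F || E at every
    point, even where f is wrong and huge; only the mean of the difference has to be small. A
    polynomial of degree k' has at most (m + 1)^k' characters, each costing [2 * delta] times a
    coefficient of size at most 2; k exceeds 2 k', and (m + 1)^k' is at most m^(2 k'). The tail
    bound takes d + 2 rounds of restrictions: d for the layers of gates, one for the sampled sets of
    literals and one for the copies whose failures make up E. Each round shrinks lam - 1 by a factor
    p of order 1 / polylog(s), which is where (log s)^O(d) comes from. *)

Section ProductExpectation.
Variables (R : realFieldType) (I O : finType) (w : O -> R).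

Definition prodE (g : {ffun I -> O} -> R) : R :=
  \sum_(rho : {ffun I -> O}) (\prod_i w (rho i)) * g rho.

Definition upd (rho : {ffun I -> O}) (i : I) (o : O) : {ffun I -> O} :=
  [ffun j => if j == i then o else rho j].

Definition upds (rho : {ffun I -> O}) (Q : {set I}) (tau : {ffun I -> O}) :
    {ffun I -> O} :=
  [ffun j => if j \in Q then tau j else rho j].

Lemma eq_prodE g h : g =1 h -> prodE g = prodE h.
Proof. by move=> e; apply: eq_bigr => rho _; rewrite e. Qed.

Lemma prodE_sum (K : Type) (r : seq K) (P : pred K) (F : K -> {ffun I -> O} -> R) :
  prodE (fun rho => \sum_(k <- r | P k) F k rho) =
  \sum_(k <- r | P k) prodE (F k).
Proof.
rewrite /prodE exchange_big /=; apply: eq_bigr => rho _.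
by rewrite mulr_sumr.
Qed.

Lemma prodEZ c g : prodE (fun rho => c * g rho) = c * prodE g.
Proof. by rewrite /prodE mulr_sumr; apply: eq_bigr => rho _; rewrite mulrCA. Qed.

Lemma prodED g h : prodE (fun rho => g rho + h rho) = prodE g + prodE h.
Proof.
by rewrite /prodE -big_split; apply: eq_bigr => rho _; rewrite mulrDr.
Qed.

Lemma prodEB g h : prodE (fun rho => g rho - h rho) = prodE g - prodE h.
Proof.
by rewrite /prodE -sumrB; apply: eq_bigr => rho _; rewrite mulrBr.
Qed.

Hypothesis w_ge0 : forall o, 0 <= w o.

Lemma ler_prodE g h : (forall rho, g rho <= h rho) -> prodE g <= prodE h.
Proof.
move=> le_gh; apply: ler_sum => rho _; apply: ler_wpM2l => //.
by apply: prodr_ge0.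
Qed.

Lemma prodE_ge0 g : (forall rho, 0 <= g rho) -> 0 <= prodE g.
Proof.
by move=> g0; apply: sumr_ge0 => rho _; apply: mulr_ge0 => //; apply: prodr_ge0.
Qed.

Hypothesis w_sum1 : \sum_o w o = 1.

Lemma prodE_cst c : prodE (fun=> c) = c.
Proof.
rewrite /prodE -mulr_suml -(bigA_distr_bigA (fun _ o => w o)).
by rewrite big1 ?mul1r // => i _.
Qed.

(** The involution [h] exchanges the fresh outcome with coordinate [i] of [rho]; the weight of the
    pair is symmetric in the two, hence preserved. *)
Lemma prodE_resample i g :
  prodE g = \sum_o w o * prodE (fun rho => g (upd rho i o)).
Proof.
pose h (x : O * {ffun I -> O}) := (x.2 i, upd x.2 i x.1).
have hK : involutive h.
  move=> [o rho]; rewrite /h /upd /=; congr pair; first by rewrite ffunE eqxx.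
  by apply/ffunP=> j; rewrite !ffunE; case: eqP => // ->.
transitivity (\sum_(x : O * {ffun I -> O})
    w x.1 * ((\prod_j w (x.2 j)) * g (upd x.2 i x.1))); last first.
  rewrite -(pair_bigA _ (fun o (rho : {ffun I -> O}) =>
    w o * ((\prod_j w (rho j)) * g (upd rho i o)))) /=.
  by apply: eq_bigr => o _; rewrite /prodE mulr_sumr.
rewrite (reindex_inj (inv_inj hK)) /=.
transitivity (\sum_(x : O * {ffun I -> O})
    w x.1 * ((\prod_j w (x.2 j)) * g x.2)); last first.
  apply: eq_bigr => -[o rho] _ /=.
  rewrite !mulrA; congr (_ * g _); last first.
    by apply/ffunP=> j; rewrite !ffunE; case: eqP => // ->.
  rewrite (bigD1 i) //= [in RHS](bigD1 i) //= /upd ffunE eqxx !mulrA.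
  rewrite [w o * _]mulrC; congr (_ * _).
  by apply: eq_bigr => j /negbTE nij; rewrite ffunE nij.
rewrite -(pair_bigA _ (fun o (rho : {ffun I -> O}) => w o * ((\prod_j w (rho j)) * g rho))) /=.
under eq_bigr => o _ do rewrite -mulr_sumr.
by rewrite -mulr_suml w_sum1 mul1r.
Qed.

(** Conditioning on the coordinates in [Q], obtained by resampling them one at a time. *)
Lemma prodE_fix (Q : {set I}) (tau : {ffun I -> O}) h :
  prodE (fun rho => [forall j in Q, rho j == tau j]%:R * h rho) =
  (\prod_(j in Q) w (tau j)) * prodE (fun rho => h (upds rho Q tau)).
Proof.
have gen (s : seq I) (k : {ffun I -> O} -> R) : uniq s ->
  prodE (fun rho => (all (fun j => rho j == tau j) s)%:R * k rho) =
  (\prod_(j <- s) w (tau j)) *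
    prodE (fun rho => k (upds rho [set x in s] tau)).
  elim: s k => [|j s IH] k /=.
    rewrite big_nil !mul1r => _; apply: eq_prodE => rho; rewrite mul1r.
    by congr k; apply/ffunP=> i; rewrite !ffunE inE.
  case/andP=> js us; rewrite (prodE_resample j) (bigD1 (tau j)) //=.
  rewrite [X in _ + X]big1 ?addr0 => [|o no]; last first.
    rewrite (eq_prodE (h := fun=> 0)) ?prodE_cst ?mulr0 // => rho.
    by rewrite ffunE eqxx (negbTE no) mul0r.
  rewrite big_cons -mulrA; congr (_ * _).
  have -> : prodE (fun rho => ((upd rho j (tau j) j == tau j) &&
      all (fun j0 => upd rho j (tau j) j0 == tau j0) s)%:R *
      k (upd rho j (tau j))) =
     prodE (fun rho => (all (fun j => rho j == tau j) s)%:R *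
      (fun r => k (upd r j (tau j))) rho).
    apply: eq_prodE => rho; congr ((nat_of_bool _)%:R * _).
    rewrite [upd rho j (tau j) j]ffunE !eqxx /=; apply/eq_in_all => i si /=.
    by rewrite ffunE; case: (eqVneq i j) => [e|//]; case/negP: js; rewrite -e.
  rewrite IH //; congr (_ * _); apply: eq_prodE => rho; congr k.
  apply/ffunP=> i; rewrite !ffunE !inE; by case: eqP => // ->.
have := gen (enum Q) h (enum_uniq _).
have -> : [set x in enum Q] = Q by apply/setP=> i; rewrite inE mem_enum.
rewrite big_enum /= => <-; apply: eq_prodE => rho; congr ((nat_of_bool _)%:R * _).
apply/forall_inP/allP => H x; first by rewrite mem_enum; apply: H.
by move=> xQ; apply: H; rewrite mem_enum.
Qed.

End ProductExpectation.

Section Restrictions.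
Variable I : finType.
Notation restr := {ffun I -> option bool}.

Definition over (rho tau : restr) : restr :=
  [ffun i => if tau i is Some b then Some b else rho i].

Definition free : restr := [ffun=> None].

Definition fixed (tau : restr) : {set I} := [set i | isSome (tau i)].

(** Terms, that is conjunctions of literals, share the type of restrictions: [T i = Some b] stands
    for the literal [x i = b]. *)
Definition fals (T rho : restr) : bool :=
  [exists i, [&& isSome (T i), isSome (rho i) & T i != rho i]].

Definition live (T rho : restr) : {set I} :=
  [set i | isSome (T i) && ~~ isSome (rho i)].

Definition first_term (G : seq restr) (rho : restr) : option restr :=
  ohead [seq T <- G | ~~ fals T rho].

Definition extends (rho rho' : restr) : Prop :=
  forall i b, rho i = Some b -> rho' i = Some b.

Definition up_closed (U : pred restr) : Prop :=
  forall rho rho', extends rho rho' -> U rho -> U rho'.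

Lemma overA rho sigma tau : over rho (over sigma tau) = over (over rho sigma) tau.
Proof. by apply/ffunP=> i; rewrite !ffunE; case: (tau i). Qed.

Lemma over_free rho : over rho free = rho.
Proof. by apply/ffunP=> i; rewrite !ffunE. Qed.

Lemma fixed_over rho tau : fixed (over rho tau) = fixed rho :|: fixed tau.
Proof.
by apply/setP=> i; rewrite !inE !ffunE; case: (tau i); case: (rho i).
Qed.

Lemma fixed_free : fixed free = set0.
Proof. by apply/setP=> i; rewrite !inE ffunE. Qed.

Lemma live_fixed T rho : [disjoint live T rho & fixed rho].
Proof.
rewrite -setI_eq0; apply/eqP/setP=> i; rewrite !inE.
by case: (isSome (rho i)); rewrite ?andbF.
Qed.

Lemma first_term_mem G rho T : first_term G rho = Some T -> T \in G.
Proof.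
rewrite /first_term => h; have : T \in [seq T <- G | ~~ fals T rho].
  by case: [seq _ <- _ | _] h => //= a l [->]; rewrite inE eqxx.
by rewrite mem_filter => /andP[].
Qed.

Lemma first_term_fals G rho T : first_term G rho = Some T -> ~~ fals T rho.
Proof.
rewrite /first_term => h; have : T \in [seq T <- G | ~~ fals T rho].
  by case: [seq _ <- _ | _] h => //= a l [->]; rewrite inE eqxx.
by rewrite mem_filter => /andP[].
Qed.

Lemma fals_extends T rho rho' : extends rho rho' -> fals T rho -> fals T rho'.
Proof.
move=> e /existsP[i /and3P[h1 h2 h3]]; apply/existsP; exists i.
by case E: (rho i) h2 h3 => [b|//] _; rewrite h1 (e _ _ E).
Qed.

Lemma first_term_extends G rho rho' T : extends rho rho' ->
  first_term G rho = Some T -> ~~ fals T rho' -> first_term G rho' = Some T.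
Proof.
move=> e; rewrite /first_term; elim: G => //= T' G IH.
case: (boolP (fals T' rho)) => h /=.
  by rewrite (fals_extends e h); apply: IH.
by move=> [->] ->.
Qed.

Lemma extends_over rho rho' tau : extends rho rho' ->
  extends (over rho tau) (over rho' tau).
Proof. by move=> e i b; rewrite !ffunE; case: (tau i) => // h; apply: e. Qed.

Lemma extends_upds_free rho rho' (Q : {set I}) : extends rho rho' ->
  extends (upds rho Q free) (upds rho' Q free).
Proof. by move=> e i b; rewrite !ffunE; case: ifP => // _; apply: e. Qed.

Lemma upds_free_extends rho (Q : {set I}) : extends (upds rho Q free) rho.
Proof. by move=> i b; rewrite !ffunE; case: ifP. Qed.

Lemma over_upds_free rho (Q : {set I}) tau : Q \subset fixed tau ->
  over (upds rho Q free) tau = over rho tau.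
Proof.
move=> /subsetP s; apply/ffunP=> i; rewrite !ffunE.
case E: (tau i) => [//|]; case: ifP => // /s; by rewrite inE E.
Qed.

(* Two assignments to the variables of the path are carried along: [alpha]
   drives the search for the next term, [beta] holds the answers that are
   kept once the path is complete. *)
Fixpoint path_sum (R : realFieldType) (Y : restr -> R) (n rem : nat)
    (G : seq restr) (rho alpha beta : restr) : R :=
  if rem == 0%N then Y (over rho beta) else
  if n is n'.+1 then
    if first_term G (over rho alpha) is Some T then
      let Q := live T (over rho alpha) in
      if Q == set0 then 0 else
      \sum_(pi | fixed pi == Q) \sum_(a | fixed a == Q)
        path_sum Y n' (rem - #|Q|) G rho (over alpha pi) (over beta a)
    else 0
  else 0.

(** The canonical decision tree of the DNF [G] queries all live variables of the first surviving
    term, block after block; this asks for a branch with at least [rem] queries. [n] is fuel, and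
    truncated subtraction lets the last block overshoot. *)
Fixpoint long_path (n rem : nat) (G : seq restr) (rho : restr) : bool :=
  (rem == 0%N) ||
  if n is n'.+1 then
    if first_term G rho is Some T then
      let Q := live T rho in
      (Q != set0) &&
      [exists pi, (fixed pi == Q) && long_path n' (rem - #|Q|) G (over rho pi)]
    else false
  else false.

Section PathSum.
Variables (R : realFieldType) (Y : restr -> R).
Hypothesis Y_ge0 : forall rho, 0 <= Y rho.

Lemma path_sum_ge0 n rem G rho alpha beta :
  0 <= path_sum Y n rem G rho alpha beta.
Proof.
elim: n rem alpha beta => [|n IH] rem alpha beta /=; case: ifP => // _.
case: first_term => // T; case: ifP => // _.
by apply: sumr_ge0 => pi _; apply: sumr_ge0 => a _.
Qed.

(** Serves to free in [rho] a block that both assignments overwrite anyway. *)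
Lemma path_sum_congr n rem G rho rho' alpha alpha' beta beta' :
  over rho alpha = over rho' alpha' -> over rho beta = over rho' beta' ->
  path_sum Y n rem G rho alpha beta = path_sum Y n rem G rho' alpha' beta'.
Proof.
elim: n rem alpha beta alpha' beta' =>
  [|n IH] rem alpha beta alpha' beta' ea eb /=; rewrite eb // ea.
case: ifP => // _; case: first_term => // T; case: ifP => // _.
apply: eq_bigr => pi _; apply: eq_bigr => a _.
by apply: IH; rewrite !overA ?ea ?eb.
Qed.

Hypothesis Y_query : forall rho (Q : {set I}), [disjoint Q & fixed rho] ->
  Y rho <= \sum_(a | fixed a == Q) Y (over rho a).

(** The answers [pi] of the long branch select one summand of the outer sum; querying the same
    variables in [Y] produces the inner sum over [a]. *)
Lemma long_path_le n rem G rho alpha beta : fixed alpha = fixed beta ->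
  long_path n rem G (over rho alpha) ->
  Y (over rho beta) <= path_sum Y n rem G rho alpha beta.
Proof.
elim: n rem alpha beta => [|n IH] rem alpha beta eab /=; case: ifP => //= _.
case: first_term => // T /andP[Q0 /existsP[pi /andP[/eqP piQ lp]]].
set Q := live T _ in Q0 piQ *; rewrite (negbTE Q0).
rewrite (bigD1 pi) /= ?piQ ?eqxx //.
apply: le_trans (_ : \sum_(a | fixed a == Q) Y (over (over rho beta) a) <= _).
  apply: Y_query; rewrite fixed_over -eab -fixed_over; exact: live_fixed.
apply: ler_wpDr.
  by apply: sumr_ge0 => ? _; apply: sumr_ge0 => ? _; apply: path_sum_ge0.
apply: ler_sum => a /eqP aQ; rewrite -overA; apply: IH.
  by rewrite !fixed_over eab piQ aQ.
by rewrite overA.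
Qed.

End PathSum.

Section Expectation.
Variables (R : realFieldType) (p : R).
Hypothesis p01 : 0 <= p < 1.

Definition restr_weight (o : option bool) : R :=
  if o is Some _ then (1 - p) / 2 else p.

Lemma restr_weight_ge0 o : 0 <= restr_weight o.
Proof. by case/andP: p01 => p0 p1; case: o => [b|] //=; lra. Qed.

Lemma restr_weight_sum1 : \sum_o restr_weight o = 1.
Proof.
have -> : \sum_o restr_weight o =
   restr_weight None + (restr_weight (Some true) + restr_weight (Some false)).
  rewrite (bigD1 None) //=; congr (_ + _).
  rewrite (bigD1 (Some true)) //= (bigD1 (Some false)) //=.
  by rewrite big1 ?addr0 // => -[[]|].
by rewrite /=; field.
Qed.

Definition rexp (g : restr -> R) : R := prodE restr_weight g.

Lemma ler_rexp g h : (forall rho, g rho <= h rho) -> rexp g <= rexp h.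
Proof. by apply: ler_prodE; apply: restr_weight_ge0. Qed.

Lemma rexp_ge0 g : (forall rho, 0 <= g rho) -> 0 <= rexp g.
Proof. by apply: prodE_ge0; apply: restr_weight_ge0. Qed.

Lemma rexp_fix (Q : {set I}) (tau : restr) h :
  rexp (fun rho => [forall j in Q, rho j == tau j]%:R * h rho) =
  (\prod_(j in Q) restr_weight (tau j)) * rexp (fun rho => h (upds rho Q tau)).
Proof. exact: (prodE_fix restr_weight_sum1). Qed.

Lemma rexp_eq0 g : (forall rho, g rho = 0) -> rexp g = 0.
Proof.
by move=> g0; apply: big1 => rho _; rewrite g0 mulr0.
Qed.

Lemma rexp_cst c : rexp (fun=> c) = c.
Proof. exact: (prodE_cst _ restr_weight_sum1). Qed.

Lemma sum_subset_expr (V : {set I}) (y : R) :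
  \sum_(Q : {set I} | Q \subset V) y ^+ #|Q| = (1 + y) ^+ #|V|.
Proof.
transitivity (\prod_i ((if i \in V then y else 0) + 1)); last first.
  rewrite -prodr_const [RHS]big_mkcond; apply: eq_bigr => i _.
  by case: ifP => _; rewrite ?add0r // addrC.
rewrite bigA_distr big_mkcond; apply: eq_bigr => Q _.
rewrite -(big_mkcond (mem Q)) /=.
case: ifP => [/subsetP s|/negbT/subsetPn[i iQ iV]].
  rewrite -prodr_const; apply: eq_bigr => i /s ->; done.
by rewrite (bigD1 i) //= (negbTE iV) mul0r.
Qed.

Lemma card_fixed (Q : {set I}) : #|[pred a : restr | fixed a == Q]| = (2 ^ #|Q|)%N.
Proof.
transitivity (\prod_i \sum_(o : option bool | isSome o == (i \in Q)) 1)%N.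
  rewrite bigA_distr_big_dep /= -sum1_card; apply: eq_big => [a|a _]; last first.
    by rewrite big1.
  rewrite unfold_in /=; apply/eqP/familyP => [<- i|h].
    by rewrite unfold_in /= inE eqxx.
  by apply/setP=> i; rewrite inE; apply/eqP; apply: h.
rewrite -prod_nat_const [RHS]big_mkcond; apply: eq_bigr => i _.
case: (i \in Q).
  by rewrite (bigD1 (Some true)) //= (bigD1 (Some false)) //= big1 // => -[[]|].
by rewrite (bigD1 None) //= big1 // => -[[]|].
Qed.

Lemma prod_weight_fixed (Q : {set I}) (tau : restr) : Q \subset fixed tau ->
  \prod_(j in Q) restr_weight (tau j) = ((1 - p) / 2) ^+ #|Q|.
Proof.
move=> /subsetP s; rewrite -prodr_const; apply: eq_bigr => i /s.
by rewrite inE; case: (tau i).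
Qed.

Lemma prod_weight_free (Q : {set I}) :
  \prod_(j in Q) restr_weight (free j) = p ^+ #|Q|.
Proof. by rewrite -prodr_const; apply: eq_bigr => i _; rewrite ffunE. Qed.

Section PathSumBound.
Variables (Y : restr -> R) (G : seq restr) (w : nat) (gamma kappa : R) (c : nat).
Hypothesis Y_ge0 : forall rho, 0 <= Y rho.
Hypothesis G_width : forall T, T \in G -> (#|fixed T| <= w)%N.
Hypothesis gamma01 : 0 < gamma <= 1.
Hypothesis kappa_ge0 : 0 <= kappa.
Hypothesis p_small : (1 + 8 * p / ((1 - p) * gamma)) ^+ w <= 2.

Hypothesis Y_bound : forall U beta, up_closed U -> (c <= #|fixed beta|)%N ->
  rexp (fun rho => (U rho)%:R * Y (over rho beta)) <=
  kappa * rexp (fun rho => (U rho)%:R).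

Let event (alpha : restr) T (Q : {set I}) (rho : restr) : bool :=
  (first_term G (over rho alpha) == Some T) && (live T (over rho alpha) == Q).

(* Reading "the live variables of the first surviving term T are exactly Q" on
   the restriction that frees Q makes it an up-closed event, because T is then
   satisfied outside Q. Setting Q according to T turns it into an event on
   which T is still the first surviving term, so that T is determined. *)
Lemma event_up_closed alpha T (Q : {set I}) U : up_closed U -> [disjoint Q & fixed alpha] ->
  up_closed (fun rho => U (upds rho Q free) && event alpha T Q (upds rho Q free)).
Proof.
move=> upU dQ rho rho' e /andP[UQ /andP[/eqP fT /eqP lT]].
have e1 := extends_upds_free (Q := Q) e; have e2 := extends_over (tau := alpha) e1.
rewrite (upU _ _ e1 UQ) /=.
set m := over _ alpha in fT lT e2; set m' := over (upds rho' Q free) alpha in e2 *.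
have out i : isSome (T i) -> i \notin Q -> m i = T i.
  move=> Ti iQ; move: (first_term_fals fT) => /existsPn /(_ i).
  have : i \notin live T m by rewrite lT.
  by rewrite inE Ti /= negbK => ->; rewrite negbK => /eqP.
have mQ i : i \in Q -> m' i = None.
  move=> iQ; rewrite !ffunE iQ.
  have := disjointFr dQ iQ; rewrite inE; by case: (alpha i).
have m'T i : isSome (T i) -> i \notin Q -> m' i = T i.
  move=> Ti iQ; case E: (T i) Ti => [b|//] _.
  by apply: e2; rewrite out // E.
apply/andP; split; apply/eqP.
  apply: first_term_extends e2 fT _; apply/existsPn => i; apply/negP => /and3P[h1 h2].
  case: (boolP (i \in Q)) => iQ; first by rewrite (mQ _ iQ) in h2.
  by rewrite (m'T _ h1 iQ) eqxx.
rewrite -lT; apply/setP=> i; rewrite lT inE.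
case: (boolP (i \in Q)) => iQ.
  rewrite (mQ _ iQ) andbT; have : i \in live T m by rewrite lT.
  by rewrite inE => /andP[].
by case E: (T i) => [b|] //=; rewrite (m'T _ _ iQ) E.
Qed.

(** Induction along the branch. When [0 < rem], at least one variable is queried before [Y] is
    evaluated, so [Y_bound] may start one variable deeper than [beta]; the induction in [switching]
    rests on this. *)
Lemma path_sum_bound n rem U alpha beta : up_closed U ->
  fixed alpha = fixed beta -> (c <= #|fixed beta| + (0 < rem)%N)%N ->
  rexp (fun rho => (U rho)%:R * path_sum Y n rem G rho alpha beta) <=
  kappa * gamma ^+ rem * rexp (fun rho => (U rho)%:R).
Proof.
case/andP: gamma01 => g0 g1; case/andP: p01 => p0 p1.
have PU0 V : 0 <= rexp (fun rho => (V rho : bool)%:R) by apply: rexp_ge0.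
elim: n rem U alpha beta => [|n IH] rem U alpha beta upU eab hc /=.
  case: (eqVneq rem 0%N) => [r0|_].
    by rewrite r0 ltnn addn0 in hc; rewrite r0 expr0 mulr1; apply: Y_bound.
  rewrite [leLHS](_ : _ = 0) ?mulr_ge0 ?exprn_ge0 ?(ltW g0) //.
  by apply: rexp_eq0 => rho; rewrite mulr0.
case: (eqVneq rem 0%N) => [r0|r0].
  by rewrite r0 ltnn addn0 in hc; rewrite r0 expr0 mulr1; apply: Y_bound.
set S := fun rho (T : restr) (Q : {set I}) => \sum_(pi | fixed pi == Q) \sum_(a | fixed a == Q)
   path_sum Y n (rem - #|Q|) G rho (over alpha pi) (over beta a).
(* Cost per variable of a block: 4 for the choices of [pi] and [a], the ratio [2 * p / (1 - p)]
   between leaving the variable free and setting it as [T] does, and [1 / gamma] for the decrease of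
   [rem]. *)
pose y : R := 8 * p / ((1 - p) * gamma).
have y0 : 0 <= y by rewrite /y divr_ge0 ?mulr_ge0 // ?(ltW g0) //; lra.
pose ff T (Q : {set I}) rho : R := (U rho)%:R *
  ((first_term G (over rho alpha) == Some T) && (Q \subset fixed T))%:R.
(* The random term and block become summation indices [T] and [Q], of which only the actual pair
   contributes. *)
have dec rho : (U rho)%:R * (if first_term G (over rho alpha) is Some T then
      if live T (over rho alpha) == set0 then 0 else S rho T (live T (over rho alpha)) else 0) =
   \sum_(T : restr | T \in G) \sum_(Q : {set I} | (Q != set0) && [disjoint Q & fixed alpha])
       \sum_(pi | fixed pi == Q) \sum_(a | fixed a == Q)
       (U rho && event alpha T Q rho)%:R *
         path_sum Y n (rem - #|Q|) G rho (over alpha pi) (over beta a).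
  case Ef: (first_term G (over rho alpha)) => [T0|]; last first.
    rewrite mulr0 big1 // => T _; rewrite big1 // => Q _; rewrite big1 // => pi _.
    by rewrite big1 // => a _; rewrite /event Ef andbF mul0r.
  rewrite (bigD1 T0) ?(first_term_mem Ef) //= [X in _ = _ + X]big1 ?addr0; last first.
    move=> T /andP[_ nT]; rewrite big1 // => Q _; rewrite big1 // => pi _.
    rewrite big1 // => a _; rewrite /event Ef.
    by rewrite [Some _ == _]eq_sym (inj_eq Some_inj) (negbTE nT) andbF mul0r.
  set L := live T0 _; case: ifP => [/eqP L0|L0].
    rewrite mulr0 big1 // => Q /andP[Q0 _]; rewrite big1 // => pi _.
    rewrite big1 // => a _; rewrite /event -/L L0.
    by rewrite [set0 == _]eq_sym (negbTE Q0) !andbF mul0r.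
  have dL : [disjoint L & fixed alpha].
    by apply: disjointWr (live_fixed T0 _); rewrite fixed_over subsetUr.
  rewrite (bigD1 L) ?L0 ?dL //= [X in _ = _ + X]big1 ?addr0; last first.
    move=> Q /andP[_ nQ]; rewrite big1 // => pi _.
    rewrite big1 // => a _; rewrite /event -/L.
    by rewrite [L == _]eq_sym (negbTE nQ) !andbF mul0r.
  rewrite /S mulr_sumr; apply: eq_bigr => pi _; rewrite mulr_sumr.
  by apply: eq_bigr => a _; rewrite /event Ef !eqxx !andbT.
rewrite /rexp (eq_prodE _ dec) prodE_sum.
have term T (Q : {set I}) : Q != set0 -> [disjoint Q & fixed alpha] ->
   rexp (fun rho => \sum_(pi | fixed pi == Q) \sum_(a | fixed a == Q)
       (U rho && event alpha T Q rho)%:R *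
         path_sum Y n (rem - #|Q|) G rho (over alpha pi) (over beta a))
   <= rexp (fun rho => kappa * gamma ^+ rem * (ff T Q rho * y ^+ #|Q|)).
  move=> Q0 dQ; set q := #|Q|.
  pose U' : pred restr := fun rho => U (upds rho Q free) && event alpha T Q (upds rho Q free).
  have upU' : up_closed U' by apply: event_up_closed.
  have q1 : (0 < q)%N by rewrite /q card_gt0.
  set X := rexp (fun rho => (U' rho)%:R).
  have X0 : 0 <= X by exact: PU0.
  (* The event forces [Q] to be free, which costs [p ^+ q]. What remains does not look at [Q], so
     the induction hypothesis applies with [U'] as the new condition. *)
  have step pi a : fixed pi == Q -> fixed a == Q ->
     rexp (fun rho => (U rho && event alpha T Q rho)%:R *
        path_sum Y n (rem - q) G rho (over alpha pi) (over beta a)) <=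
     p ^+ q * (kappa * gamma ^+ (rem - q) * X).
    move=> /eqP piQ /eqP aQ.
    have -> : rexp (fun rho => (U rho && event alpha T Q rho)%:R *
        path_sum Y n (rem - q) G rho (over alpha pi) (over beta a)) =
        rexp (fun rho => [forall j in Q, rho j == free j]%:R *
         ((U rho && event alpha T Q rho)%:R *
        path_sum Y n (rem - q) G rho (over alpha pi) (over beta a))).
      apply: eq_prodE => rho; case: (boolP [forall j in Q, _]) => [_|/forall_inPn[i iQ hi]].
        by rewrite mul1r.
      rewrite mul0r [_ && _](_ : _ = false) ?mul0r //.
      apply/negbTE; rewrite negb_and; apply/orP; right.
      apply/negP => /andP[_ /eqP lQ].
      have : i \in live T (over rho alpha) by rewrite lQ.
      rewrite inE => /andP[_]; rewrite !ffunE => h; case/negP: hi.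
      by rewrite ffunE; case: (alpha i) h => // ; case: (rho i).
    rewrite rexp_fix prod_weight_free -/q; apply: ler_wpM2l; first by rewrite exprn_ge0.
    apply: le_trans (IH (rem - q)%N U' (over alpha pi) (over beta a) upU' _ _).
    - apply: ler_rexp => rho; rewrite le_eqVlt; apply/orP; left; apply/eqP.
      congr (_ * _); apply: path_sum_congr; apply: over_upds_free;
        by rewrite fixed_over ?piQ ?aQ subsetUr.
    - by rewrite !fixed_over eab piQ aQ.
    - rewrite fixed_over aQ cardsU; have /eqP := disjoint_setI0 dQ.
      rewrite eab setIC => /eqP ->; rewrite cards0 subn0 -/q.
      apply: leq_trans hc _; rewrite -addnA leq_add2l.
      by case: (0 < rem)%N => //; apply: leq_trans q1 (leq_addr _ _).
  have total : rexp (fun rho => \sum_(pi | fixed pi == Q) \sum_(a | fixed a == Q)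
       (U rho && event alpha T Q rho)%:R *
         path_sum Y n (rem - #|Q|) G rho (over alpha pi) (over beta a))
     <= 4 ^+ q * (p ^+ q * (kappa * gamma ^+ (rem - q) * X)).
    rewrite /rexp prodE_sum; under eq_bigr => pi _ do rewrite prodE_sum.
    apply: (@le_trans _ _ (\sum_(pi | fixed pi == Q) \sum_(a | fixed a == Q)
      (p ^+ q * (kappa * gamma ^+ (rem - q) * X)))).
      by apply: ler_sum => pi hpi; apply: ler_sum => a ha; apply: step.
    rewrite sumr_const sumr_const !card_fixed -mulrnA -/q -[leLHS]mulr_natl.
    by rewrite natrM natrX -exprMn -natrM.
  apply: le_trans total _.
  have XF : ((1 - p) / 2) ^+ q * X <= rexp (ff T Q).
    case: (boolP (Q \subset fixed T)) => QT; last first.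
      have -> : X = 0.
        apply: rexp_eq0 => rho.
        rewrite /U' [_ && _](_ : _ = false) //; apply/negbTE/negP => /andP[_ /andP[_ /eqP h]].
        case/negP: QT; rewrite -h; apply/subsetP=> i; rewrite !inE => /andP[]; done.
      by rewrite mulr0; apply: rexp_ge0 => rho; rewrite /ff mulr_ge0.
    rewrite -(prod_weight_fixed QT).
    have -> : X = rexp (fun rho => (U' (upds rho Q T))%:R).
      apply: eq_prodE => rho; congr ((nat_of_bool _)%:R).
      have e : upds (upds rho Q T) Q free = upds rho Q free.
        by apply/ffunP=> i; rewrite !ffunE; case: (i \in Q).
      by rewrite /U' e.
    rewrite -(rexp_fix _ _ (fun rho => (U' rho)%:R)); apply: ler_rexp => rho.
    case: (boolP [forall j in Q, _]) => [/forall_inP hT|_]; last by rewrite mul0r /ff mulr_ge0.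
    rewrite mul1r /ff QT andbT /U'; case: (boolP (_ && _)); last first.
      by rewrite mulr_ge0.
    move=> /andP[hU /andP[/eqP hf /eqP hl]].
    have e1 := @upds_free_extends rho Q.
    rewrite (upU _ _ e1 hU) (first_term_extends (extends_over e1) hf) ?eqxx ?mul1r //.
    apply/existsPn => i; apply/negP => /and3P[h1 h2 h3].
    case: (boolP (i \in Q)) => iQ.
      have := disjointFr dQ iQ; rewrite inE => ai.
      by move: h3; rewrite !ffunE (eqP (hT _ iQ)); case: (alpha i) ai => //; rewrite eqxx.
    have := first_term_fals hf => /existsPn /(_ i).
    have : i \notin live T (over (upds rho Q free) alpha) by rewrite hl.
    rewrite inE h1 /= negbK => -> /=; rewrite negbK => /eqP h4.
    by case/negP: h3; rewrite h4 !ffunE (negbTE iQ).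
  rewrite /rexp prodEZ.
  have -> : prodE restr_weight (fun rho => ff T Q rho * y ^+ #|Q|) = y ^+ q * rexp (ff T Q).
    by rewrite -prodEZ; apply: eq_prodE => rho; rewrite mulrC.
  apply: le_trans (_ : kappa * gamma ^+ rem * (y ^+ q * (((1 - p) / 2) ^+ q * X)) <= _).
    rewrite [y ^+ q * (_ * _)]mulrA -exprMn.
    have -> : y * ((1 - p) / 2) = 4 * p / gamma by rewrite /y; field; lra.
    have -> : (4 * p / gamma) ^+ q = 4 ^+ q * p ^+ q / gamma ^+ q by rewrite !exprMn exprVn.
    have -> : kappa * gamma ^+ rem * (4 ^+ q * p ^+ q / gamma ^+ q * X) =
       (gamma ^+ rem / gamma ^+ q) * (kappa * 4 ^+ q * p ^+ q * X) by ring.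
    have -> : 4 ^+ q * (p ^+ q * (kappa * gamma ^+ (rem - q) * X)) =
       gamma ^+ (rem - q) * (kappa * 4 ^+ q * p ^+ q * X) by ring.
    apply: ler_wpM2r; first by rewrite !mulr_ge0 ?exprn_ge0.
    rewrite ler_pdivlMr ?exprn_gt0 // -exprD; apply: ler_wiXn2l; rewrite ?(ltW g0) //.
    by rewrite addnC -leq_subLR.
  apply: ler_wpM2l; first by rewrite mulr_ge0 ?exprn_ge0 ?(ltW g0).
  by apply: ler_wpM2l; rewrite ?exprn_ge0.
apply: (@le_trans _ _ (\sum_(T | T \in G)
    \sum_(Q : {set I} | (Q != set0) && [disjoint Q & fixed alpha])
    rexp (fun rho => kappa * gamma ^+ rem * (ff T Q rho * y ^+ #|Q|)))).
  apply: ler_sum => T _; rewrite prodE_sum; apply: ler_sum => Q /andP[Q0 dQ].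
  exact: term.
rewrite -prodEZ.
under eq_bigr => T _ do rewrite -prodE_sum.
rewrite -prodE_sum; apply: ler_rexp => rho.
under eq_bigr => T _ do rewrite -mulr_sumr.
rewrite -mulr_sumr; apply: ler_wpM2l; first by rewrite mulr_ge0 ?exprn_ge0 ?(ltW g0).
rewrite /ff.
case Ef: (first_term G (over rho alpha)) => [T0|]; last first.
  by rewrite big1 // => T _; rewrite big1 // => Q _; rewrite mulr0 mul0r.
rewrite (bigD1 T0) ?(first_term_mem Ef) //= [X in _ + X]big1 ?addr0; last first.
  move=> T /andP[_ nT]; rewrite big1 // => Q _.
  by rewrite (inj_eq Some_inj) eq_sym (negbTE nT) mulr0 mul0r.
case: (U rho); last by rewrite big1 // => Q _; rewrite !mul0r.
under eq_bigr => Q _ do rewrite mul1r eqxx andTb.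
(* As the empty block is excluded, this sum is [(1 + y) ^+ #|fixed T0| - 1], at most 1 by
   [p_small]. *)
apply: (@le_trans _ _ (\sum_(Q : {set I} | (Q \subset fixed T0) && (Q != set0)) y ^+ #|Q|)).
  rewrite [leLHS]big_mkcond [leRHS]big_mkcond; apply: ler_sum => Q _.
  have yq : 0 <= y ^+ #|Q| by rewrite exprn_ge0.
  case: (Q \subset _); case: (Q != set0); case: [disjoint _ & _] => //=;
    by rewrite ?mul1r ?mul0r.
have := sum_subset_expr (fixed T0) y; rewrite (bigD1 set0) ?sub0set //= cards0 expr0.
have : (1 + y) ^+ #|fixed T0| <= 2.
  apply: le_trans p_small; apply: ler_weXn2l; rewrite ?G_width ?(first_term_mem Ef) //; lra.
lra.
Qed.

End PathSumBound.

(** Bernoulli's inequality gives [1 / 2 <= (1 - y) ^+ w], and [(1 + y) * (1 - y) <= 1]. *)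
Lemma expr1D_le2 (y : R) (w : nat) : 0 <= y -> w%:R * y <= 2^-1 ->
  (1 + y) ^+ w <= 2.
Proof.
move=> y0 wy.
have bern : 1 - w%:R * y <= (1 - y) ^+ w \/ 1 < y.
  case: (leP y 1) => y1; [left|by right].
  elim: w wy => [|w IH] wy; first by rewrite mul0r subr0 expr0.
  have wy' : w%:R * y <= 2^-1 by apply: le_trans wy; rewrite ler_wpM2r // ler_nat.
  have wy0 : 0 <= w%:R * y by rewrite mulr_ge0.
  rewrite exprS; apply: (@le_trans _ _ ((1 - y) * (1 - w%:R * y))).
    rewrite -natr1; have : 0 <= w%:R * y * y by rewrite mulr_ge0. nra.
  by apply: ler_wpM2l; rewrite ?subr_ge0 // IH.
case: w wy bern => [|w] wy bern; first by rewrite expr0 ler1n.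
have y2 : y <= 2^-1.
  by apply: le_trans wy; rewrite -[leLHS]mul1r ler_wpM2r // ler1n.
case: bern => [bern|]; last by lra.
have h : (1 + y) ^+ w.+1 * (1 - y) ^+ w.+1 <= 1.
  by rewrite -exprMn exprn_ile1 //; nra.
have h0 : 0 <= (1 + y) ^+ w.+1 by rewrite exprn_ge0 //; lra.
have : (1 + y) ^+ w.+1 * 2^-1 <= 1.
  by apply: le_trans h; apply: ler_wpM2l => //; lra.
lra.
Qed.

(* The multi-switching lemma, for an abstract cost Y that at most doubles with
   every queried variable. *)
Lemma switching (Y : restr -> R) (Gs : seq (seq restr)) (l w : nat) (B : R) :
  (forall rho, 0 <= Y rho) ->
  (forall rho (Q : {set I}), [disjoint Q & fixed rho] ->
    Y rho <= \sum_(a | fixed a == Q) Y (over rho a)) ->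
  (forall G T, G \in Gs -> T \in G -> (#|fixed T| <= w)%N) ->
  (0 < l)%N -> (0 < w)%N -> (2 * size Gs <= 4 ^ l)%N -> 128 * w%:R * p <= 1 ->
  0 <= B ->
  (forall rho, (forall G, G \in Gs -> ~~ long_path l l G rho) -> Y rho <= B) ->
  rexp Y <= 2 * B.
Proof.
move=> Y0 Yq Gw l0 w0 Ml pw B0 YB; case/andP: p01 => p0 p1.
have w1 : (1 : R) <= w%:R by rewrite ler1n.
have p2 : p <= 2^-1 by nra.
(* With [gamma = 1 / 4] and [p <= 1 / 2] the base is at most [1 + 64 * p]; the 128 makes
   [w * 64 * p] at most 1/2. *)
have psmall : (1 + 8 * p / ((1 - p) * 4^-1)) ^+ w <= 2.
  apply: expr1D_le2; first by rewrite divr_ge0 // ?mulr_ge0 //; lra.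
  rewrite mulrA ler_pdivrMr; last by nra.
  nra.
(* Backward induction on the number of variables fixed by [beta]. A long branch leads to [Y] with
   more variables fixed, where the bound [2 * B] is already known; weighted by [4^-1 ^+ l] and
   summed over [Gs], these branches contribute at most [B], and the remaining restrictions another
   [B]. *)
have claim n : forall beta, (#|I| < n + #|fixed beta|)%N -> forall U, up_closed U ->
    rexp (fun rho => (U rho)%:R * Y (over rho beta)) <= 2 * B * rexp (fun rho => (U rho)%:R).
  elim: n => [|n IH] beta hn U upU.
    by move: hn; rewrite add0n ltnNge max_card.
  have hb (G : seq restr) : G \in Gs ->
     rexp (fun rho => (U rho)%:R * path_sum Y l l G rho beta beta) <=
     2 * B * 4^-1 ^+ l * rexp (fun rho => (U rho)%:R).
    move=> GGs; apply: (@path_sum_bound Y G w 4^-1 (2 * B) #|fixed beta|.+1) => //.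
    - by move=> T; apply: Gw.
    - by lra.
    - by rewrite mulr_ge0.
    - by move=> V b upV hc; apply: IH => //; lia.
    - by rewrite l0 addn1.
  apply: (@le_trans _ _ (rexp (fun rho => B * (U rho)%:R +
     \sum_(G <- Gs) (U rho)%:R * path_sum Y l l G rho beta beta))).
    apply: ler_rexp => rho; rewrite mulrC -mulr_sumr [X in _ <= _ + X]mulrC -mulrDl.
    apply: ler_wpM2r => //.
    case: (boolP (all (fun G => ~~ long_path l l G (over rho beta)) Gs)) => [/allP h|/allPn[G GGs]].
      apply: ler_wpDr; last exact: YB.
      by apply: sumr_ge0 => G _; apply: path_sum_ge0.
    rewrite negbK => lp; apply: ler_wpDl => //.
    rewrite (big_rem G) //=; apply: ler_wpDr.
      by apply: sumr_ge0 => ? _; apply: path_sum_ge0.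
    exact: long_path_le.
  rewrite /rexp prodED prodEZ prodE_sum -!/(rexp _).
  set PU := rexp (fun rho => (U rho)%:R).
  have PU0 : 0 <= PU by apply: rexp_ge0.
  apply: (@le_trans _ _ (B * PU + \sum_(G <- Gs) 2 * B * 4^-1 ^+ l * PU)).
    by rewrite lerD2l big_seq [leRHS]big_seq; apply: ler_sum => G; apply: hb.
  rewrite big_const_seq count_predT iter_addr_0 -[X in _ + X <= _]mulr_natl.
  have M1 : (size Gs)%:R * 4^-1 ^+ l <= 2^-1 :> R.
    rewrite exprVn ler_pdivrMr ?exprn_gt0 // -ler_pdivrMl ?invr_gt0 // invrK.
    by rewrite -natrX -natrM ler_nat.
  have := ler_wpM2r (mulr_ge0 B0 PU0) M1; nra.
have := claim #|I|.+1 free _ xpredT; rewrite fixed_free cards0 addn0 ltnSn => /(_ isT).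
have -> : rexp (fun rho => (xpredT rho)%:R) = 1 by apply: rexp_cst.
rewrite mulr1 => h; apply: le_trans (h _); last by [].
by apply: ler_rexp => rho; rewrite mul1r over_free.
Qed.

End Expectation.
End Restrictions.

(** * Decision trees *)

Section DecisionTrees.
Variable I : finType.
Notation restr := {ffun I -> option bool}.
Notation cube := {ffun I -> bool}.

Definition overwrite (rho : restr) (x : cube) : cube :=
  [ffun i => if rho i is Some b then b else x i].

Definition sat (T : restr) (x : cube) : bool :=
  [forall i, isSome (T i) ==> (T i == Some (x i))].

Definition dnf (G : seq restr) (x : cube) : bool := has (fun T => sat T x) G.

Lemma overwrite_free x : overwrite (free I) x = x.
Proof. by apply/ffunP=> i; rewrite !ffunE. Qed.

Lemma overwrite_over rho tau x : overwrite (over rho tau) x = overwrite tau (overwrite rho x).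
Proof. by apply/ffunP=> i; rewrite !ffunE; case: (tau i). Qed.

Lemma overwrite_over_disjoint rho tau x : [disjoint fixed tau & fixed rho] ->
  overwrite (over rho tau) x = overwrite rho (overwrite tau x).
Proof.
move=> d; apply/ffunP=> i; rewrite !ffunE.
case E: (tau i) => [b|//]; have : i \in fixed tau by rewrite inE E.
by move=> /(disjointFr d); rewrite inE; case: (rho i).
Qed.

Lemma overwrite_upd rho i b x : overwrite (upd rho i (Some b)) x = upd (overwrite rho x) i b.
Proof. by apply/ffunP=> j; rewrite !ffunE; case: eqP. Qed.

Lemma overwrite_upd_free i b x : overwrite (upd (free I) i (Some b)) x = upd x i b.
Proof. by rewrite overwrite_upd overwrite_free. Qed.

Lemma upd_upd (x : cube) i b c : upd (upd x i b) i c = upd x i c.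
Proof. by apply/ffunP=> j; rewrite !ffunE; case: eqP. Qed.

Lemma upd_id (x : cube) i : upd x i (x i) = x.
Proof. by apply/ffunP=> j; rewrite !ffunE; case: eqP => // ->. Qed.

(** Being computable by a decision tree of bounded depth, as a property of the function: no tree is
    stored, and after a query the subfunctions ignore the queried coordinate. Values of any type
    allow running several trees at once. *)
Inductive dt (V : Type) : nat -> (cube -> V) -> Prop :=
| dt_leaf n f v : (forall x, f x = v) -> dt n f
| dt_query n f i : (forall b, dt n (fun x => f (upd x i b))) -> dt n.+1 f.

Lemma dt_ext V n (f g : cube -> V) : f =1 g -> dt n f -> dt n g.
Proof.
move=> e h; elim: h g e => {n f} [n f v fv|n f i _ IH] g e.
  by apply: (@dt_leaf _ _ _ v) => x; rewrite -e.
by apply: (@dt_query _ _ _ i) => b; apply: (IH b) => x; apply: e.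
Qed.

Lemma dt_le V n n' (f : cube -> V) : (n <= n')%N -> dt n f -> dt n' f.
Proof.
move=> le h; elim: h n' le => {n f} [n f v fv|n f i _ IH] n' le.
  exact: dt_leaf fv.
by case: n' le => // n' le; apply: (@dt_query _ _ _ i) => b; apply: IH.
Qed.

Lemma dt_overwrite V n (f : cube -> V) rho : dt n f -> dt n (fun x => f (overwrite rho x)).
Proof.
elim=> {n f} [n f v fv|n f i _ IH]; first by apply: (@dt_leaf _ _ _ v).
case E: (rho i) => [b|].
  apply: dt_le (leqnSn n) _; apply: dt_ext (IH b) => x.
  congr f; apply/ffunP=> j; rewrite !ffunE; by case: (eqVneq j i) => [->|//]; rewrite E.
apply: (@dt_query _ _ _ i) => b; apply: dt_ext (IH b) => x.
congr f; apply/ffunP=> j; rewrite !ffunE; by case: (eqVneq j i) => [->|//]; rewrite E.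
Qed.

Lemma dt_upd V n (f : cube -> V) i b : dt n f -> dt n (fun x => f (upd x i b)).
Proof.
move=> /(dt_overwrite (upd (free I) i (Some b))); apply: dt_ext => x.
by rewrite overwrite_upd_free.
Qed.

Lemma dt_comp V V' n (f : cube -> V) (h : V -> V') :
  dt n f -> dt n (fun x => h (f x)).
Proof.
elim=> {n f} [n f v fv|n f i _ IH]; last exact: dt_query IH.
by apply: (@dt_leaf _ _ _ (h v)) => x; rewrite fv.
Qed.

Lemma dt_comp2 V V' V'' n n' (f : cube -> V) (g : cube -> V') (h : V -> V' -> V'') :
  dt n f -> dt n' g -> dt (n + n') (fun x => h (f x) (g x)).
Proof.
move=> hf; elim: hf g => {n f} [n f v fv|n f i _ IH] g hg.
  apply: dt_le (leq_addl n n') _; apply: dt_ext (dt_comp (h v) hg) => x.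
  by rewrite fv.
by rewrite addSn; apply: (@dt_query _ _ _ i) => b; apply: IH; apply: dt_upd.
Qed.

Lemma dt_map (K : Type) V n (s : seq K) (f : K -> cube -> V) :
  (forall k, dt n (f k)) -> dt (size s * n) (fun x => [seq f k x | k <- s]).
Proof.
move=> h; elim: s => [|k s IH] /=; first exact: (@dt_leaf _ _ _ [::]).
by rewrite mulSn; apply: dt_comp2.
Qed.

Lemma dt_ffun (J : finType) V n (f : J -> cube -> bool) (h : {ffun J -> bool} -> V) :
  (forall j, dt n (f j)) -> dt (#|J| * n) (fun x => h [ffun j => f j x]).
Proof.
move=> hf; rewrite cardE; have := dt_map (enum J) hf.
move=> /(dt_comp (fun l : seq bool => h [ffun j => nth false l (index j (enum J))])).
apply: dt_ext => x; congr h; apply/ffunP=> j; rewrite !ffunE.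
by rewrite (nth_map j) ?index_mem ?mem_enum // nth_index ?mem_enum.
Qed.

Lemma dt_set V n (Q : {set I}) (f : cube -> V) :
  (forall pi, fixed pi = Q -> dt n (fun x => f (overwrite pi x))) -> dt (n + #|Q|) f.
Proof.
have [k] := ubnP #|Q|; elim: k Q f => // k IH Q f hk hf.
case: (set_0Vmem Q) => [Q0|[i iQ]].
  rewrite Q0 cards0 addn0; apply: dt_ext (hf (free I) _) => [x|].
    by rewrite overwrite_free.
  by rewrite Q0 fixed_free.
rewrite (cardsD1 i) iQ add1n addnS; apply: (@dt_query _ _ _ i) => b.
apply: IH => [|pi piQ]; first by move: hk; rewrite (cardsD1 i) iQ.
apply: dt_ext (hf (upd pi i (Some b)) _) => [x|].
  by rewrite overwrite_upd.
apply/setP=> j; rewrite inE ffunE; case: eqP => [->|/eqP ij]; first by rewrite iQ.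
by have := congr1 (fun A : {set I} => j \in A) piQ; rewrite !inE ij.
Qed.

(** One term for each branch ending in [true], made of the literals queried along it. *)
Lemma dt_dnf n (f : cube -> bool) : dt n f ->
  exists2 G, (forall T, T \in G -> (#|fixed T| <= n)%N) & dnf G =1 f.
Proof.
elim=> {n f} [n f v fv|n f i _ IH].
  case: v fv => fv; last by exists [::].
  exists [:: free I] => [T|x]; first by rewrite inE => /eqP ->; rewrite fixed_free cards0.
  rewrite fv /dnf /= orbF; apply/forallP=> i; by rewrite ffunE.
have [G0 w0 e0] := IH false; have [G1 w1 e1] := IH true.
pose ext (b : bool) (T : restr) : restr := upd T i (Some b).
exists (map (ext false) G0 ++ map (ext true) G1).
  have hw b T : (#|fixed T| <= n -> #|fixed (ext b T)| <= n.+1)%N.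
    move=> h; apply: (@leq_trans #|i |: fixed T|); last first.
      by rewrite cardsU1; case: (i \notin _); rewrite /= ?add1n ?add0n // ltnW.
    apply: subset_leq_card; apply/subsetP=> j; rewrite !inE ffunE.
    by case: eqP.
  by move=> T; rewrite mem_cat => /orP[] /mapP[T' T'G ->]; apply: hw; [apply: w0|apply: w1].
have satE b T (x : cube) : sat (ext b T) x -> x i = b.
  by move=> /forallP /(_ i); rewrite ffunE eqxx /= => /eqP [->].
have satI b T (x : cube) : x i = b -> sat T x -> sat (ext b T) x.
  move=> xb /forallP h; apply/forallP=> j; rewrite ffunE.
  by case: eqP => [->|_] //=; rewrite xb.
(* [T] may itself fix [i], to a value that [ext] overwrites; moving [x] to that value is harmless
   because the subfunction ignores coordinate [i]. *)
have satU b T (x : cube) : sat (ext b T) x -> exists c, sat T (upd x i c).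
  move=> /forallP h; exists (if T i is Some c then c else x i); apply/forallP=> j.
  have := h j; rewrite !ffunE; case: (eqVneq j i) => [->|//] _.
  by case: (T i) => //= c; rewrite eqxx.
have fe b (G : seq restr) x : (forall y, dnf G y = f (upd y i b)) ->
   has (preim (ext b) (sat^~ x)) G = (x i == b) && f x.
  move=> e; apply/hasP/andP => [[T TG /= h]|[/eqP xb fx]].
    split; first by rewrite (satE _ _ _ h).
    have [c hc] := satU _ _ _ h.
    have : dnf G (upd x i c) by apply/hasP; exists T.
    by rewrite e upd_upd -(satE _ _ _ h) upd_id.
  have : dnf G x by rewrite e -xb upd_id.
  by move=> /hasP[T TG hT]; exists T => //=; apply: satI.
move=> x; rewrite /dnf has_cat !has_map.
by rewrite (fe _ _ _ e0) (fe _ _ _ e1); case: (x i); rewrite ?orbF.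
Qed.

Lemma dnf_has (K : eqType) (s : seq K) n (f : K -> cube -> bool) :
  (forall k, k \in s -> dt n (f k)) ->
  exists2 G, (forall T, T \in G -> (#|fixed T| <= n)%N) &
             forall x, dnf G x = has (fun k => f k x) s.
Proof.
elim: s => [|k s IH] h; first by exists [::].
have [G wG eG] := dt_dnf (h k (mem_head _ _)).
have [G' wG' eG'] := IH (fun k' k's => h k' (mem_behead (s := k :: s) k's)).
exists (G ++ G') => [T|x]; first by rewrite mem_cat => /orP[]; [apply: wG|apply: wG'].
by rewrite /dnf has_cat -!/(dnf _ _) eG eG'.
Qed.

Lemma fals_sat T rho x : fals T rho -> ~~ sat T (overwrite rho x).
Proof.
move=> /existsP[i /and3P[h1 h2 h3]]; apply/forallPn; exists i.
by rewrite h1 ffunE; case: (rho i) h2 h3.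
Qed.

Lemma first_term_None G rho : first_term G rho = None ->
  forall T : restr, T \in G -> fals T rho.
Proof.
rewrite /first_term => h T TG; case: (boolP (fals T rho)) => // nf.
have : T \in [seq T <- G | ~~ fals T rho] by rewrite mem_filter nf.
by case: [seq _ <- _ | _] h.
Qed.

(** The canonical tree itself: a branch stops with [false] when all terms are falsified, and with
    [true] when the first surviving term has no live variable left. *)
Lemma not_long_path_dt n rem G rho : (rem <= n)%N -> ~~ long_path n rem G rho ->
  dt rem (fun x => dnf G (overwrite rho x)).
Proof.
elim: n rem rho => [|n IH] rem rho le /=.
  by move: le; rewrite leqn0 => ->.
rewrite negb_or => /andP[r0]; case E: (first_term G rho) => [T|]; last first.
  move=> _; apply: (@dt_leaf _ _ _ false) => x; apply/hasPn => T TG.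
  by apply: fals_sat; apply: first_term_None E _ TG.
rewrite negb_and negbK => /orP[/eqP l0|/existsPn h].
  apply: (@dt_leaf _ _ _ true) => x; apply/hasP; exists T; first exact: first_term_mem E.
  apply/forallP=> i; apply/implyP=> Ti.
  have : i \notin live T rho by rewrite l0 inE.
  rewrite inE Ti /= negbK => ri.
  have := first_term_fals E => /existsPn /(_ i); rewrite Ti ri /= negbK => /eqP ->.
  by rewrite ffunE; case: (rho i) ri.
(* A block of [rem] or more variables would complete the path at once, whatever the answers. *)
have lt : (#|live T rho| < rem)%N.
  rewrite ltnNge; apply/negP => le2.
  pose pi : restr := [ffun i => if i \in live T rho then Some true else None].
  have piQ : fixed pi = live T rho by apply/setP=> i; rewrite inE ffunE; case: ifP.
  have := h pi; rewrite piQ eqxx /=; move: le2; rewrite -subn_eq0 => /eqP ->.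
  by case: (n).
rewrite -(subnK (ltnW lt)); apply: dt_set => pi piQ.
have := h pi; rewrite piQ eqxx /= => nl.
case: (posnP #|live T rho|) => [q0|q0].
  have l0 : live T rho = set0 by apply/eqP; rewrite -cards_eq0 q0.
  apply: (@dt_leaf _ _ _ true) => x; apply/hasP; exists T; first exact: first_term_mem E.
  apply/forallP=> i; apply/implyP=> Ti.
  have : i \notin live T rho by rewrite l0 inE.
  rewrite inE Ti /= negbK => ri.
  have := first_term_fals E => /existsPn /(_ i); rewrite Ti ri /= negbK => /eqP ->.
  by rewrite ffunE; case: (rho i) ri.
have le' : (rem - #|live T rho| <= n)%N by move: q0 le; lia.
by apply: dt_ext (IH _ _ le' nl) => x; rewrite overwrite_over_disjoint // piQ live_fixed.
Qed.

End DecisionTrees.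

(** * Fourier weights and degree *)

Section Fourier.
Variables (R : realFieldType) (I : finType).
Notation restr := {ffun I -> option bool}.
Notation cube := {ffun I -> bool}.
Implicit Types (f g : cube -> R) (S T : {set I}) (x : cube).

Definition chi S x : R := \prod_(i in S) (-1) ^+ x i.

Definition mean f : R := (2 ^+ #|I|)^-1 * \sum_x f x.

Definition hat f S : R := mean (fun x => f x * chi S x).

Definition symdiff S T : {set I} := (S :\: T) :|: (T :\: S).

Lemma chiE S x : chi S x = \prod_i (if i \in S then (-1) ^+ x i else 1).
Proof. by rewrite /chi big_mkcond. Qed.

Lemma chiM S T x : chi S x * chi T x = chi (symdiff S T) x.
Proof.
rewrite !chiE -big_split; apply: eq_bigr => i _ /=; rewrite !inE.
by case: (i \in S); case: (i \in T); rewrite ?mulr1 ?mul1r //= -signr_addb addbb.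
Qed.

Lemma normr_chi S x : `|chi S x| = 1.
Proof. by rewrite normr_prod big1 // => i _; rewrite normrX normrN1 expr1n. Qed.

Lemma chi_upd S x i b :
  chi S (upd x i b) = (if i \in S then (-1) ^+ b else 1) * chi (S :\ i) x.
Proof.
rewrite !chiE (bigD1 i) //= ffunE eqxx; congr (_ * _).
rewrite [RHS](bigD1 i) //= !inE eqxx mul1r; apply: eq_bigr => j ij.
by rewrite ffunE !inE ij (negbTE ij).
Qed.

Lemma chi_split S x i :
  chi S x = (if i \in S then (-1) ^+ x i else 1) * chi (S :\ i) x.
Proof. by rewrite -[in LHS](upd_id x i) chi_upd. Qed.

Lemma pow2_neq0 : 2 ^+ #|I| != 0 :> R.
Proof. by rewrite expf_neq0 // pnatr_eq0. Qed.

Lemma sum_chi x y : \sum_S chi S x * chi S y = 2 ^+ #|I| * (x == y)%:R.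
Proof.
transitivity (\prod_i ((-1) ^+ (x i (+) y i) + 1 : R)).
  rewrite bigA_distr; apply: eq_bigr => S _.
  rewrite !chiE -big_split; apply: eq_bigr => i _ /=.
  by case: ifP; rewrite ?mulr1 // signr_addb.
case: eqP => [->|ne].
  rewrite mulr1 -[RHS]prodr_const; apply: eq_bigr => i _.
  by rewrite addbb expr0.
have [i nei] : exists i, x i != y i.
  apply/existsP; case: (boolP [exists i, x i != y i]) => // /existsPn h.
  case: ne; apply/ffunP=> i.
  by apply/eqP; move: (h i); rewrite negbK.
rewrite mulr0 (bigD1 i) //= (_ : x i (+) y i = true); last first.
  by case: (x i) (y i) nei => [] [].
by rewrite expr1 addNr mul0r.
Qed.

Lemma hat_inv f x : f x = \sum_S hat f S * chi S x.
Proof.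
have -> : \sum_S hat f S * chi S x =
   (2 ^+ #|I|)^-1 * \sum_y f y * (\sum_S chi S y * chi S x).
  rewrite mulr_sumr; under [RHS]eq_bigr => y _ do rewrite !mulr_sumr.
  rewrite exchange_big; apply: eq_bigr => S _.
  by rewrite /hat /mean -mulrA mulr_suml mulr_sumr; apply: eq_bigr => y _; ring.
rewrite (bigD1 x) //= [X in _ * (_ + X)]big1 ?addr0; last first.
  by move=> y /negbTE nxy; rewrite sum_chi nxy !mulr0.
by rewrite sum_chi eqxx mulr1 mulrCA mulVf ?pow2_neq0 ?mulr1.
Qed.

Lemma mean_chi S : mean (chi S) = (S == set0)%:R.
Proof.
rewrite /mean; case: eqP => [->|/eqP/set0Pn[i iS]].
  under eq_bigr => x _ do rewrite /chi big_set0.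
  rewrite sumr_const card_ffun card_bool -mulr_natl mulr1 natrX mulVf //.
  exact: pow2_neq0.
rewrite (_ : \sum_x chi S x = 0) ?mulr0 //.
pose flip x := upd x i (~~ x i).
have flipK : involutive flip.
  move=> x; rewrite /flip upd_upd ffunE eqxx negbK; exact: upd_id.
have h : \sum_x chi S x = - \sum_x chi S x.
  rewrite [LHS](reindex_inj (inv_inj flipK)) -sumrN; apply: eq_bigr => x _ /=.
  rewrite chi_upd (chi_split S x i) iS; case: (x i); rewrite /= ?expr0 ?expr1; ring.
by have := h; lra.
Qed.

Lemma eq_mean f g : f =1 g -> mean f = mean g.
Proof. by move=> e; congr (_ * _); apply: eq_bigr => x _. Qed.

Lemma mean_sum (K : Type) (r : seq K) (P : pred K) (F : K -> cube -> R) :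
  mean (fun x => \sum_(k <- r | P k) F k x) = \sum_(k <- r | P k) mean (F k).
Proof. by rewrite /mean exchange_big mulr_sumr. Qed.

Lemma meanZ c f : mean (fun x => c * f x) = c * mean f.
Proof. by rewrite /mean -mulr_sumr; ring. Qed.

Lemma meanD f g : mean (fun x => f x + g x) = mean f + mean g.
Proof. by rewrite /mean big_split mulrDr. Qed.

Lemma ler_mean f g : (forall x, f x <= g x) -> mean f <= mean g.
Proof.
by move=> h; apply: ler_wpM2l; rewrite ?invr_ge0 ?exprn_ge0 //; apply: ler_sum.
Qed.

Lemma mean_ge0 f : (forall x, 0 <= f x) -> 0 <= mean f.
Proof. by move=> h; rewrite mulr_ge0 ?invr_ge0 ?exprn_ge0 ?sumr_ge0. Qed.

Lemma eq_hat f g : f =1 g -> hat f =1 hat g.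
Proof. by move=> e S; apply: eq_mean => x; rewrite e. Qed.

Lemma mean_chiM S T : mean (fun x => chi S x * chi T x) = (S == T)%:R.
Proof.
rewrite (eq_mean (g := chi (symdiff S T))) => [|x]; last exact: chiM.
rewrite mean_chi; congr ((nat_of_bool _)%:R).
apply/eqP/eqP => [/setP h|->]; apply/setP=> i; last by rewrite !inE; case: (_ \in _).
by move: (h i); rewrite !inE; case: (i \in S); case: (i \in T).
Qed.

(** Used to read off the coefficients of a function from an explicit expansion in characters. *)
Lemma hat_unique (c : {set I} -> R) T :
  hat (fun x => \sum_S c S * chi S x) T = c T.
Proof.
rewrite /hat (eq_mean (g := fun x => \sum_S c S * (chi S x * chi T x))).
  rewrite mean_sum (bigD1 T) //= big1 ?addr0 => [|S nST].
    by rewrite meanZ mean_chiM eqxx mulr1.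
  by rewrite meanZ mean_chiM (negbTE nST) mulr0.
by move=> x; rewrite mulr_suml; apply: eq_bigr => S _; rewrite mulrA.
Qed.

Lemma parseval f : mean (fun x => f x ^+ 2) = \sum_S hat f S ^+ 2.
Proof.
rewrite (eq_mean (g := fun x => \sum_S hat f S * (f x * chi S x))).
  by rewrite mean_sum; apply: eq_bigr => S _; rewrite meanZ expr2.
move=> x; rewrite expr2 {2}[f x]hat_inv mulr_sumr.
by apply: eq_bigr => S _; ring.
Qed.

Lemma sum_set_split i (F : {set I} -> R) :
  \sum_S F S = \sum_(S : {set I} | i \notin S) (F S + F (i |: S)).
Proof.
rewrite (bigID (fun S : {set I} => i \notin S)) /= big_split /=; congr (_ + _).
rewrite (reindex_onto (fun S => i |: S) (fun S => S :\ i)) /=; last first.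
  by move=> S; rewrite negbK => iS; rewrite setD1K.
apply: eq_bigl => S; rewrite setU11 /=.
apply/eqP/idP => [<-|iS]; first by rewrite !inE eqxx.
by rewrite setU1K.
Qed.

(* [Phi (fun=> lam) f = \sum_S lam ^+ #|S| * hat f S ^+ 2]; separate weights
   for the coordinates allow to treat these one at a time. *)
Definition Phi (lam : I -> R) f : R :=
  \sum_(S : {set I}) (\prod_(i in S) lam i) * hat f S ^+ 2.

Lemma eq_Phi lam f g : f =1 g -> Phi lam f = Phi lam g.
Proof. by move=> e; apply: eq_bigr => S _; rewrite (eq_hat e). Qed.

(** Once [x i] is set to [b], the characters of [S] and [i |: S] agree up to the sign [(-1) ^+ b],
    so their coefficients merge. *)
Lemma hat_upd f i b S : i \notin S ->
  hat (fun x => f (upd x i b)) S = hat f S + (-1) ^+ b * hat f (i |: S).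
Proof.
move=> iS; pose c (S : {set I}) := if i \in S then 0 else hat f S + (-1) ^+ b * hat f (i |: S).
rewrite (eq_hat (g := fun x => \sum_S c S * chi S x)).
  by rewrite hat_unique /c (negbTE iS).
move=> x; rewrite hat_inv (sum_set_split i) [RHS](sum_set_split i).
apply: eq_bigr => T iT; rewrite /c setU11 (negbTE iT) mul0r addr0.
rewrite !chi_upd setU11 (negbTE iT) setU1K // mul1r.
have -> : T :\ i = T by apply/setDidPl; rewrite disjoint_sym disjoints1.
by ring.
Qed.

Lemma hat_upd0 f i b S : i \in S -> hat (fun x => f (upd x i b)) S = 0.
Proof.
move=> iS; pose c (S : {set I}) := if i \in S then 0 else hat f S + (-1) ^+ b * hat f (i |: S).
rewrite (eq_hat (g := fun x => \sum_S c S * chi S x)).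
  by rewrite hat_unique /c iS.
move=> x; rewrite hat_inv (sum_set_split i) [RHS](sum_set_split i).
apply: eq_bigr => T iT; rewrite /c setU11 (negbTE iT) mul0r addr0.
rewrite !chi_upd setU11 (negbTE iT) setU1K // mul1r.
have -> : T :\ i = T by apply/setDidPl; rewrite disjoint_sym disjoints1.
by ring.
Qed.

Definition Phi0 i lam f : R :=
  \sum_(S : {set I} | i \notin S) (\prod_(j in S) lam j) * hat f S ^+ 2.
Definition Phi1 i lam f : R :=
  \sum_(S : {set I} | i \notin S) (\prod_(j in S) lam j) * hat f (i |: S) ^+ 2.

Lemma Phi_split i lam f : Phi lam f = Phi0 i lam f + lam i * Phi1 i lam f.
Proof.
rewrite /Phi (sum_set_split i) /Phi0 /Phi1 mulr_sumr -big_split.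
by apply: eq_bigr => S iS; rewrite big_setU1 //= mulrA.
Qed.

(** Parallelogram law: the cross terms for the two values of [b] cancel. Setting a coordinate at
    random thus replaces its weight by 1. *)
Lemma Phi_upd i lam f :
  \sum_b Phi lam (fun x => f (upd x i b)) = 2 * (Phi0 i lam f + Phi1 i lam f).
Proof.
have e b : Phi lam (fun x => f (upd x i b)) =
   \sum_(S : {set I} | i \notin S) (\prod_(j in S) lam j) *
     (hat f S + (-1) ^+ b * hat f (i |: S)) ^+ 2.
  rewrite (Phi_split i) [X in _ * X]big1 ?mulr0 ?addr0.
    by apply: eq_bigr => S iS; rewrite hat_upd.
  by move=> S iS; rewrite hat_upd0 ?setU11 // expr0n mulr0.
rewrite big_bool !e /Phi0 /Phi1 -!big_split mulr_sumr; apply: eq_bigr => S _ /=.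
by rewrite expr1 expr0; ring.
Qed.

Lemma Phi_ge0 lam f : (forall i, 0 <= lam i) -> 0 <= Phi lam f.
Proof.
by move=> l0; apply: sumr_ge0 => S _; rewrite mulr_ge0 ?sqr_ge0 ?prodr_ge0.
Qed.

Lemma Phi_query i lam f : (forall i, 1 <= lam i) ->
  Phi lam f <= lam i / 2 * \sum_b Phi lam (fun x => f (upd x i b)).
Proof.
move=> l1; rewrite Phi_upd (Phi_split i).
have l0 j : 0 <= lam j by apply: le_trans (l1 j).
have h0 : 0 <= Phi0 i lam f.
  by apply: sumr_ge0 => S _; rewrite mulr_ge0 ?sqr_ge0 ?prodr_ge0.
by have := ler_wpM2r h0 (l1 i); lra.
Qed.

Lemma Phi_cst lam (c : R) : Phi lam (fun=> c) = c ^+ 2.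
Proof.
have e S : hat (fun=> c) S = c * (S == set0)%:R by rewrite /hat meanZ mean_chi.
rewrite /Phi (bigD1 set0) //= big_set0 mul1r e eqxx mulr1 big1 ?addr0 // => S nS.
by rewrite e (negbTE nS) mulr0 expr0n mulr0.
Qed.

Lemma Phi_dt (lam : R) n (f : cube -> bool) : 1 <= lam -> dt n f ->
  Phi (fun=> lam) (fun x => (f x)%:R) <= lam ^+ n.
Proof.
move=> l1 h; elim: h => {n f} [n f v fv|n f i _ IH].
  rewrite (eq_Phi _ (g := fun=> v%:R)) => [|x]; last by rewrite fv.
  rewrite Phi_cst; apply: le_trans (exprn_ege1 n l1).
  by case: v {fv}; rewrite ?expr1n // expr0n.
apply: le_trans (Phi_query i _ _) _ => //.
rewrite big_bool exprS /=; have := IH true; have := IH false; set a := Phi _ _; set b := Phi _ _.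
move=> ha hb; have l0 : 0 <= lam by lra.
have := ler_wpM2l l0 ha; have := ler_wpM2l l0 hb; lra.
Qed.

(** A coordinate that stays free keeps the weight [lam], one set at random gets weight 1 by
    [Phi_upd]; the average is [(1 - p) + p * lam]. Coordinates are averaged one by one, [s] being
    the list of those already treated. *)
Lemma Phi_restr (p lam : R) f : 0 <= p < 1 ->
  Phi (fun=> (1 - p) + p * lam) f =
  rexp p (fun rho => Phi (fun=> lam) (fun x => f (overwrite rho x))).
Proof.
move=> p01; pose L (s : seq I) i := if i \in s then (1 - p) + p * lam else lam.
have gen s : uniq s -> forall f, Phi (L s) f =
    rexp p (fun rho => Phi (fun=> lam)
      (fun x => f (overwrite (upds (free I) [set i in s] rho) x))).
  elim: s => [_|i s IH /= /andP[is_ us]] g.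
    rewrite -[LHS](rexp_cst I p); apply: eq_prodE => rho; apply: eq_Phi => x.
    congr g; rewrite -[LHS]overwrite_free; congr overwrite; apply/ffunP=> j.
    by rewrite !ffunE inE.
  have -> : Phi (L (i :: s)) g =
    p * Phi (L s) g + (1 - p) / 2 * \sum_b Phi (L s) (fun x => g (upd x i b)).
    have e (S : {set I}) : i \notin S -> \prod_(j in S) L (i :: s) j = \prod_(j in S) L s j.
      move=> iS; apply: eq_bigr => j jS; rewrite /L inE; case: eqP => // e.
      by rewrite -e jS in iS.
    have Li : L (i :: s) i = 1 - p + p * lam by rewrite /L mem_head.
    have Ls : L s i = lam by rewrite /L (negbTE is_).
    rewrite Phi_upd !(Phi_split i) Li Ls.
    have -> : Phi0 i (L (i :: s)) g = Phi0 i (L s) g.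
      by apply: eq_bigr => S iS; rewrite e.
    have -> : Phi1 i (L (i :: s)) g = Phi1 i (L s) g.
      by apply: eq_bigr => S iS; rewrite e.
    by field.
  rewrite /rexp (prodE_resample (restr_weight_sum1 _) i).
  rewrite (bigD1 None) //= (bigD1 (Some true)) //= (bigD1 (Some false)) //=.
  rewrite [X in _ + (_ + (_ + X))]big1 ?addr0 => [|[[]|]] //.
  rewrite big_bool mulrDr; congr (_ * _ + (_ * _ + _ * _)); rewrite IH //.
  - apply: eq_prodE => rho; apply: eq_Phi => x; congr (g (overwrite _ x)).
    apply/ffunP=> j; rewrite !ffunE !inE; case: (eqVneq j i) => //= ->.
    by rewrite (negbTE is_).
  - apply: eq_prodE => rho; apply: eq_Phi => x; congr g; rewrite -overwrite_upd; congr overwrite.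
    by apply/ffunP=> j; rewrite !ffunE !inE; case: (eqVneq j i).
  - apply: eq_prodE => rho; apply: eq_Phi => x; congr g; rewrite -overwrite_upd; congr overwrite.
    by apply/ffunP=> j; rewrite !ffunE !inE; case: (eqVneq j i).
have -> : Phi (fun=> (1 - p) + p * lam) f = Phi (L (enum I)) f.
  apply: eq_bigr => S _; congr (_ * _); apply: eq_bigr => i _.
  by rewrite /L mem_enum.
rewrite gen ?enum_uniq //; apply: eq_prodE => rho; apply: eq_Phi => x.
by congr (f (overwrite _ x)); apply/ffunP=> i; rewrite !ffunE inE mem_enum.
Qed.

Lemma sum_fixed_setU1 (F : restr -> R) i (Q : {set I}) : i \notin Q ->
  \sum_(a | fixed a == i |: Q) F a =
  \sum_b \sum_(a | fixed a == Q) F (upd a i (Some b)).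
Proof.
move=> iQ; rewrite pair_big_dep /=.
pose h (u : bool * restr) : restr := upd u.2 i (Some u.1).
pose h' (a : restr) : bool * restr := (odflt false (a i), upd a i None).
rewrite (reindex_onto h h') /=; last first.
  move=> a /eqP aQ; apply/ffunP=> j; rewrite !ffunE; case: eqP => // ->.
  have : i \in fixed a by rewrite aQ setU11.
  by rewrite inE /h' /=; case: (a i).
apply: eq_bigl => -[b a] /=; apply/andP/eqP => [[/eqP aQ /eqP [h1 h2]]|aQ].
  apply/setP=> j; have := congr1 (fun A : {set I} => j \in A) aQ.
  have := congr1 (fun a : restr => a j) h2.
  rewrite !inE !ffunE; case: (eqVneq j i) => [->|_ _ -> //].
  by move=> e _; rewrite -e (negbTE iQ).
have ai : a i = None.
  by have := congr1 (fun A : {set I} => i \in A) aQ; rewrite inE (negbTE iQ); case: (a i).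
split; apply/eqP.
  apply/setP=> j; rewrite !inE ffunE; case: eqP => //= _.
  by rewrite -aQ inE.
congr pair; first by rewrite ffunE eqxx.
by apply/ffunP=> j; rewrite !ffunE; case: eqP => // ->.
Qed.

(** For [lam <= 2] the factor [lam / 2] of [Phi_query] is at most 1. This is the condition that
    [switching] puts on its cost. *)
Lemma Phi_query_set lam f (Q : {set I}) : 1 <= lam <= 2 ->
  Phi (fun=> lam) f <= \sum_(a | fixed a == Q) Phi (fun=> lam) (fun x => f (overwrite a x)).
Proof.
case/andP=> l1 l2; have [k] := ubnP #|Q|; elim: k Q f => // k IH Q f hk.
case: (set_0Vmem Q) => [->|[i iQ]].
  rewrite (bigD1 (free I)) ?fixed_free //=.
  rewrite (eq_Phi (f := f) _ (g := fun x => f (overwrite (free I) x))).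
    by rewrite ler_wpDr // sumr_ge0 // => a _; apply: Phi_ge0 => _; lra.
  by move=> x; rewrite overwrite_free.
rewrite -(setD1K iQ) sum_fixed_setU1 ?setD11 //.
apply: (@le_trans _ _ (\sum_b Phi (fun=> lam) (fun x => f (upd x i b)))).
  apply: le_trans (Phi_query i _ _) _ => //.
  have h : 0 <= \sum_b Phi (fun=> lam) (fun x => f (upd x i b)).
    by apply: sumr_ge0 => b _; apply: Phi_ge0 => _; lra.
  by have := ler_wpM2r h l2; lra.
apply: ler_sum => b _.
apply: le_trans (IH (Q :\ i) _ _) _; first by move: hk; rewrite (cardsD1 i) iQ.
rewrite le_eqVlt; apply/orP; left; apply/eqP; apply: eq_bigr => a _.
by apply: eq_Phi => x; rewrite overwrite_upd.
Qed.

(* One round of depth reduction: it suffices to bound Phi once all the DNFs in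
   [Gs] have become shallow decision trees. *)
Lemma Phi_switching (f : cube -> R) (Gs : seq (seq restr)) (l w : nat) (p eta B : R) :
  0 <= p < 1 -> 0 <= eta <= 1 ->
  (forall (G : seq restr) (T : restr), G \in Gs -> T \in G -> (#|fixed T| <= w)%N) ->
  (0 < l)%N -> (0 < w)%N -> (2 * size Gs <= 4 ^ l)%N -> 128 * w%:R * p <= 1 ->
  0 <= B ->
  (forall rho, (forall G, G \in Gs -> dt l (fun x => dnf G (overwrite rho x))) ->
    Phi (fun=> 1 + eta) (fun x => f (overwrite rho x)) <= B) ->
  Phi (fun=> 1 + p * eta) f <= 2 * B.
Proof.
move=> p01 /andP[e0 e1] Gw l0 w0 Ml pw B0 h.
have -> : 1 + p * eta = (1 - p) + p * (1 + eta) by ring.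
rewrite Phi_restr //; apply: (switching p01 (Gs := Gs) (l := l) (w := w)) => //.
- by move=> rho; apply: Phi_ge0 => _; lra.
- move=> rho Q dQ; apply: le_trans (Phi_query_set _ Q _) _; first by lra.
  rewrite le_eqVlt; apply/orP; left; apply/eqP; apply: eq_bigr => a /eqP aQ.
  by apply: eq_Phi => x; rewrite overwrite_over_disjoint // aQ.
- move=> rho hl; apply: h => G GGs; apply: not_long_path_dt (leqnn _) _.
  exact: hl.
Qed.

Definition lowpart (K : nat) f x : R :=
  \sum_(S : {set I} | (#|S| <= K)%N) hat f S * chi S x.

(** By Parseval the mean is the sum of the squared coefficients with [#|S| > K], each of which has
    weight at least [lam ^+ K] in [Phi]. *)
Lemma lowpart_err K (lam : R) f : 1 <= lam ->
  mean (fun x => (f x - lowpart K f x) ^+ 2) * lam ^+ K <= Phi (fun=> lam) f.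
Proof.
move=> l1; rewrite parseval mulr_suml; apply: ler_sum => S _.
have lp n : 0 <= lam ^+ n by rewrite exprn_ge0 //; lra.
rewrite (eq_hat (g := fun x =>
  \sum_(T : {set I}) (if (#|T| <= K)%N then 0 else hat f T) * chi T x)).
  rewrite hat_unique prodr_const; case: (leqP #|S| K) => hS.
    by rewrite expr0n mul0r mulr_ge0 ?sqr_ge0.
  by rewrite mulrC; apply: ler_wpM2r; rewrite ?sqr_ge0 // ler_weXn2l // ltnW.
move=> x; rewrite [f x]hat_inv /lowpart [X in _ - X]big_mkcond -sumrB.
by apply: eq_bigr => T _; case: ifP => _; rewrite ?mul0r ?subrr ?subr0.
Qed.

(** The degree of the unique multilinear polynomial that agrees with [f] on the cube. *)
Definition degle (k : nat) f : Prop := forall S, (k < #|S|)%N -> hat f S = 0.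

Lemma eq_degle k f g : f =1 g -> degle k f -> degle k g.
Proof. by move=> e h S kS; rewrite -(eq_hat e) h. Qed.

Lemma degle_le k k' f : (k <= k')%N -> degle k f -> degle k' f.
Proof. by move=> le h S kS; apply: h; apply: leq_ltn_trans kS. Qed.

Lemma degle_lowpart K f : degle K (lowpart K f).
Proof.
move=> S KS; rewrite (eq_hat (g := fun x =>
  \sum_(T : {set I}) (if (#|T| <= K)%N then hat f T else 0) * chi T x)).
  by rewrite hat_unique leqNgt KS.
move=> x; rewrite /lowpart big_mkcond; apply: eq_bigr => T _.
by case: ifP => // _; rewrite mul0r.
Qed.

Lemma hatD f g S : hat (fun x => f x + g x) S = hat f S + hat g S.
Proof. by rewrite -meanD; apply: eq_mean => x; rewrite mulrDl. Qed.

Lemma hatZ c f S : hat (fun x => c * f x) S = c * hat f S.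
Proof. by rewrite -meanZ; apply: eq_mean => x; rewrite mulrA. Qed.

Lemma degle_cst k c : degle k (fun=> c).
Proof.
move=> S kS; rewrite /hat meanZ mean_chi -cards_eq0.
by case: #|S| kS => //= n _; rewrite mulr0.
Qed.

Lemma degleD k f g : degle k f -> degle k g -> degle k (fun x => f x + g x).
Proof. by move=> hf hg S kS; rewrite hatD hf // hg // addr0. Qed.

Lemma degleZ k c f : degle k f -> degle k (fun x => c * f x).
Proof. by move=> hf S kS; rewrite hatZ hf // mulr0. Qed.

Lemma degleB k f g : degle k f -> degle k g -> degle k (fun x => f x - g x).
Proof.
move=> hf hg; apply: eq_degle (degleD hf (degleZ (-1) hg)) => x.
by rewrite mulN1r.
Qed.

Lemma degle_sum (K : Type) (r : seq K) (P : pred K) k (F : K -> cube -> R) :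
  (forall a, P a -> degle k (F a)) -> degle k (fun x => \sum_(a <- r | P a) F a x).
Proof.
move=> h S kS; rewrite /hat (eq_mean (g := fun x => \sum_(a <- r | P a) F a x * chi S x)).
  by rewrite mean_sum big1 // => a Pa; apply: h.
by move=> x; rewrite mulr_suml.
Qed.

Lemma card_symdiff S T : (#|symdiff S T| <= #|S| + #|T|)%N.
Proof.
apply: leq_trans (leq_card_setU _ _) _.
by apply: leq_add; apply: subset_leq_card; apply: subsetDl.
Qed.

Lemma degleM k k' f g : degle k f -> degle k' g ->
  degle (k + k') (fun x => f x * g x).
Proof.
move=> hf hg; apply: (@eq_degle _ (fun x => \sum_A \sum_B
   hat f A * hat g B * (chi A x * chi B x))) => [x|].
  rewrite [f x]hat_inv [g x]hat_inv mulr_suml; apply: eq_bigr => A _.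
  by rewrite mulr_sumr; apply: eq_bigr => B _; ring.
apply: degle_sum => A _; apply: degle_sum => B _.
case: (leqP #|A| k) => hA; last by move=> S _; rewrite hatZ hf // !mul0r.
case: (leqP #|B| k') => hB; last by move=> S _; rewrite hatZ hg // mulr0 mul0r.
apply: degleZ => S kS.
rewrite (eq_hat (g := chi (symdiff A B))) => [|x]; last exact: chiM.
rewrite /hat mean_chiM; case: eqP => // e; move: kS; rewrite -e.
by rewrite ltnNge (leq_trans (card_symdiff A B)) // leq_add.
Qed.

Lemma degle_prod (K : Type) (r : seq K) k (F : K -> cube -> R) :
  (forall a, degle k (F a)) -> degle (size r * k) (fun x => \prod_(a <- r) F a x).
Proof.
move=> h; elim: r => [|a r IH].
  by apply: (@eq_degle _ (fun=> 1)) => [x|]; [rewrite big_nil|apply: degle_cst].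
rewrite mulSn; apply: (@eq_degle _ (fun x => F a x * \prod_(b <- r) F b x)) => [x|].
  by rewrite big_cons.
exact: degleM.
Qed.

Lemma degle_var i : degle 1 (fun x => (x i)%:R).
Proof.
apply: (@eq_degle _ (fun x => 2^-1 + (- 2^-1) * chi [set i] x)) => [x|].
  by rewrite /chi big_set1; case: (x i); rewrite /= ?expr1 ?expr0; field.
apply: degleD; first exact: degle_cst.
apply: degleZ => S kS; rewrite /hat mean_chiM; case: eqP => // e.
by rewrite -e cards1 in kS.
Qed.

Lemma normr_hat_le f S : `|hat f S| <= mean (fun x => `|f x|).
Proof.
rewrite /hat /mean normrM ger0_norm ?invr_ge0 ?exprn_ge0 //.
apply: ler_wpM2l; first by rewrite invr_ge0 exprn_ge0.
apply: le_trans (ler_norm_sum _ _ _) _; apply: ler_sum => x _.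
by rewrite normrM normr_chi mulr1.
Qed.

(** Such a set is the range of a map from ['I_k] to [option I], with [None] as padding. *)
Lemma card_small_sets k : (#|[set S : {set I} | (#|S| <= k)%N]| <= #|I|.+1 ^ k)%N.
Proof.
pose F (u : {ffun 'I_k -> option I}) : {set I} := [set i | Some i \in codom u].
have <- : #|{ffun 'I_k -> option I}| = (#|I|.+1 ^ k)%N.
  by rewrite card_ffun card_option card_ord.
apply: leq_trans (leq_imset_card F _); apply: subset_leq_card.
apply/subsetP=> S; rewrite inE => Sk; apply/imsetP.
exists [ffun j : 'I_k => nth None [seq Some i | i <- enum S] j] => //.
apply/setP=> i; rewrite inE; apply/idP/idP => [iS|/codomP[j]].
  have hi : (index i (enum S) < #|S|)%N by rewrite cardE index_mem mem_enum.
  apply/codomP; exists (Ordinal (leq_trans hi Sk)); rewrite ffunE /=.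
  by rewrite (nth_map i) -?cardE // nth_index // mem_enum.
rewrite ffunE; case: (ltnP j (size [seq Some i | i <- enum S])) => [h e|h].
  have := mem_nth None h; rewrite -e => /mapP[i' i'S [->]].
  by rewrite mem_enum in i'S.
by rewrite nth_default.
Qed.

End Fourier.

(** * Razborov-Smolensky polynomials *)

Section Isolation.
Variables (R : realFieldType) (L : finType).

(** If [B] is the set of true literals of an OR gate and [S] a sampled set, this says that the sum
    of the literals in [S] is 1, the value of the OR. *)
Definition isolates (S B : {set L}) : bool := #|S :&: B| == 1%N.

Let bias (theta : R) (b : bool) : R := if b then theta else 1 - theta.

Lemma prodE_isolates (theta : R) (B : {set L}) : 0 <= theta <= 1 ->
  4^-1 <= #|B|%:R * theta <= 2^-1 ->
  8^-1 <= prodE (bias theta) (fun rho => (isolates [set a | rho a] B)%:R).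
Proof.
move=> /andP[t0 t1] /andP[lo hi].
have w0 b : 0 <= bias theta b by case: b => //=; lra.
have w1 : \sum_b bias theta b = 1 by rewrite big_bool /=; lra.
have Efix (Q : {set L}) :
    prodE (bias theta) (fun rho => [forall j in Q, rho j == true]%:R) = theta ^+ #|Q|.
  have := prodE_fix w1 Q [ffun=> true] (fun=> 1); rewrite prodE_cst // mulr1.
  under eq_bigr => j _ do rewrite ffunE.
  rewrite prodr_const => <-; apply: eq_prodE => rho; rewrite mulr1.
  by congr ((nat_of_bool _)%:R); apply: eq_forallb_in => j _; rewrite ffunE.
(* With c elements of [B] sampled this is c (2 - c), which is 1 for c = 1 and at most 0 for every
   other c; its expectation involves only single elements and pairs. *)
pose lower (rho : {ffun L -> bool}) : R := \sum_(a in B) ([forall j in [set a], rho j == true]%:R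
   - \sum_(b in B :\ a) [forall j in [set a; b], rho j == true]%:R).
have lowerP rho : lower rho <= (isolates [set a | rho a] B)%:R.
  set c := #|[set a | rho a] :&: B|.
  have -> : lower rho = c%:R * (1 - (c%:R - 1)).
    rewrite /lower (bigID (fun a => rho a)) /= [X in _ + X]big1 ?addr0; last first.
      move=> a /andP[aB nra]; rewrite (_ : [forall j in _, _] = false); last first.
        by apply/negbTE/forall_inPn; exists a; rewrite ?inE // eqb_id.
      rewrite big1 ?subrr // => b _; rewrite (_ : [forall j in _, _] = false) //.
      by apply/negbTE/forall_inPn; exists a; rewrite ?inE ?eqxx // eqb_id.
    have -> : c%:R = \sum_(a in B | rho a) (1 : R).
      rewrite sumr_const; congr (_ *+ _); apply: eq_card => a.
      by rewrite !inE andbC.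
    rewrite mulr_suml; apply: eq_bigr => a /andP[aB ra]; rewrite mul1r.
    have -> : [forall j in [set a], rho j == true].
      by apply/forall_inP => j; rewrite inE => /eqP ->; rewrite ra.
    congr (_ - _); rewrite [in RHS](bigD1 a) ?aB //= addrAC subrr add0r.
    rewrite [LHS]big_mkcond [RHS]big_mkcond; apply: eq_bigr => b _.
    rewrite !inE; case: (eqVneq b a) => [->|ba]; first by rewrite andbF.
    rewrite andbT; case: (b \in B) => //=.
    rewrite -[RHS]/(if rho b then 1 else 0 : R).
    have -> : [forall j in [set a; b], rho j == true] = rho b.
      apply/forall_inP/idP => [/(_ b)|rb j]; first by rewrite !inE eqxx orbT => /(_ isT) /eqP.
      by rewrite !inE => /orP[] /eqP ->; rewrite ?ra ?rb.
    by case: (rho b).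
  rewrite /isolates -/c; case: (c) => [|[|k]]; rewrite ?mul0r //=.
    by rewrite subrr subr0 mulr1.
  by rewrite -!natr1; have : (0 : R) <= k%:R by []; nra.
apply: le_trans (ler_prodE w0 lowerP).
rewrite /lower prodE_sum.
have -> : \sum_(a in B) prodE (bias theta) (fun rho => [forall j in [set a], rho j == true]%:R
   - \sum_(b in B :\ a) [forall j in [set a; b], rho j == true]%:R) =
   \sum_(a in B) (theta - (#|B|%:R - 1) * theta ^+ 2).
  apply: eq_bigr => a aB; rewrite prodEB Efix cards1 expr1 prodE_sum; congr (_ - _).
  rewrite (eq_bigr (fun=> theta ^+ 2)); last first.
    move=> b; rewrite !inE => /andP[ba _].
    by rewrite (Efix [set a; b]) cards2 eq_sym ba.
  rewrite sumr_const (cardsD1 a B) aB add1n.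
  by rewrite -[in RHS]natr1 addrK mulr_natl.
rewrite sumr_const -mulr_natl; nra.
Qed.

(** As in the Valiant-Vazirani lemma, sets are sampled with densities [1 / 2 ^ (l + 2)]; for each
    [x], the level [l = trunc_log 2 #|B x|] isolates with probability at least 1/8. Summing over the
    [n.+1] levels and replacing random sets by the best set [S0] gives the factor [8 * n.+1]. *)
Lemma exists_isolating (X : finType) (B : X -> {set L}) (nu : X -> R) (n : nat) :
  (forall x, 0 <= nu x) -> (forall x, #|B x| <= 2 ^ n)%N ->
  exists S, \sum_(x | B x != set0) nu x <=
    8 * n.+1%:R * \sum_(x | (B x != set0) && isolates S (B x)) nu x.
Proof.
move=> nu0 hB; pose th (l : nat) : R := (2 ^+ l.+2)^-1.
have th01 l : 0 <= th l <= 1.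
  by rewrite /th invr_ge0 exprn_ge0 //= invf_le1 ?exprn_gt0 // exprn_ege1 ?ler1n.
pose val (S : {set L}) : R := \sum_(x | (B x != set0) && isolates S (B x)) nu x.
have [S0 _ hS] := arg_maxP val (isT : xpredT (set0 : {set L})).
exists S0; rewrite -/(val S0).
pose g l (x : X) := prodE (bias (th l)) (fun rho => (isolates [set a | rho a] (B x))%:R).
have g0 l x : 0 <= g l x.
  apply: prodE_ge0 => // b; case/andP: (th01 l) => t0 t1.
  by rewrite /bias; case: b; lra.
have hg x : B x != set0 -> 8^-1 <= \sum_(l < n.+1) g l x.
  move=> Bx; have b0 : (0 < #|B x|)%N by rewrite card_gt0.
  have hl : (trunc_log 2 #|B x| < n.+1)%N.
    rewrite ltnS -(@leq_exp2l 2) //; apply: leq_trans (hB x).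
    exact: trunc_logP.
  rewrite (bigD1 (Ordinal hl)) //=; apply: ler_wpDr; first by rewrite sumr_ge0.
  apply: prodE_isolates => //; set k := trunc_log 2 _.
  have lo : (2 ^ k <= #|B x|)%N by apply: trunc_logP.
  have hi : (#|B x| < 2 ^ k.+1)%N by apply: trunc_log_ltn.
  have p0 : 0 < (2 ^+ k : R) by rewrite exprn_gt0.
  have lo' : (2 ^+ k : R) <= #|B x|%:R by rewrite -natrX ler_nat.
  have hi' : #|B x|%:R <= 2 * (2 ^+ k : R) by rewrite -exprS -natrX ler_nat ltnW.
  rewrite /th !exprS ler_pdivlMr ?ler_pdivrMr ?mulr_gt0 //; apply/andP; split; lra.
have sum_le l : \sum_(x | B x != set0) nu x * g l x <= val S0.
  have -> : \sum_(x | B x != set0) nu x * g l x =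
     prodE (bias (th l)) (fun rho => val [set a | rho a]).
    under eq_bigr => x _ do rewrite -prodEZ.
    rewrite -prodE_sum; apply: eq_prodE => rho; rewrite /val big_mkcondr /=.
    by apply: eq_bigr => x _; case: ifP; rewrite ?mulr1 ?mulr0.
  have w1 : \sum_b bias (th l) b = 1 by rewrite big_bool /=; lra.
  rewrite -[leRHS](prodE_cst L w1); apply: ler_prodE => [b|rho]; last exact: hS.
  by case/andP: (th01 l) => t0 t1; rewrite /bias; case: b; lra.
have : \sum_(x | B x != set0) nu x * 8^-1 <= \sum_(l < n.+1) val S0.
  apply: (@le_trans _ _ (\sum_(l < n.+1) \sum_(x | B x != set0) nu x * g l x)).
    rewrite exchange_big; apply: ler_sum => x Bx; rewrite -mulr_sumr.
    by apply: ler_wpM2l => //; apply: hg.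
  by apply: ler_sum.
rewrite sumr_const card_ord -mulr_suml -mulr_natl; lra.
Qed.

Lemma bernoulli (y : R) n : 0 <= y -> 1 + n%:R * y <= (1 + y) ^+ n.
Proof.
move=> y0; elim: n => [|n IH]; first by rewrite mul0r addr0.
rewrite exprS -natr1; have n0 : (0 : R) <= n%:R by [].
have : 0 <= n%:R * y * y by rewrite !mulr_ge0.
have := ler_wpM2l (_ : 0 <= 1 + y) IH; move=> /(_ _); nra.
Qed.

Lemma expr_decay (n k : nat) : (0 < n)%N -> (1 - n%:R^-1 : R) ^+ (n * k) <= 2^-1 ^+ k.
Proof.
move=> n0; rewrite exprM; have n1 : (1 : R) <= n%:R by rewrite ler1n.
have y0 : (0 : R) <= n%:R^-1 by rewrite invr_ge0.
have y1 : (n%:R^-1 : R) <= 1 by rewrite invf_le1 // ltr0n.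
set y := n%:R^-1 in y0 y1 *.
have h0 : 0 <= (1 - y) ^+ n by rewrite exprn_ge0 //; lra.
suff h1 : (1 - y) ^+ n <= 2^-1.
  by apply: lerXn2r; rewrite ?nnegrE // ?invr_ge0.
have := bernoulli n y0; rewrite /y mulfV ?lt0r_neq0 ?ltr0n // -/y => b.
have : (1 - y) ^+ n * (1 + y) ^+ n <= 1.
  by rewrite -exprMn exprn_ile1 //; nra.
nra.
Qed.

(** Greedy choice: each new set isolates at least a fraction [1 / N] of the mass not isolated so
    far, with [N = 8 * n.+1], so [N * k] sets leave at most [2^-1 ^+ k]. *)
Lemma exists_isolating_seq (X : finType) (B : X -> {set L}) (nu : X -> R) (n k : nat) :
  (forall x, 0 <= nu x) -> (forall x, #|B x| <= 2 ^ n)%N ->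
  exists Ss : 'I_(8 * n.+1 * k) -> {set L},
    \sum_(x | (B x != set0) && [forall t, ~~ isolates (Ss t) (B x)]) nu x <=
    2^-1 ^+ k * \sum_x nu x.
Proof.
move=> nu0 hB; set N := (8 * n.+1)%N.
have N0 : (0 < N)%N by rewrite /N.
have [Ss [sz hS]] : exists Ss : seq {set L}, size Ss = (N * k)%N /\
   \sum_(x | (B x != set0) && all (fun S => ~~ isolates S (B x)) Ss) nu x <=
     (1 - N%:R^-1) ^+ (N * k) * \sum_x nu x.
  elim: (N * k)%N => [|T [Ss [sz IH]]].
    exists [::]; split=> //; rewrite expr0 mul1r /= [leLHS]big_mkcond.
    by apply: ler_sum => x _; case: ifP.
  pose nu' x := if all (fun S => ~~ isolates S (B x)) Ss then nu x else 0.
  have nu'0 x : 0 <= nu' x by rewrite /nu'; case: ifP.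
  have [S hS] := exists_isolating nu'0 hB.
  exists (S :: Ss); split; first by rewrite /= sz.
  have N1 : 0 <= 1 - N%:R^-1 :> R.
    by rewrite subr_ge0 invf_le1 ?ler1n ?ltr0n.
  rewrite exprS -mulrA; apply: le_trans (ler_wpM2l N1 IH).
  have e1 : \sum_(x | B x != set0) nu' x =
    \sum_(x | (B x != set0) && all (fun S => ~~ isolates S (B x)) Ss) nu x.
    by rewrite big_mkcondr.
  have e2 : \sum_(x | B x != set0) nu' x =
     \sum_(x | (B x != set0) && isolates S (B x)) nu' x +
     \sum_(x | (B x != set0) && all (fun S => ~~ isolates S (B x)) (S :: Ss)) nu x.
    rewrite (bigID (fun x => isolates S (B x))) /=; congr (_ + _).
    rewrite /nu' -big_mkcondr; apply: eq_bigl => x /=.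
    by rewrite andbA.
  rewrite -e1; move: e2 hS; set a := \sum_(x | _) nu' x; set b := \sum_(x | _ && isolates _ _) _.
  set c := \sum_(x | _) nu x => e2 hS.
  have -> : c = a - b by lra.
  rewrite mulrBl mul1r lerD2l lerN2 ler_pdivrMl ?ltr0n //.
  by rewrite /N natrM.
exists (fun t => nth set0 Ss t); apply: le_trans (le_trans hS _).
  rewrite [leLHS]big_mkcond [leRHS]big_mkcond; apply: ler_sum => x _.
  case: (B x != set0) => //=; case: ifP => [/forallP h|_]; last by case: ifP.
  rewrite (_ : all _ _ = true) //; apply/(all_nthP set0) => i hi.
  by rewrite sz in hi; apply: (h (Ordinal hi)).
by apply: ler_wpM2r; [apply: sumr_ge0|apply: expr_decay].
Qed.

End Isolation.

(** * Circuits in normal form and their approximation by polynomials *)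

Section NormalForm.
Variables (I J : finType).
Notation cube := {ffun I -> bool}.
Notation lit := ((I + J) * bool)%type.
Implicit Types (A : J -> {set lit}) (g : J -> cube -> bool) (x : cube).

(* (inl i, b) and (inr j, b) stand for the input i and the gate j, negated
   when b holds. *)
Definition lit_eval g (a : lit) x : bool :=
  match a.1 with inl i => x i | inr j => g j x end (+) a.2.

(* All gates are OR gates, negations are on the wires, and dep j + 1 bounds the
   depth of gate j. *)
Record normal_form (d : nat) A g (dep : J -> nat) : Prop := NormalForm {
  nf_eval : forall j x, g j x = [exists a in A j, lit_eval g a x];
  nf_dep : forall j j' b, (inr j', b) \in A j -> (dep j' < dep j)%N;
  nf_depth : forall j, (dep j < d)%N }.

Definition true_lits A g (j : J) x : {set lit} := [set a in A j | lit_eval g a x].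

Lemma gate_true_lits d A g dep j x : normal_form d A g dep ->
  g j x = (true_lits A g j x != set0).
Proof.
move=> nf; rewrite (nf_eval nf); apply/existsP/set0Pn => -[a h]; exists a.
  by rewrite inE.
by move: h; rewrite inE.
Qed.

Section Copies.
Variables (R : realFieldType) (A : J -> {set lit}) (g : J -> cube -> bool) (T : nat).

(** The data of one Razborov-Smolensky polynomial: [T] sampled sets of literals for each gate. *)
Definition copy := J -> 'I_T -> {set lit}.

(** Stated with the true values of the wires, not with approximate ones, so that errors do not
    propagate and the event is within reach of the switching lemma. *)
Definition gate_bad (C : copy) (j : J) x : bool :=
  (true_lits A g j x != set0) &&
  [forall t, ~~ isolates (C j t) (true_lits A g j x)].

Definition bad (C : copy) x : bool := [exists j, gate_bad C j x].

Definition most_bad (t : nat) (Cs : 'I_t -> copy) x : bool :=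
  (t <= 2 * #|[set i | bad (Cs i) x]|)%N.

End Copies.

Lemma exists_copy (R : realFieldType) A g (nu : cube -> R) (n k : nat) :
  (forall x, 0 <= nu x) -> (forall j, #|A j| <= 2 ^ n)%N -> (16 * #|J| <= 2 ^ k)%N ->
  exists C : copy (8 * n.+1 * k), \sum_(x | bad A g C x) nu x <= 16^-1 * \sum_x nu x.
Proof.
move=> nu0 hA hk.
have hB j x : (#|true_lits A g j x| <= 2 ^ n)%N.
  apply: leq_trans (hA j); apply: subset_leq_card.
  by apply/subsetP=> a; rewrite inE => /andP[].
have [C hC] := fin_all_exists (fun j => exists_isolating_seq k nu0 (hB j)).
exists C; set tot := \sum_x nu x.
have tot0 : 0 <= tot by apply: sumr_ge0.
apply: (@le_trans _ _ (\sum_j \sum_(x | gate_bad A g C j x) nu x)).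
  under [leRHS]eq_bigr => j _ do rewrite big_mkcond.
  rewrite exchange_big big_mkcond; apply: ler_sum => x _.
  case: ifP => [/existsP[j hj]|_]; last by apply: sumr_ge0 => j _; case: ifP.
  by rewrite (bigD1 j) //= hj ler_wpDr // sumr_ge0 // => i _; case: ifP.
apply: (@le_trans _ _ (\sum_(j : J) 2^-1 ^+ k * tot)).
  by apply: ler_sum => j _; apply: hC.
rewrite sumr_const -[leLHS]mulr_natl mulrA; apply: ler_wpM2r => //.
rewrite exprVn ler_pdivrMr ?exprn_gt0 // mulrC ler_pdivlMr //.
by rewrite mulrC -natrX -natrM ler_nat.
Qed.

(** The potential gives [x] the weight 16 to the number of copies bad at [x]. Each new copy
    multiplies the total by at most 1 + 15/16, so it ends below [2 ^+ t] times the mass; where half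
    of the copies are bad the weight is at least [4 ^+ t]. *)
Lemma exists_copies (R : realFieldType) A g (nu : cube -> R) (n k t : nat) :
  (forall x, 0 <= nu x) -> (forall j, #|A j| <= 2 ^ n)%N -> (16 * #|J| <= 2 ^ k)%N ->
  exists Cs : 'I_t -> copy (8 * n.+1 * k),
    \sum_(x | most_bad A g Cs x) nu x <= 2^-1 ^+ t * \sum_x nu x.
Proof.
move=> nu0 hA hk; set tot := \sum_x nu x.
have tot0 : 0 <= tot by apply: sumr_ge0.
have [Cs hCs] : exists Cs : 'I_t -> copy (8 * n.+1 * k),
   \sum_x nu x * 16 ^+ #|[set i | bad A g (Cs i) x]| <= 2 ^+ t * tot.
  elim: t => [|t [Cs IH]].
    exists (fun _ _ _ => set0); rewrite expr0 mul1r.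
    apply: ler_sum => x _; rewrite [X in 16 ^+ X](_ : _ = 0%N) ?expr0 ?mulr1 //.
    by apply: eq_card0 => -[].
  (* Boosting: the next copy is chosen against the inputs on which many of the
     previous ones fail. *)
  pose nu' x := nu x * 16 ^+ #|[set i | bad A g (Cs i) x]|.
  have nu'0 x : 0 <= nu' x by rewrite mulr_ge0 ?exprn_ge0.
  have [C hC] := exists_copy g nu'0 hA hk.
  exists (fun i => if unlift ord0 i is Some i' then Cs i' else C).
  have e x : #|[set i | bad A g (if unlift ord0 i is Some i' then Cs i' else C) x]| =
      (bad A g C x + #|[set i | bad A g (Cs i) x]|)%N.
    rewrite (cardsD1 ord0) inE unlift_none; congr (_ + _)%N.
    rewrite -[RHS](card_imset _ (@lift_inj _ ord0)); apply: eq_card => i; rewrite !inE.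
    apply/andP/imsetP => [[i0]|[i' hi' ->]].
      case: unliftP i0 => [i' ->|->]; last by rewrite eqxx.
      by move=> _ h; exists i'; rewrite ?inE.
    by rewrite eq_sym neq_lift liftK; move: hi'; rewrite inE.
  have -> : \sum_x nu x * 16 ^+
      #|[set i | bad A g (if unlift ord0 i is Some i' then Cs i' else C) x]| =
      \sum_x nu' x + 15 * \sum_(x | bad A g C x) nu' x.
    rewrite mulr_sumr [X in _ + X]big_mkcond -big_split; apply: eq_bigr => x _ /=.
    rewrite e exprD /nu'; move: (16 ^+ #|_|) => y.
    by case: (bad A g C x); rewrite /= ?expr1 ?expr0; ring.
  have IH' : \sum_x nu' x <= 2 ^+ t * tot := IH.
  have X0 : 0 <= 2 ^+ t * tot by rewrite mulr_ge0 ?exprn_ge0.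
  by rewrite exprS -mulrA; move: IH' hC X0; lra.
exists Cs; rewrite exprVn mulrC ler_pdivlMr ?exprn_gt0 //.
have p4 : 0 < (2 ^+ t : R) by rewrite exprn_gt0.
rewrite -(ler_pM2r p4) -mulrA -exprMn [leRHS]mulrC.
apply: le_trans hCs; rewrite mulr_suml big_mkcond; apply: ler_sum => x _.
case: ifP => [h|_]; last by rewrite mulr_ge0 ?exprn_ge0.
apply: ler_wpM2l => //; rewrite (_ : 2 * 2 = 4 :> R); last by rewrite -natrM.
rewrite (_ : 16 = 4 ^+ 2 :> R); last by rewrite -natrX.
by rewrite -exprM; apply: ler_weXn2l; rewrite ?ler1n.
Qed.

Section Polynomials.
Variables (R : realFieldType) (A : J -> {set lit}) (g : J -> cube -> bool).
Variables (d : nat) (dep : J -> nat) (T : nat).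
Hypothesis nf : normal_form d A g dep.

Definition lit_poly (f : J -> cube -> R) (a : lit) x : R :=
  let v := match a.1 with inl i => (x i)%:R | inr j => f j x end in
  if a.2 then 1 - v else v.

Definition gate_poly (C : copy T) (f : J -> cube -> R) (j : J) x : R :=
  1 - \prod_t (1 - \sum_(a in C j t :&: A j) lit_poly f a x).

Definition circ_poly (C : copy T) (n : nat) : J -> cube -> R :=
  iter n (gate_poly C) (fun _ _ => 0).

Lemma lit_poly_eval f a x :
  (forall j, a.1 = inr j -> f j x = (g j x)%:R) ->
  lit_poly f a x = (lit_eval g a x)%:R.
Proof.
case: a => [[i|j] b] h; rewrite /lit_poly /lit_eval /=.
  by case: b h => _; case: (x i); rewrite /= ?subrr ?subr0.
by rewrite (h j) //; case: b h => _; case: (g j x); rewrite /= ?subrr ?subr0.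
Qed.

(** When the wires are right, the sum over [C j t] counts the sampled true literals: 0 for all [t]
    if the gate is false, and 1 for some [t] if it is true and not bad, which kills the product. *)
Lemma circ_poly_correct C n j x : (dep j < n)%N -> ~~ bad A g C x ->
  circ_poly C n j x = (g j x)%:R.
Proof.
move=> hn /existsPn nb; elim: n j hn => // n IH j hn.
rewrite /circ_poly iterS -/(circ_poly C n) /gate_poly.
have e t : \sum_(a in C j t :&: A j) lit_poly (circ_poly C n) a x =
   #|C j t :&: true_lits A g j x|%:R.
  rewrite -sum1_card natr_sum big_mkcond [RHS]big_mkcond; apply: eq_bigr => a _.
  rewrite !inE; case: (a \in C j t) => //=; case: (boolP (a \in A j)) => //= aA.
  rewrite lit_poly_eval => [|j' ej']; first by case: ifP.
  apply: IH; rewrite ltnS in hn; apply: leq_trans hn.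
  by apply: (nf_dep nf (b := a.2)); rewrite -ej' -surjective_pairing.
under eq_bigr => t _ do rewrite e.
rewrite (gate_true_lits j x nf); case: eqP => [->|/eqP B0] /=.
  by rewrite big1 ?subrr // => t _; rewrite setI0 cards0 subr0.
have := nb j; rewrite /gate_bad B0 /= => /forallPn[t]; rewrite negbK => /eqP ht.
by rewrite (bigD1 t) //= ht subrr mul0r subr0.
Qed.

Lemma degle_lit_poly k f a : (0 < k)%N -> (forall j, degle k (f j)) ->
  degle k (lit_poly f a).
Proof.
move=> k0 hf; have h : degle k (fun x => match a.1 with inl i => (x i)%:R | inr j => f j x end : R).
  case: a => [[i|j] b] //=; exact: degle_le k0 (degle_var R i).
by rewrite /lit_poly; case: a.2 => //; apply: degleB => //; apply: degle_cst.
Qed.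

Lemma degle_circ_poly C n j : (0 < T)%N -> degle (T ^ n) (circ_poly C n j).
Proof.
move=> T0; elim: n j => [|n IH] j; first exact: degle_cst.
rewrite /circ_poly iterS -/(circ_poly C n); apply: degleB; first exact: degle_cst.
rewrite expnS -{1}(size_enum_ord T) -(size_map (fun t : 'I_T => t)) map_id.
rewrite -[enum _]/(enum 'I_T).
apply: (@eq_degle _ _ _ (fun x => \prod_(t <- enum 'I_T)
  (1 - \sum_(a in C j t :&: A j) lit_poly (circ_poly C n) a x))).
  by move=> x; rewrite big_enum.
apply: degle_prod => t; apply: degleB; first exact: degle_cst.
by apply: degle_sum => a _; apply: degle_lit_poly; rewrite ?expn_gt0 ?T0.
Qed.

Lemma lit_poly_bound f a x (u : R) : 1 <= u -> (forall j, `|f j x| <= u) ->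
  `|lit_poly f a x| <= 1 + u.
Proof.
move=> u1 hf; have h : `|match a.1 with inl i => (x i)%:R | inr j => f j x end : R| <= u.
  by case: a => [[i|j] b] //=; case: (x i); rewrite ?normr1 ?normr0 //; lra.
rewrite /lit_poly; case: a.2; last by lra.
by apply: le_trans (ler_normB _ _) _; rewrite normr1 lerD2l.
Qed.

(** One layer turns the bound [2 ^+ e] into [2 ^+ ((k + 3 + e) * T)]; as [k + 3 <= e], the exponent
    grows by a factor [2 * T]. *)
Lemma circ_poly_bound C n k j x : (0 < T)%N -> (forall j, #|A j| <= 2 ^ k)%N ->
  `|circ_poly C n j x| <= 2 ^+ ((k + 3) * (2 * T) ^ n).
Proof.
move=> T0 hA; elim: n j => [|n IH] j; first by rewrite normr0 exprn_ge0.
rewrite /circ_poly iterS -/(circ_poly C n) /gate_poly.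
set e := ((k + 3) * (2 * T) ^ n)%N; set u : R := 2 ^+ e in IH.
have u1 : 1 <= u by rewrite exprn_ege1 ?ler1n.
have e1 : (k + 3 <= e)%N by rewrite leq_pmulr // expn_gt0 muln_gt0 T0.
have k1 : 1 <= 2 ^+ k :> R by rewrite exprn_ege1 ?ler1n.
pose v : R := 2 ^+ (k + 2) * u.
have v1 : 1 <= v by rewrite /v mulr_ege1 // exprn_ege1 ?ler1n.
have hs t : `|1 - \sum_(a in C j t :&: A j) lit_poly (circ_poly C n) a x| <= v.
  apply: le_trans (ler_normB _ _) _; rewrite normr1.
  apply: (@le_trans _ _ (1 + 2 ^+ k * (1 + u))); last first.
    by rewrite /v exprD; nra.
  rewrite lerD2l; apply: le_trans (ler_norm_sum _ _ _) _.
  apply: (@le_trans _ _ (\sum_(a in C j t :&: A j) (1 + u))).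
    by apply: ler_sum => a _; apply: lit_poly_bound.
  rewrite sumr_const -[leLHS]mulr_natl; apply: ler_wpM2r; first by lra.
  rewrite -natrX ler_nat; apply: leq_trans (hA j).
  by apply: subset_leq_card; apply: subsetIr.
have hp : `|\prod_t (1 - \sum_(a in C j t :&: A j) lit_poly (circ_poly C n) a x)| <= v ^+ T.
  rewrite normr_prod -[X in v ^+ X]card_ord -prodr_const.
  by apply: ler_prod => t _; rewrite normr_ge0 hs.
apply: le_trans (ler_normB _ _) _; rewrite normr1.
apply: (@le_trans _ _ (2 * v ^+ T)).
  have : 1 <= v ^+ T by rewrite exprn_ege1. lra.
apply: (@le_trans _ _ ((2 * v) ^+ T)).
  rewrite [leRHS]exprMn; apply: ler_wpM2r; first by rewrite exprn_ge0 //; lra.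
  by rewrite -{1}[2]expr1 ler_weXn2l ?ler1n.
have -> : 2 * v = 2 ^+ ((k + 3) + e) by rewrite /v /u mulrA -exprS -exprD -(addnS k 2).
rewrite -exprM; apply: ler_weXn2l; first by rewrite ler1n.
rewrite [(_ ^ n.+1)%N]expnS mulnCA -/e.
apply: (@leq_trans ((e + e) * T)); first by rewrite leq_mul2r leq_add2r e1 orbT.
by rewrite addnn -mul2n mulnAC.
Qed.

Section Majority.
Variables (t : nat) (v : 'I_t -> R).

(* The multilinear extension of majority: it is right as soon as most of the
   [v i] are the right bit, whatever the values of the others. *)
Definition maj : R :=
  \sum_(S : {set 'I_t} | (t < 2 * #|S|)%N) \prod_i (if i \in S then v i else 1 - v i).

Lemma maj_correct (b : bool) (G : {set 'I_t}) :
  (t < 2 * #|G|)%N -> (forall i, i \in G -> v i = b%:R) -> maj = b%:R.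
Proof.
move=> hG hv; have total : \sum_(S : {set 'I_t}) \prod_i (if i \in S then v i else 1 - v i) = 1.
  by rewrite -bigA_distr big1 // => i _; rewrite /= addrC subrK.
case: b hv => hv; last first.
  rewrite /maj big1 // => S hS; have [i iS iG] : exists2 i, i \in S & i \in G.
    case: (boolP [disjoint S & G]) => [d0|/pred0Pn[i /andP[]]]; last by exists i.
    have := cardsUI S G; rewrite (disjoint_setI0 d0) cards0.
    have : (#|S :|: G| <= t)%N by rewrite -[X in (_ <= X)%N]card_ord max_card.
    by move: hS hG; lia.
  by rewrite (bigD1 i) //= iS hv // mul0r.
move: total; rewrite (bigID (fun S : {set 'I_t} => (t < 2 * #|S|)%N)) /= => <-.
rewrite /maj -[LHS]addr0; congr (_ + _); rewrite big1 // => S hS.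
have [i iG iS] : exists2 i, i \in G & i \notin S.
  apply/subsetPn; apply/negP => /subset_leq_card le; rewrite -leqNgt in hS.
  by have := leq_trans (leq_mul (leqnn 2) le) hS; rewrite leqNgt hG.
by rewrite (bigD1 i) //= (negbTE iS) hv // subrr mul0r.
Qed.

Lemma maj_bound (u : R) : (forall i, `|v i| <= u) -> `|maj| <= (2 * (1 + u)) ^+ t.
Proof.
move=> hv; have u0 : (0 < t)%N -> 0 <= u by move=> t0; apply: le_trans (hv (Ordinal t0)).
apply: le_trans (ler_norm_sum _ _ _) _.
apply: (@le_trans _ _ (\sum_(S : {set 'I_t}) (1 + u) ^+ t)).
  rewrite big_mkcond; apply: ler_sum => S _.
  have h : `|\prod_i (if i \in S then v i else 1 - v i)| <= (1 + u) ^+ t.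
    rewrite normr_prod -[X in _ ^+ X]card_ord -prodr_const.
    apply: ler_prod => i _; rewrite normr_ge0 /=; case: ifP => _.
      by have := hv i; lra.
    by apply: le_trans (ler_normB _ _) _; rewrite normr1 lerD2l.
  case: ifP => // _; apply: le_trans h; exact: normr_ge0.
have ct : #|{: {set 'I_t}}| = (2 ^ t)%N.
  by rewrite -cardsT -powersetT card_powerset cardsT card_ord.
by rewrite sumr_const ct -[leLHS]mulr_natl natrX -exprMn.
Qed.

End Majority.

Lemma degle_maj (t k : nat) (v : 'I_t -> cube -> R) : (forall i, degle k (v i)) ->
  degle (t * k) (fun x => maj (fun i => v i x)).
Proof.
move=> hv; apply: degle_sum => S _.
apply: (@eq_degle _ _ _ (fun x => \prod_(i <- enum 'I_t) (if i \in S then v i x else 1 - v i x))).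
  by move=> x; rewrite big_enum.
rewrite -{1}(size_enum_ord t).
apply: (degle_prod (F := fun i x => if i \in S then v i x else 1 - v i x)) => i.
by case: (i \in S) => //; apply: degleB => //; apply: degle_cst.
Qed.

(** A possible negation at the output raises the bound [u] of the gate polynomials to [1 + u], and
    [2 * (1 + (1 + u)) <= 8 * u] accounts for the last [+ 3] in the exponent. *)
Lemma maj_poly_exists (t k : nat) (Cs : 'I_t -> copy T) (out : lit) :
  (0 < T)%N -> (forall j, #|A j| <= 2 ^ k)%N ->
  exists f : cube -> R,
  [/\ degle (t * T ^ d) f,
      forall x, `|f x| <= 2 ^+ (t * ((k + 3) * (2 * T) ^ d + 3)) &
      forall x, ~~ most_bad A g Cs x -> f x = (lit_eval g out x)%:R].
Proof.
move=> T0 hA.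
pose v i := lit_poly (circ_poly (Cs i) d) out.
exists (fun x => maj (fun i => v i x)); split.
- apply: degle_maj => i; apply: degle_lit_poly => [|j]; rewrite ?expn_gt0 ?T0 //.
  exact: degle_circ_poly.
- move=> x; set e := ((k + 3) * _)%N; pose u : R := 2 ^+ e.
  have u1 : 1 <= u by rewrite exprn_ege1 ?ler1n.
  apply: le_trans (maj_bound (u := 1 + u) _) _.
    by move=> i; apply: lit_poly_bound => // j; apply: circ_poly_bound.
  rewrite mulnC exprM exprD -/u; apply: lerXn2r; rewrite ?nnegrE ?mulr_ge0 ?exprn_ge0 //; lra.
- move=> x hx; apply: (@maj_correct _ _ _ [set i | ~~ bad A g (Cs i) x]).
    have hc := cardsC [set i | bad A g (Cs i) x]; rewrite card_ord in hc.
    have eC : ~: [set i | bad A g (Cs i) x] = [set i | ~~ bad A g (Cs i) x].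
      by apply/setP=> i; rewrite !inE.
    move: hx hc; rewrite /most_bad -ltnNge eC.
    by move: #|[set i | bad _ _ _ _]| #|[set i | ~~ _]| => a b; lia.
  move=> i; rewrite inE => nb; apply: lit_poly_eval => j _.
  by apply: circ_poly_correct; rewrite ?(nf_depth nf).
Qed.

End Polynomials.
End NormalForm.

(** * Fourier tail of the error event *)

Section Tail.
Variables (R : realFieldType) (I J : finType).
Notation cube := {ffun I -> bool}.
Notation restr := {ffun I -> option bool}.
Notation lit := ((I + J) * bool)%type.

Definition dnf_width (w : nat) (h : cube -> bool) : Prop :=
  exists2 G : seq restr,
    (forall T, T \in G -> (#|fixed T| <= w)%N) & dnf G =1 h.

Lemma dnf_width_le w w' h : (w <= w')%N -> dnf_width w h -> dnf_width w' h.
Proof.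
by move=> le [G hG e]; exists G => // T /hG /leq_trans; apply.
Qed.

Lemma dnf_width_exists (K : finType) (P : pred K) w (f : K -> cube -> bool) :
  (forall k, P k -> dt w (f k)) ->
  dnf_width w (fun x => [exists k, P k && f k x]).
Proof.
move=> h; have [k kP|G wG eG] := @dnf_has I K (enum P) w f.
  by apply: h; rewrite mem_enum in kP.
exists G => // x; rewrite eG; apply/hasP/existsP => [[k]|[k /andP[Pk fk]]].
  by rewrite mem_enum => kP fk; exists k; rewrite fk andbT.
by exists k; rewrite ?mem_enum.
Qed.

Lemma Phi_switching_family (K : finType) (h : K -> cube -> bool) (f : cube -> R)
    (l w : nat) (p eta B : R) :
  0 <= p < 1 -> 0 <= eta <= 1 -> (forall k, dnf_width w (h k)) ->
  (0 < l)%N -> (0 < w)%N -> (2 * #|K| <= 4 ^ l)%N -> 128 * w%:R * p <= 1 ->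
  0 <= B ->
  (forall rho, (forall k, dt l (fun x => h k (overwrite rho x))) ->
    Phi (fun=> 1 + eta) (fun x => f (overwrite rho x)) <= B) ->
  Phi (fun=> 1 + p * eta) f <= 2 * B.
Proof.
move=> p01 e01 hw l0 w0 Kl pw B0 hB.
have hw' k : exists G : seq restr, (forall T, T \in G -> (#|fixed T| <= w)%N) /\ dnf G =1 h k.
  by have [G h1 h2] := hw k; exists G.
have [G hG] := fin_all_exists hw'.
apply: (@Phi_switching _ _ f [seq G k | k <- enum K] l w) => //.
- by move=> _ T /mapP[k _ ->]; apply: (hG k).1.
- by rewrite size_map -cardE.
move=> rho hdt; apply: hB => k; apply: dt_ext (hdt (G k) _) => [x|].
  exact: (hG k).2.
by apply: map_f; rewrite mem_enum.
Qed.

Variables (A : J -> {set lit}) (g : J -> cube -> bool) (d : nat) (dep : J -> nat).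
Hypothesis nf : normal_form d A g dep.
Variables (T t : nat) (Cs : 'I_t -> copy I J T) (l w : nat) (p : R).
Hypothesis T_gt0 : (0 < T)%N.
Hypothesis l_gt0 : (0 < l)%N.
Hypothesis w_large : ((2 * T + 1) * l <= w)%N.
Hypothesis l_large : (4 * (t.+1 * #|J|.+1 * T) <= 4 ^ l)%N.
Hypothesis p01 : 0 <= p < 1.
Hypothesis pw : 128 * w%:R * p <= 1.

Let some_true (C : copy I J T) j s x := [exists a in C j s :&: A j, lit_eval g a x].
Let two_true (C : copy I J T) j s x :=
  [exists ab : lit * lit, [&& ab.1 \in C j s :&: A j, ab.2 \in C j s :&: A j & ab.1 != ab.2]
     && (lit_eval g ab.1 x && lit_eval g ab.2 x)].

(** Exactly one means at least one but not two. Both events are ORs, over literals and over pairs of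
    literals, hence narrow DNFs once the gates are shallow trees. *)
Lemma isolatesE C j s x :
  isolates (C j s) (true_lits A g j x) = some_true C j s x && ~~ two_true C j s x.
Proof.
rewrite /isolates; set S := _ :&: _.
have memS a : a \in S = (a \in C j s :&: A j) && lit_eval g a x.
  by rewrite !inE andbA.
have -> : some_true C j s x = (S != set0).
  by apply/existsP/set0Pn => -[a h]; exists a; rewrite ?memS // -memS.
have -> : two_true C j s x = (1 < #|S|)%N.
  apply/existsP/card_gt1P => [[[a b] /= /andP[/and3P[aC bC ab] /andP[ha hb]]]|[a [b [aS bS ab]]]].
    by exists a, b; split; rewrite ?memS ?aC ?bC.
  by exists (a, b); move: aS bS; rewrite /= !memS ab => /andP[-> ->] /andP[-> ->].
by rewrite -card_gt0; case: #|S| => [|[|k]].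
Qed.

Lemma dt_lit rho n (a : lit) : (0 < n)%N ->
  (forall j, a.1 = inr j -> dt n (fun x => g j (overwrite rho x))) ->
  dt n (fun x => lit_eval g a (overwrite rho x)).
Proof.
move=> n0 h; case: a h => [[i|j] b] h; last first.
  exact: (dt_comp (fun v => v (+) b) (h j erefl)).
apply: dt_le n0 _; apply: (dt_overwrite rho (f := fun x : cube => x i (+) b)).
apply: (dt_comp (fun v => v (+) b)); apply: (@dt_query _ _ _ _ i) => c.
by apply: (@dt_leaf _ _ _ _ c) => x; rewrite ffunE eqxx.
Qed.

Lemma w_ge n : (n <= 2 * T + 1)%N -> (n * l <= w)%N.
Proof. by move=> h; apply: leq_trans w_large; rewrite leq_mul2r h orbT. Qed.

Lemma w_gt0 : (0 < w)%N.
Proof. by apply: leq_trans (w_ge (n := 1) _); rewrite ?mul1n // addn1. Qed.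

Let E x : R := (most_bad A g Cs x)%:R.

Lemma Phi_error_last rho :
  (forall i, dt l (fun x => bad A g (Cs i) (overwrite rho x))) ->
  Phi (fun=> 1 + 1) (fun x => E (overwrite rho x)) <= 2 ^+ (t * l).
Proof.
move=> h; apply: (Phi_dt (f := fun x => most_bad A g Cs (overwrite rho x))); first by lra.
have := dt_ffun (fun b : {ffun 'I_t -> bool} => (t <= 2 * #|[set i | b i]|)%N) h.
rewrite card_ord; apply: dt_ext => x; rewrite /most_bad.
by congr (_ <= 2 * _)%N; apply: eq_card => i; rewrite !inE ffunE.
Qed.

(** One tree for the gate and two for each of the [T] sampled sets, all of depth [l]. *)
Lemma gate_bad_dt C j rho :
  (forall j, dt l (fun x => g j (overwrite rho x))) ->
  (forall s, dt l (fun x => some_true C j s (overwrite rho x))) ->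
  (forall s, dt l (fun x => two_true C j s (overwrite rho x))) ->
  dt ((2 * T + 1) * l) (fun x => gate_bad A g C j (overwrite rho x)).
Proof.
move=> hg h1 h2.
have hs s : dt (l + l) (fun x =>
    some_true C j s (overwrite rho x) && ~~ two_true C j s (overwrite rho x)).
  exact: (dt_comp2 (fun a b => a && ~~ b) (h1 s) (h2 s)).
have hT := dt_ffun (fun b : {ffun 'I_T -> bool} => [forall s, ~~ b s]) hs.
have := dt_comp2 andb (hg j) hT.
rewrite card_ord (_ : (l + T * (l + l) = (2 * T + 1) * l)%N); last by lia.
apply: dt_ext => x; rewrite /gate_bad (gate_true_lits j _ nf); congr (_ && _).
by apply: eq_forallb => s; rewrite ffunE isolatesE.
Qed.

Lemma Phi_error_bad rho :
  (forall j, dt l (fun x => g j (overwrite rho x))) ->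
  (forall i j s, dt l (fun x => some_true (Cs i) j s (overwrite rho x))) ->
  (forall i j s, dt l (fun x => two_true (Cs i) j s (overwrite rho x))) ->
  Phi (fun=> 1 + p * 1) (fun x => E (overwrite rho x)) <= 2 * 2 ^+ (t * l).
Proof.
move=> hg h1 h2.
apply: (@Phi_switching_family 'I_t (fun i x => bad A g (Cs i) (overwrite rho x)) _ l w) => //.
- by lra.
- move=> i; apply: (dnf_width_le w_large).
  have [G wG eG] := dnf_width_exists (P := xpredT)
    (fun j _ => gate_bad_dt hg (h1 i j) (h2 i j)).
  by exists G => // x; rewrite eG; apply: eq_existsb.
- exact: w_gt0.
- rewrite card_ord; apply: leq_trans l_large.
  have : (t.+1 <= t.+1 * #|J|.+1 * T)%N by rewrite -mulnA leq_pmulr // muln_gt0.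
  by move: (t.+1 * _ * _)%N => y; lia.
- by rewrite exprn_ge0.
move=> rho' h; rewrite (eq_Phi _ (g := fun x => E (overwrite (over rho' rho) x))).
  apply: Phi_error_last => i; apply: dt_ext (h i) => x; by rewrite overwrite_over.
by move=> x; rewrite overwrite_over.
Qed.

Lemma Phi_error_gates rho :
  (forall j, dt l (fun x => g j (overwrite rho x))) ->
  Phi (fun=> 1 + p * (p * 1)) (fun x => E (overwrite rho x)) <= 2 * (2 * 2 ^+ (t * l)).
Proof.
move=> hg; case/andP: (p01) => p0 p1.
have hlit a : dt l (fun x => lit_eval g a (overwrite rho x)) by apply: dt_lit.
pose h (k : 'I_t * J * 'I_T * bool) (x : cube) : bool :=
  let: (i, j, s, b) := k in
  if b then some_true (Cs i) j s (overwrite rho x) else two_true (Cs i) j s (overwrite rho x).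
apply: (@Phi_switching_family _ h _ l w) => //.
- by rewrite mulr1 p0 ltW.
- move=> [[[i j] s] []] /=.
    apply: (dnf_width_le (w_ge (n := 1) _)); first by lia.
    by rewrite mul1n; apply: dnf_width_exists.
  apply: (dnf_width_le (w_ge (n := 2) _)); first by lia.
  apply: dnf_width_exists => -[a b] _ /=; rewrite mul2n -addnn.
  exact: (dt_comp2 andb (hlit a) (hlit b)).
- exact: w_gt0.
- rewrite !card_prod !card_ord card_bool; apply: leq_trans l_large.
  rewrite (_ : 2 * _ = 4 * (t * #|J| * T))%N; last by lia.
  by rewrite leq_mul2l leq_mul2r leq_mul ?orbT // ltnW.
- by rewrite mulr_ge0 ?exprn_ge0.
move=> rho' h'; rewrite (eq_Phi _ (g := fun x => E (overwrite (over rho' rho) x))); last first.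
  by move=> x; rewrite overwrite_over.
apply: Phi_error_bad.
- move=> j; apply: dt_ext (dt_overwrite rho' (hg j)) => x; by rewrite overwrite_over.
- move=> i j s; apply: dt_ext (h' (i, j, s, true)) => x; by rewrite overwrite_over.
- move=> i j s; apply: dt_ext (h' (i, j, s, false)) => x; by rewrite overwrite_over.
Qed.

(** A restriction makes one more layer shallow: the gate inputs of a gate with [dep j + k < d]
    satisfy the hypothesis for [k.+1], so the gate is a DNF of width [l]. Nothing is assumed at
    [k = d], and at [k = 0] the two rounds of [Phi_error_gates] remain. Each round costs a factor 2
    and a factor [p] in [lam - 1]. *)
Lemma Phi_error_depth k rho :
  (forall j, (dep j + k < d)%N -> dt l (fun x => g j (overwrite rho x))) ->
  Phi (fun=> 1 + p ^+ k.+2) (fun x => E (overwrite rho x)) <= 2 ^+ k.+2 * 2 ^+ (t * l).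
Proof.
case/andP: (p01) => p0 p1; elim: k rho => [|k IH] rho hg.
  have := @Phi_error_gates rho _; rewrite mulr1 -!expr2 mulrA -expr2; apply => j.
  by apply: hg; rewrite addn0 (nf_depth nf).
rewrite exprS [2 ^+ k.+3]exprS -mulrA.
pose h (j : J) (x : cube) : bool := if (dep j + k < d)%N then g j (overwrite rho x) else false.
apply: (@Phi_switching_family _ h _ l w) => //.
- by rewrite exprn_ge0 //= exprn_ile1 // ltW.
- move=> j; apply: (dnf_width_le (w_ge (n := 1) _)); first by lia.
  rewrite mul1n /h; case: (boolP (dep j + k < d)%N) => hd; last by exists [::].
  have [|G wG eG] := @dnf_width_exists _ (mem (A j)) l (fun a x => lit_eval g a (overwrite rho x)).
    move=> a aA; apply: dt_lit => // j' ej'; apply: hg.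
    have : (dep j' < dep j)%N by apply: (nf_dep nf (b := a.2)); rewrite -ej' -surjective_pairing.
    by move: hd; lia.
  by exists G => // x; rewrite eG (nf_eval nf).
- exact: w_gt0.
- apply: leq_trans l_large.
  have : (#|J|.+1 <= t.+1 * #|J|.+1 * T)%N by rewrite mulnAC leq_pmull // muln_gt0.
  by move: (t.+1 * _ * _)%N => y; lia.
- by rewrite mulr_ge0 ?exprn_ge0.
move=> rho' h'; rewrite (eq_Phi _ (g := fun x => E (overwrite (over rho' rho) x))); last first.
  by move=> x; rewrite overwrite_over.
apply: IH => j hj; apply: dt_ext (h' j) => x; by rewrite /h hj overwrite_over.
Qed.

Lemma Phi_error : Phi (fun=> 1 + p ^+ d.+2) E <= 2 ^+ d.+2 * 2 ^+ (t * l).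
Proof.
rewrite (eq_Phi _ (g := fun x => E (overwrite (free I) x))) => [|x]; last by rewrite overwrite_free.
by apply: Phi_error_depth => j; rewrite ltnNge leq_addl.
Qed.

End Tail.

(** * Fooling circuits with narrow gates *)

Section Sandwich.
Variables (R : realFieldType) (I J : finType).
Notation cube := {ffun I -> bool}.
Notation lit := ((I + J) * bool)%type.

(* P vanishes together with F || E, because f (1 - Et) does. Where E holds, f
   carries no information and P may be far below 1, but E is rare for nu. *)
Lemma lower_polynomial (A : J -> {set lit}) (g : J -> cube -> bool)
    (d : nat) (dep : J -> nat) (out : lit) (nu : cube -> R)
    (n k t l w K : nat) (p U kappa : R) :
  let T := (8 * n.+1 * k)%N in
  normal_form d A g dep -> (forall j, #|A j| <= 2 ^ n)%N ->
  (0 < k)%N -> (16 * #|J| <= 2 ^ k)%N -> (0 < l)%N ->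
  ((2 * T + 1) * l <= w)%N -> (4 * (t.+1 * #|J|.+1 * T) <= 4 ^ l)%N ->
  0 <= p < 1 -> 128 * w%:R * p <= 1 -> (forall x, 0 <= nu x) ->
  2 ^+ (t * ((n + 3) * (2 * T) ^ d + 3)) <= U -> 0 <= kappa ->
  2 ^+ d.+2 * 2 ^+ (t * l) <= kappa * (1 + p ^+ d.+2) ^+ K ->
  exists (P : cube -> R) (E : pred cube),
  [/\ degle (2 * (t * T ^ d + K)) P,
      \sum_(x | E x) nu x <= 2^-1 ^+ t * \sum_x nu x,
      forall x, P x <= (lit_eval g out x || E x)%:R &
      mean (fun x => (lit_eval g out x || E x)%:R - P x) <=
        2 * mean (fun x => (E x)%:R) + 2 * U ^+ 2 * kappa].
Proof.
move=> T nf hA k0 Jk l0 wT lT p01 pw nu0 hU kap0 hkap; case/andP: (p01) => p0 p1.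
have T0 : (0 < T)%N by rewrite /T muln_gt0 k0.
have [Cs hCs] := exists_copies g t nu0 hA Jk.
have [f [fdeg fU fgood]] := maj_poly_exists R nf Cs out T0 hA.
pose E := most_bad A g Cs.
pose e x : R := (E x)%:R.
pose et := lowpart K e.
pose f' x := f x * (1 - et x).
have U1 : 1 <= U by apply: le_trans hU; rewrite exprn_ege1 ?ler1n.
have err : mean (fun x => (e x - et x) ^+ 2) <= kappa.
  have l1 : 1 <= 1 + p ^+ d.+2 by rewrite lerDl exprn_ge0.
  have lK : 0 < (1 + p ^+ d.+2) ^+ K by rewrite exprn_gt0 //; lra.
  rewrite -(ler_pM2r lK); apply: le_trans hkap.
  apply: le_trans (lowpart_err K e l1) _.
  exact: (Phi_error nf Cs (l := l) (w := w)).
exists (fun x => 1 - (1 - f' x) * (1 - f' x)), E; split => //.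
- have hf' : degle (t * T ^ d + K) f'.
    by apply: degleM => //; apply: degleB; [apply: degle_cst|apply: degle_lowpart].
  apply: degleB; first exact: degle_cst.
  by rewrite mul2n -addnn; apply: degleM; apply: degleB => //; apply: degle_cst.
- move=> x; case: (boolP (E x)) => Ex.
    by rewrite orbT lerBlDr lerDl -expr2 sqr_ge0.
  rewrite orbF /f' fgood //; case: (lit_eval g out x).
    by rewrite lerBlDr lerDl -expr2 sqr_ge0.
  by rewrite mul0r subr0 mulr1 subrr.
(* The difference to bound is [(1 - f') ^+ 2] where [E] holds, at most [2 + 2 * f' ^+ 2] with
   [f' = f * (e - et)]. Elsewhere it is [et ^+ 2 = (e - et) ^+ 2] if the circuit is true, and 0 if
   it is false. *)
- apply: (@le_trans _ _ (mean (fun x => 2 * (E x)%:R + 2 * U ^+ 2 * (e x - et x) ^+ 2))).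
    apply: ler_mean => x.
    have U2 : 1 <= U ^+ 2 by rewrite exprn_ege1.
    case: (boolP (E x)) => Ex.
      have h : f x ^+ 2 * (1 - et x) ^+ 2 <= U ^+ 2 * (1 - et x) ^+ 2.
        rewrite ler_wpM2r ?sqr_ge0 // -[f x ^+ 2]real_normK ?num_real //.
        apply: lerXn2r; rewrite ?nnegrE //; first by lra.
        exact: le_trans (fU x) hU.
      rewrite orbT /f' /e Ex /=; move: h; move: (et x) => y.
      have := sqr_ge0 (1 + f x * (1 - y)); rewrite !expr2; lra.
    have h : et x ^+ 2 <= U ^+ 2 * et x ^+ 2 by rewrite ler_peMl ?sqr_ge0.
    rewrite orbF /f' fgood // /e (negbTE Ex); move: h; rewrite !expr2.
    by have := sqr_ge0 (et x); rewrite expr2; case: (lit_eval g out x) => /=; lra.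
  by rewrite meanD !meanZ lerD2l ler_wpM2l // mulr_ge0 ?exprn_ge0 //; lra.
Qed.

End Sandwich.

(** * Almost indistinguishable distributions against polynomials and narrow circuits *)

Section Fooling.
Variables (R : realType) (m : nat).
Implicit Types (D : dist R (bits m)) (S : {set 'I_m}).

Definition depends_on (V : Type) S (h : bits m -> V) : Prop :=
  forall x x' : bits m, (forall i, i \in S -> x i = x' i) -> h x = h x'.

Lemma expectation_push S D (h : bits m -> R)
    (h' : {ffun {i : 'I_m | i \in S} -> bool} -> R) :
  (forall x, h x = h' (restrict S x)) ->
  expectation D h = \sum_y marginal S D y * h' y.
Proof.
move=> e; rewrite /expectation (partition_big (restrict S) predT) //=.
apply: eq_bigr => y _; rewrite mulr_suml; apply: eq_bigr => x /eqP <-.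
by rewrite e.
Qed.

Lemma indist_depends k delta D1 D2 S (h : bits m -> R) (b : R) :
  almost_indist k delta D1 D2 -> (#|S| <= k)%N -> depends_on S h ->
  (forall x, `|h x| <= b) ->
  `|expectation D1 h - expectation D2 h| <= 2 * delta * b.
Proof.
move=> ind Sk dep hb.
pose ext (y : {ffun {i : 'I_m | i \in S} -> bool}) : bits m :=
  [ffun i => if insub i is Some u then y u else false].
have eh (x : bits m) : h x = h (ext (restrict S x)).
  apply: dep => i iS; rewrite ffunE; case: insubP => [u _ ui|]; last by rewrite iS.
  by rewrite ffunE ui.
rewrite !(expectation_push (h' := fun y => h (ext y)) _ eh) -sumrB.
have b0 : 0 <= b by apply: le_trans (hb [ffun=> false]).
apply: le_trans (ler_norm_sum _ _ _) _.
have := ind S Sk; rewrite /tv_dist => tv.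
apply: (@le_trans _ _ (\sum_y `|marginal S D1 y - marginal S D2 y| * b)).
  by apply: ler_sum => y _; rewrite -mulrBl normrM ler_wpM2l.
by rewrite -mulr_suml; apply: ler_wpM2r => //; lra.
Qed.

Lemma indist_delta_ge0 k delta D1 D2 : almost_indist k delta D1 D2 -> 0 <= delta.
Proof.
move=> /(_ set0); rewrite cards0 => /(_ isT); apply: le_trans.
by rewrite /tv_dist; apply: mulr_ge0; rewrite ?invr_ge0 //; apply: sumr_ge0.
Qed.

Lemma almost_indist_le k k' delta D1 D2 : (k' <= k)%N ->
  almost_indist k delta D1 D2 -> almost_indist k' delta D1 D2.
Proof. by move=> le h S Sk; apply: h; apply: leq_trans le. Qed.

Lemma expectation_sum (K : Type) (r : seq K) (Q : pred K) D (F : K -> bits m -> R) :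
  expectation D (fun x => \sum_(i <- r | Q i) F i x) =
  \sum_(i <- r | Q i) expectation D (F i).
Proof.
rewrite /expectation exchange_big; apply: eq_bigr => x _.
by rewrite mulr_sumr.
Qed.

Lemma expectationZ D c (F : bits m -> R) :
  expectation D (fun x => c * F x) = c * expectation D F.
Proof. by rewrite /expectation mulr_sumr; apply: eq_bigr => x _; rewrite mulrCA. Qed.

Lemma eq_expectation D (F G : bits m -> R) :
  F =1 G -> expectation D F = expectation D G.
Proof. by move=> e; apply: eq_bigr => x _; rewrite e. Qed.

Lemma ler_expectation D (F G : bits m -> R) :
  (forall x, F x <= G x) -> expectation D F <= expectation D G.
Proof. by move=> h; apply: ler_sum => x _; rewrite ler_wpM2l ?pmf_ge0. Qed.

Lemma expectationD D (F G : bits m -> R) :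
  expectation D (fun x => F x + G x) = expectation D F + expectation D G.
Proof.
by rewrite /expectation -big_split; apply: eq_bigr => x _; rewrite mulrDr.
Qed.

Lemma expectationB D (F G : bits m -> R) :
  expectation D (fun x => F x - G x) = expectation D F - expectation D G.
Proof.
by rewrite /expectation -sumrB; apply: eq_bigr => x _; rewrite mulrBr.
Qed.

Lemma expectation_bool D (F : pred (bits m)) :
  expectation D (fun x => (F x)%:R) = \sum_(x | F x) D x.
Proof.
rewrite /expectation [RHS]big_mkcond; apply: eq_bigr => x _.
by case: (F x); rewrite ?mulr1 ?mulr0.
Qed.

(** At most [m.+1 ^ k] characters occur; each reads at most [k] bits, so its expectations differ by
    at most [2 * delta], and its coefficient is at most the mean of the absolute value of [P]. *)
Lemma indist_degle k delta D1 D2 (P : bits m -> R) :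
  almost_indist k delta D1 D2 -> degle k P ->
  `|expectation D1 P - expectation D2 P| <=
  2 * delta * (m.+1 ^ k)%:R * mean (fun x => `|P x|).
Proof.
move=> ind degP; have d0 := indist_delta_ge0 ind.
have eP D : expectation D P =
    \sum_(S : {set 'I_m} | (#|S| <= k)%N) hat P S * expectation D (@chi R 'I_m S).
  rewrite (eq_expectation D (hat_inv P)) expectation_sum [RHS]big_mkcond.
  apply: eq_bigr => S _; rewrite expectationZ; case: leqP => // kS.
  by rewrite degP ?mul0r.
rewrite !eP -sumrB; apply: le_trans (ler_norm_sum _ _ _) _.
have M0 : 0 <= mean (fun x => `|P x|) by apply: mean_ge0.
apply: (@le_trans _ _ (\sum_(S : {set 'I_m} | (#|S| <= k)%N)
    mean (fun x => `|P x|) * (2 * delta))).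
  apply: ler_sum => S Sk; rewrite -mulrBr normrM; apply: ler_pM => //.
    exact: normr_hat_le.
  rewrite -[2 * delta]mulr1; apply: (indist_depends ind Sk) => [x x' e|x].
    by apply: eq_bigr => i iS; rewrite e.
  by rewrite normr_chi.
have := card_small_sets 'I_m k; rewrite card_ord cardsE => hc.
rewrite sumr_const -[leLHS]mulr_natl.
have -> : 2 * delta * (m.+1 ^ k)%:R * mean (fun x => `|P x|) =
  (m.+1 ^ k)%:R * (mean (fun x => `|P x|) * (2 * delta)) by ring.
apply: ler_wpM2r.
  by apply: mulr_ge0 => //; apply: mulr_ge0.
rewrite ler_nat; apply: leq_trans hc; apply: subset_leq_card; apply/subsetP=> S.
by [].
Qed.

Lemma fool_normal_form (J : finType) (A : J -> {set (('I_m + J) * bool)%type})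
    (g : J -> bits m -> bool) (d : nat) (dep : J -> nat) out
    (n k l w K L : nat) (p U delta R0 : R) D1 D2 :
  let T := (8 * n.+1 * k)%N in let t := (L + 5)%N in
  let k' := (2 * (t * T ^ d + K))%N in
  normal_form d A g dep -> (forall j, #|A j| <= 2 ^ n)%N ->
  (0 < k)%N -> (16 * #|J| <= 2 ^ k)%N -> (0 < l)%N ->
  ((2 * T + 1) * l <= w)%N -> (4 * (t.+1 * #|J|.+1 * T) <= 4 ^ l)%N ->
  0 <= p < 1 -> 128 * w%:R * p <= 1 ->
  2 ^+ (t * ((n + 3) * (2 * T) ^ d + 3)) <= U ->
  U ^+ 2 * 2 ^+ (L + 4) * (2 ^+ d.+2 * 2 ^+ (t * l)) <= (1 + p ^+ d.+2) ^+ K ->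
  1 <= R0 -> (forall x, D1 x <= R0 / 2 ^+ m) ->
  almost_indist k' delta D1 D2 ->
  expectation D1 (fun x => (lit_eval g out x)%:R) -
  expectation D2 (fun x => (lit_eval g out x)%:R) <=
  R0 / 2 ^+ L / 4 + 4 * delta * (m.+1 ^ k')%:R.
Proof.
move=> T t k' nf hA k0 Jk l0 wT lT p01 pw hU hK R01 hD1 ind.
have d0 := indist_delta_ge0 ind.
have two0 i : 0 < (2 ^+ i : R) by rewrite exprn_gt0.
have U1 : 1 <= U by apply: le_trans hU; rewrite exprn_ege1 ?ler1n.
have U2 : 0 < U ^+ 2 by rewrite exprn_gt0 //; lra.
(* The mass of [E] is its probability under [D2] plus [2 * R0 * mean e], exactly the two error terms
   needed. The total mass is at most [3 * R0], and the 5 in [t] brings the mass of [E] below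
   [R0 / 2 ^+ L / 8]. *)
pose nu x : R := D2 x + 2 * R0 / 2 ^+ m.
have nu0 x : 0 <= nu x by rewrite addr_ge0 ?pmf_ge0 // !mulr_ge0 ?invr_ge0 ?(ltW (two0 _)) //; lra.
(* Makes [R0 * (2 * U ^+ 2 * kappa)] the other [R0 / 2 ^+ L / 8]. *)
pose kappa : R := (U ^+ 2 * 2 ^+ (L + 4))^-1.
have kap0 : 0 < kappa by rewrite invr_gt0 mulr_gt0.
have hkap : 2 ^+ d.+2 * 2 ^+ (t * l) <= kappa * (1 + p ^+ d.+2) ^+ K.
  by rewrite /kappa ler_pdivlMl // mulr_gt0.
have [P [E [degP nuE PH errP]]] :=
  lower_polynomial out nf hA k0 Jk l0 wT lT p01 pw nu0 hU (ltW kap0) hkap.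
set F := fun x => (lit_eval g out x)%:R.
pose H x : R := (lit_eval g out x || E x)%:R.
pose e x : R := (E x)%:R.
have HP0 x : 0 <= H x - P x by rewrite subr_ge0; apply: PH.
pose mE := mean e; pose mHP := mean (fun x => H x - P x).
rewrite -/mE -/mHP in errP.
have sumnu : \sum_x nu x = 1 + 2 * R0.
  rewrite big_split /= pmf_sum1 sumr_const card_ffun card_bool card_ord.
  by rewrite -[X in _ + X]mulr_natl natrX; field; rewrite gt_eqF.
have nuE' : expectation D2 e + 2 * R0 * mE <= R0 / 2 ^+ L / 8.
  have -> : expectation D2 e + 2 * R0 * mE = \sum_(x | E x) nu x.
    rewrite big_split /= expectation_bool; congr (_ + _).
    rewrite /mE /mean card_ord mulr_sumr mulr_sumr [RHS]big_mkcond.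
    by apply: eq_bigr => x _; rewrite /e; case: (E x); rewrite ?mulr1 ?mulr0.
  apply: le_trans nuE _; rewrite sumnu exprVn /t exprD invfM.
  have h : 0 < (2 ^+ L : R)^-1 by rewrite invr_gt0.
  rewrite (_ : 2 ^+ 5 = 32 :> R); last by rewrite -natrX.
  set y := (2 ^+ L)^-1 in h *; rewrite -[R0 / _]/(R0 * y).
  have : y <= R0 * y by rewrite ler_peMl // ltW.
  nra.
have errP' : R0 * (2 * U ^+ 2 * kappa) = R0 / 2 ^+ L / 8.
  rewrite /kappa exprD (_ : 2 ^+ 4 = 16 :> R); last by rewrite -natrX.
  by field; rewrite !gt_eqF //; lra.
have mE0 : 0 <= mE by apply: mean_ge0 => x; rewrite ler0n.
have e20 : 0 <= expectation D2 e.
  by apply: sumr_ge0 => x _; rewrite mulr_ge0 ?pmf_ge0 ?ler0n.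
have b1 : expectation D1 F <= expectation D1 H.
  by apply: ler_expectation => x; rewrite /F /H; case: (lit_eval g out x); case: (E x).
have b2 : expectation D2 H <= expectation D2 F + expectation D2 e.
  rewrite -expectationD; apply: ler_expectation => x; rewrite /F /H /e.
  by case: (lit_eval g out x); case: (E x); rewrite /= ?addr0 ?add0r // lerDl ler01.
have b3 : expectation D2 P <= expectation D2 H by apply: ler_expectation => x; apply: PH.
have b4 : expectation D1 H - expectation D1 P <= R0 * mHP.
  rewrite -expectationB /mHP /mean card_ord mulrA mulr_sumr.
  by apply: ler_sum => x _; rewrite ler_wpM2r.
(* The absolute value of [P] is at most [1 + (H - P)], and [H - P] has mean at most 1. This 2 turns
   the [2 * delta] of [indist_degle] into [4 * delta]. *)
have b5 : mean (fun x => `|P x|) <= 2.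
  apply: (@le_trans _ _ (mean (fun x => 1 + (H x - P x)))).
    apply: ler_mean => x; have h1 : H x <= 1 by rewrite /H; case: (_ || _).
    have h0 : 0 <= H x by rewrite /H.
    by have := HP0 x; rewrite ler_norml; move=> h2; apply/andP; split; lra.
  rewrite meanD -/mHP.
  have -> : mean (fun _ : bits m => 1 : R) = 1.
    rewrite /mean sumr_const card_ffun card_bool card_ord -[X in _ * X]mulr_natl.
    rewrite mulr1 natrX mulVf //.
    by rewrite gt_eqF.
  have hy : (2 ^+ L : R)^-1 <= 1 by rewrite invf_le1 // exprn_ege1 ?ler1n.
  have : R0 * mHP <= R0 * 1; last by rewrite ler_pM2l; lra.
  apply: le_trans (ler_wpM2l _ errP) _; first by lra.
  rewrite mulrDr errP'.
  have : R0 / 2 ^+ L <= R0 * 1 by rewrite ler_wpM2l //; lra.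
  lra.
have b6 := indist_degle ind degP; rewrite ler_norml in b6; case/andP: b6 => _ b6.
have b7 : 2 * delta * (m.+1 ^ k')%:R * mean (fun x => `|P x|) <=
    4 * delta * (m.+1 ^ k')%:R.
  have -> : 4 * delta * (m.+1 ^ k')%:R = 2 * delta * (m.+1 ^ k')%:R * 2 by ring.
  by rewrite ler_wpM2l // !mulr_ge0 ?ler0n.
have b8 : R0 * mHP <= R0 * (2 * mE) + R0 / 2 ^+ L / 8.
  by rewrite -errP' -mulrDr ler_wpM2l //; lra.
lra.
Qed.

End Fooling.

Local Open Scope nat_scope.

(** * Normal form of circuits *)

Section Runs.
Variables (V : Type) (v0 : V) (F : seq V -> gate -> V).

Definition run (l : seq V) (gs : seq gate) : seq V :=
  foldl (fun vs g => rcons vs (F vs g)) l gs.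

Lemma nth_run_prefix l gs i : i < size l -> nth v0 (run l gs) i = nth v0 l i.
Proof.
elim: gs l => //= g gs IH l il.
rewrite IH; first by rewrite nth_rcons il.
by rewrite size_rcons ltnS ltnW.
Qed.

Hypothesis F_local : forall vs vs' g,
  (forall w, w \in gate_wires g -> nth v0 vs w = nth v0 vs' w) -> F vs g = F vs' g.

(** Later gates only append, so the wires of gate [j] have the same values in the final list as when
    the gate was evaluated. *)
Lemma nth_run l gs j : wf_gates (size l) gs -> j < size gs ->
  nth v0 (run l gs) (size l + j) = F (run l gs) (nth (Not 0) gs j).
Proof.
elim: gs l j => //= g gs IH l j /andP[wfg wfgs] hj.
case: j hj => [|j] hj; last first.
  have e : size (rcons l (F l g)) = (size l).+1 by rewrite size_rcons.
  by rewrite addnS -addSn -e IH // e.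
rewrite addn0 nth_run_prefix ?size_rcons // nth_rcons ltnn eqxx.
apply: F_local => w wg; have wl := allP wfg _ wg.
by rewrite nth_run_prefix ?size_rcons ?ltnS ?(ltnW wl) // nth_rcons wl.
Qed.
End Runs.

Lemma wf_wires n gs j w : wf_gates n gs -> j < size gs ->
  w \in gate_wires (nth (Not 0) gs j) -> w < n + j.
Proof.
elim: gs n j => //= g gs IH n j /andP[wfg wfgs] hj.
case: j hj => [|j] hj /=; first by rewrite addn0 => /(allP wfg).
by rewrite addnS -addSn; apply: IH.
Qed.

Lemma gate_eval_local vs vs' g :
  (forall w, w \in gate_wires g -> nth false vs w = nth false vs' w) ->
  gate_eval vs g = gate_eval vs' g.
Proof.
case: g => [ws|ws|w] /= h; first exact: eq_in_all.
- exact: eq_in_has.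
- by rewrite h ?mem_head.
Qed.

Lemma gate_depth_local ds ds' g :
  (forall w, w \in gate_wires g -> nth 0 ds w = nth 0 ds' w) ->
  gate_depth ds g = gate_depth ds' g.
Proof.
case: g => [ws|ws|w] /= h; last by rewrite h ?mem_head.
- by congr S; apply: eq_big_seq.
- by congr S; apply: eq_big_seq.
Qed.

Definition is_and_or (g : gate) : bool := if g is Not _ then false else true.
Definition is_and (g : gate) : bool := if g is And _ then true else false.

Section CircuitNormalForm.
Variables (m : nat) (c : circuit m) (d : nat).

Let gs := gates c.
Let vals (x : bits m) := run gate_eval [seq x i | i <- enum 'I_m] gs.
Let depths := run gate_depth (nseq m 0) gs.
Let gate_at j := nth (Not 0) gs j.

Lemma vals_gate x j : j < size gs ->
  nth false (vals x) (m + j) = gate_eval (vals x) (gate_at j).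
Proof.
have sz : size [seq x i | i <- enum 'I_m] = m by rewrite size_map size_enum_ord.
move=> jn; have := nth_run gate_eval_local (l := [seq x i | i <- enum 'I_m]) (j := j) (gs := gs).
by rewrite sz; apply=> //; apply: gates_wf.
Qed.

Lemma depths_gate j : j < size gs ->
  nth 0 depths (m + j) = gate_depth depths (gate_at j).
Proof.
move=> jn; have := nth_run gate_depth_local (l := nseq m 0) (j := j) (gs := gs).
by rewrite size_nseq; apply=> //; apply: gates_wf.
Qed.

(** NOT gates are absorbed into the signs of the wires, and gates deeper than [d] cannot feed an
    output of depth at most [d]. *)
Let shallow (j : 'I_(size gs)) : bool :=
  is_and_or (gate_at j) && (nth 0 depths (m + j) <= d).
Let J : finType := {j : 'I_(size gs) | shallow j}.
Notation lit := (('I_m + J) * bool)%type.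

Let val_at (j : J) : 'I_(size gs) := val j.
(** De Morgan: an AND gate is replaced by its negation, which is an OR of negated wires. *)
Let g (j : J) (x : bits m) : bool :=
  nth false (vals x) (m + val_at j) (+) is_and (gate_at (val_at j)).
Let dep (j : J) : nat := (nth 0 depths (m + val_at j)).-1.

(** The condition on depths is what makes [dep] decrease along the wires of the normal form. *)
Let represents (a : lit) (v : nat) : bool :=
  [forall x, nth false (vals x) v == lit_eval g a x] &&
  (if a.1 is inr j then nth 0 depths (m + val_at j) <= nth 0 depths v else true).

Let flip (b : bool) (a : lit) : lit := (a.1, a.2 (+) b).

Lemma lit_eval_flip b a x : lit_eval g (flip b a) x = lit_eval g a x (+) b.
Proof. by rewrite /lit_eval /= addbA. Qed.

Lemma exists_represents v : v < m + size gs -> nth 0 depths v <= d ->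
  exists a, represents a v.
Proof.
have [n] := ubnP v; elim: n v => // n IH v vn hv dv.
case: (ltnP v m) => vm.
  exists (inl (Ordinal vm), false); rewrite /represents andbT; apply/forallP=> x.
  rewrite /lit_eval /= addbF nth_run_prefix ?size_map ?size_enum_ord //.
  rewrite (nth_map (Ordinal vm)) //.
    apply/eqP; congr (x _).
    by apply: val_inj; rewrite /= nth_enum_ord.
  by rewrite size_enum_ord.
  by rewrite -enumT size_enum_ord.
pose j := v - m; have ev : v = m + j by rewrite /j subnKC.
have jn : j < size gs by move: hv; rewrite ev ltn_add2l.
case E: (gate_at j) => [ws|ws|w].
- have sh : shallow (Ordinal jn) by rewrite /shallow /= E -ev dv.
  pose u : J := exist (fun j => is_true (shallow j)) (Ordinal jn) sh.
  exists (inr u, true); rewrite /represents /= -ev leqnn andbT.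
  by apply/forallP=> x; rewrite /lit_eval /g /= E -ev -addbA addbF.
- have sh : shallow (Ordinal jn) by rewrite /shallow /= E -ev dv.
  pose u : J := exist (fun j => is_true (shallow j)) (Ordinal jn) sh.
  exists (inr u, false); rewrite /represents /= -ev leqnn andbT.
  by apply/forallP=> x; rewrite /lit_eval /g /= E -ev !addbF.
have wv : w < v.
  by rewrite ev; apply: wf_wires (gates_wf c) jn _; rewrite -/gs -/(gate_at j) E mem_head.
have ed : nth 0 depths v = nth 0 depths w by rewrite {1}ev depths_gate // E.
have [|||a /andP[/forallP ha hd]] := IH w.
- exact: leq_trans wv _.
- exact: ltn_trans wv hv.
- by rewrite -ed.
exists (flip true a); rewrite /represents ed hd andbT; apply/forallP=> x.
by rewrite {1}ev vals_gate // E /= lit_eval_flip (eqP (ha x)) addbT.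
Qed.

(** Every literal that represents a wire is taken, without choosing one; literals for the same wire
    have the same value, so the OR is unaffected. *)
Let A (j : J) : {set lit} :=
  [set a | has (represents (flip (is_and (gate_at (val_at j))) a))
             (gate_wires (gate_at (val_at j)))].

Lemma circuit_normal_form_at : normal_form d A g dep.
Proof.
have wires_depth (j : J) w : w \in gate_wires (gate_at (val_at j)) ->
    nth 0 depths w < nth 0 depths (m + val_at j).
  rewrite depths_gate //; case: (valP j) => /andP[].
  by rewrite -/(val_at j); case: (gate_at (val_at j)) => //= ws _ _ wws;
    rewrite ltnS (big_rem w) //= leq_maxl.
have depth_pos (j : J) : 0 < nth 0 depths (m + val_at j).
  rewrite depths_gate //; case: (valP j) => /andP[].
  by rewrite -/(val_at j); case: (gate_at (val_at j)).
have depth_le (j : J) : nth 0 depths (m + val_at j) <= d.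
  by case: (valP j) => /andP[].
split=> [j x|j j' b|j].
- have eg : g j x = has (fun w => nth false (vals x) w (+) is_and (gate_at (val_at j)))
      (gate_wires (gate_at (val_at j))).
    rewrite /g vals_gate //; case: (valP j) => /andP[+ _].
    rewrite -/(val_at j); case: (gate_at (val_at j)) => //= ws _.
      by rewrite addbT -has_predC; apply: eq_has => w /=; rewrite addbT.
    by rewrite addbF; apply: eq_has => w; rewrite addbF.
  rewrite eg; apply/hasP/existsP => [[w wj hw]|[a /andP[]]].
    have wlt := wires_depth _ _ wj.
    have [||a ha] := @exists_represents w.
    - apply: (@ltn_trans (m + val_at j)); first exact: wf_wires (gates_wf c) _ wj.
      by rewrite ltn_add2l.
    - by apply: ltnW; apply: leq_trans wlt _.
    exists (flip (is_and (gate_at (val_at j))) a).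
    rewrite lit_eval_flip inE; apply/andP; split.
      apply/hasP; exists w => //; rewrite /flip /= -addbA addbb addbF.
      by rewrite -surjective_pairing.
    by case/andP: ha => /forallP/(_ x)/eqP <-.
  rewrite inE => /hasP[w wj /andP[/forallP/(_ x)/eqP hw _]] ha.
  by exists w => //; rewrite hw lit_eval_flip -addbA addbb addbF.
- rewrite inE => /hasP[w wj /andP[_ /= hd]].
  have := wires_depth _ _ wj; have := depth_pos j'; rewrite /dep; lia.
- have := depth_pos j; have := depth_le j; rewrite /dep; lia.
Qed.

Lemma card_gates : #|J| <= circuit_size c.
Proof.
rewrite card_sig /circuit_size -/gs -sum1_count (big_nth (Not 0)) big_mkord -sum1_card.
rewrite big_mkcond [X in _ <= X]big_mkcond; apply: leq_sum => j _.
by rewrite inE /shallow /is_and_or -/(gate_at j); case: (gate_at j) => //= ws; case: ifP.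
Qed.

Lemma circuit_normal_form : circuit_depth c <= d ->
  exists (J' : finType) (A' : J' -> {set (('I_m + J') * bool)%type})
    (g' : J' -> bits m -> bool) (dep' : J' -> nat) (out : (('I_m + J') * bool)%type),
  [/\ #|J'| <= circuit_size c, normal_form d A' g' dep' &
      forall x, circuit_eval c x = lit_eval g' out x].
Proof.
move=> hd; have [a /andP[/forallP ha _]] := exists_represents (output_wf c) hd.
exists J, A, g, dep, a; split; first exact: card_gates.
- exact: circuit_normal_form_at.
- by move=> x; rewrite -(eqP (ha x)).
Qed.
End CircuitNormalForm.

(** * Reducing the fan-in of wide gates *)

Section Trimming.
Variables (I J : finType).
Notation cube := {ffun I -> bool}.
Notation lit := ((I + J) * bool)%type.

Lemma normal_form_exists d (A : J -> {set lit}) dep :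
  (forall j j' b, (inr j', b) \in A j -> dep j' < dep j) -> (forall j, dep j < d) ->
  exists g : J -> cube -> bool, normal_form d A g dep.
Proof.
move=> hA hd.
pose step (g : J -> cube -> bool) j x := [exists a in A j, lit_eval g a x].
pose it n := iter n step (fun _ _ => false).
have stable n j (x : cube) : dep j < n -> it n j x = it n.+1 j x.
  elim: n j => // n IH j hj; rewrite -[LHS]/(step (it n) j x) -[RHS]/(step (it n.+1) j x).
  apply: eq_existsb => -[[i|j'] b]; first by [].
  case: (boolP (_ \in A j)) => //= h; rewrite /lit_eval /= IH //.
  exact: leq_trans (hA _ _ _ h) hj.
by exists (it d); split=> // j x; rewrite stable.
Qed.

(** A gate reading more than [w] inputs keeps only [w] of them. The OR can change only where all
    kept input literals are false, and there [x] agrees with [z j] on [V j], a subcube of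
    codimension [w]. *)
Lemma trim d (A : J -> {set lit}) (g : J -> cube -> bool) dep (w : nat) :
  normal_form d A g dep ->
  exists (A' : J -> {set lit}) (g' : J -> cube -> bool)
    (V : J -> {set I}) (z : J -> cube) (b : pred J),
  [/\ normal_form d A' g' dep, forall j, #|A' j| <= (w + #|J|) * 2,
      forall j, b j -> #|V j| = w &
      forall x : cube, (forall j, b j -> exists2 i, i \in V j & x i != z j i) ->
        forall j, g' j x = g j x].
Proof.
move=> nf.
pose vars j := [set i | ((inl i, false) \in A j) || ((inl i, true) \in A j)].
pose b j := w < #|vars j|.
pose V j := if b j then [set i in take w (enum (vars j))] else vars j.
pose A' j := [set a in A j | if a.1 is inl i then i \in V j else true].
(* Chosen so that [(inl i, z j i)] is a literal of the gate for every [i] in [vars j]; it is true as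
   soon as [x i] differs from [z j i]. *)
pose z j : cube := [ffun i => (inl i, false) \notin A j].
have VS j : V j \subset vars j.
  rewrite /V; case: ifP => // _; apply/subsetP=> i; rewrite inE => /mem_take.
  by rewrite mem_enum.
have Vw j : b j -> #|V j| = w.
  move=> bj; rewrite /V bj cardsE (card_uniqP _) ?take_uniq ?enum_uniq //.
  by rewrite size_take -cardE -/(b j) bj.
have [|g' nf'] := @normal_form_exists d A' dep _ (nf_depth nf).
  by move=> j j' c; rewrite inE => /andP[/(nf_dep nf)].
exists A', g', V, z, b; split => // [j|x hx].
  have Vle : #|V j| <= w.
    by case: (boolP (b j)) => [/Vw ->|nb] //; rewrite /V (negbTE nb) leqNgt.
  pose W : {set (I + J)} := inl @: V j :|: inr @: [set: J].
  apply: (@leq_trans #|setX W [set: bool]|).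
    apply: subset_leq_card; apply/subsetP=> -[[i|j'] c]; rewrite !inE /=.
      by case/andP=> _ iV; rewrite andbT imset_f.
    by rewrite andbT => _; rewrite (imset_f inr) ?inE ?orbT.
  rewrite cardsX cardsT card_bool leq_mul2r /=.
  apply: leq_trans (leq_card_setU _ _) _; rewrite leq_add //.
    exact: leq_trans (leq_imset_card _ _) Vle.
  by apply: leq_trans (leq_imset_card _ _) _; rewrite cardsT.
have gen n : forall j, dep j < n -> g' j x = g j x.
  elim: n => // n IH j hj.
  have eqlit a : a \in A j -> lit_eval g' a x = lit_eval g a x.
    case: a => [[i|j'] c] // h; rewrite /lit_eval /= IH //.
    exact: leq_trans (nf_dep nf h) hj.
  rewrite (nf_eval nf) (nf_eval nf'); case: (boolP (b j)) => bj; last first.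
    apply: eq_existsb => a; rewrite inE; case: (boolP (a \in A j)) => //= aA.
    rewrite eqlit //.
    suff -> : (match a.1 with inl i => i \in V j | inr _ => true end) = true by [].
    case: a aA => [[i|j'] c] aA //=; rewrite /V (negbTE bj) inE.
    by case: c aA => ->; rewrite ?orbT.
  have [i iV xi] := hx j bj.
  have iA : (inl i, z j i) \in A j.
    rewrite ffunE; case: (boolP ((inl i, false) \in A j)) => //= nA.
    by have := subsetP (VS j) i iV; rewrite inE (negbTE nA).
  have le h : lit_eval h (inl i, z j i) x.
    by rewrite /lit_eval /=; case: (x i) (z j i) xi => [] [].
  transitivity true; [|symmetry]; apply/existsP; exists (inl i, z j i).
    by rewrite inE iA /= iV le.
  by rewrite iA le.
by move=> j; apply: gen (ltnSn _).
Qed.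
End Trimming.

Local Open Scope ring_scope.

(** * Conjunctions of literals and extreme parameters *)

Section Subcubes.
Variables (R : realType) (m : nat) (delta R0 : R) (D1 D2 : dist R (bits m)).
Implicit Types (F G : pred (bits m)) (V : {set 'I_m}) (z : bits m).

Definition prob (D : dist R (bits m)) F : R := expectation D (fun x => (F x)%:R).

Definition gap F : R := `|prob D1 F - prob D2 F|.

Definition subcube V z : pred (bits m) := fun x => [forall i in V, x i == z i].

Lemma prob_ge0 D F : 0 <= prob D F.
Proof. by apply: sumr_ge0 => x _; rewrite mulr_ge0 ?pmf_ge0 ?ler0n. Qed.

Lemma eq_prob D F G : F =1 G -> prob D F = prob D G.
Proof. by move=> e; apply: eq_expectation => x; rewrite e. Qed.

Lemma eq_gap F G : F =1 G -> gap F = gap G.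
Proof. by move=> e; rewrite /gap !(eq_prob _ e). Qed.

Lemma prob_le D F G : (forall x, F x -> G x) -> prob D F <= prob D G.
Proof.
move=> h; apply: ler_expectation => x; rewrite ler_nat.
by case: (F x) (h x) => // ->.
Qed.

Lemma prob0 D F : (forall x, F x = false) -> prob D F = 0.
Proof. by move=> h; apply: big1 => x _; rewrite h mulr0. Qed.

Lemma prob_predC D F : prob D (predC F) = 1 - prob D F.
Proof.
rewrite -(pmf_sum1 D) /prob /expectation -sumrB; apply: eq_bigr => x _ /=.
by case: (F x); rewrite ?mulr1 ?mulr0 ?subrr ?subr0.
Qed.

Lemma prob_predD D F G : (forall x, F x -> G x) ->
  prob D (predD G F) = prob D G - prob D F.
Proof.
move=> h; rewrite /prob -expectationB; apply: eq_expectation => x /=.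
by case: (F x) (h x) => [->|_]; rewrite ?subrr ?subr0.
Qed.

Lemma gap_predC F : gap (predC F) = gap F.
Proof.
by rewrite /gap !prob_predC -[RHS]normrN; congr `|_|; ring.
Qed.

Lemma prob_exists (J : finType) (b : pred J) D (F : J -> pred (bits m)) (u : R) :
  0 <= u -> (forall j, b j -> prob D (F j) <= u) ->
  prob D (fun x => [exists j, b j && F j x]) <= #|J|%:R * u.
Proof.
move=> u0 h; apply: (@le_trans _ _ (\sum_(j | b j) prob D (F j))).
  rewrite /prob -expectation_sum; apply: ler_expectation => x.
  case: existsP => [[j /andP[bj Fj]]|_]; last by apply: sumr_ge0 => j _.
  by rewrite (bigD1 j) //= Fj lerDl sumr_ge0.
apply: (@le_trans _ _ (\sum_(j : J) u)); last by rewrite sumr_const mulr_natl.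
by rewrite big_mkcond; apply: ler_sum => j _; case: ifP => // /h.
Qed.

Lemma card_subcube V z : #|subcube V z| = (2 ^ (m - #|V|))%N.
Proof.
transitivity (\prod_i \sum_(c : bool | (i \in V) ==> (c == z i)) 1)%N.
  rewrite bigA_distr_big_dep /= -sum1_card; apply: eq_big => [x|x _]; last by rewrite big1.
  rewrite -[LHS]/(subcube V z x).
  by apply/forallP/familyP => h i; move: (h i); rewrite unfold_in.
have -> : (m - #|V| = #|~: V|)%N.
  by have := cardsC V; rewrite card_ord; move: #|V| #|~: V| => a b; lia.
rewrite -prod_nat_const [RHS]big_mkcond; apply: eq_bigr => i _; rewrite inE.
case: (i \in V) => /=; last by rewrite big_bool.
by rewrite big_pred1_eq.
Qed.

Lemma depends_subcube V z : depends_on V (subcube V z).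
Proof.
by move=> x x' e; apply: eq_forallb_in => i iV; rewrite e.
Qed.

Hypothesis D1_le : forall x, D1 x <= R0 / 2 ^+ m.
Hypothesis delta_ge0 : 0 <= delta.

Lemma R0_ge1 : 1 <= R0.
Proof.
rewrite -(pmf_sum1 D1); apply: (@le_trans _ _ (\sum_(x : bits m) R0 / 2 ^+ m)).
  by apply: ler_sum => x _.
rewrite sumr_const card_ffun card_bool card_ord -[leLHS]mulr_natl natrX.
by rewrite mulrCA mulfV ?mulr1 // expf_neq0 // pnatr_eq0.
Qed.

Lemma prob_card F : prob D1 F <= R0 / 2 ^+ m * #|F|%:R.
Proof.
rewrite /prob expectation_bool; apply: (@le_trans _ _ (\sum_(x | F x) R0 / 2 ^+ m)).
  by apply: ler_sum => x _.
by rewrite sumr_const mulr_natr.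
Qed.

Section Indist.
Variable k : nat.
Hypothesis ind : almost_indist k delta D1 D2.

Lemma gap_depends V F : (#|V| <= k)%N -> depends_on V F -> gap F <= 2 * delta.
Proof.
move=> Vk dep; rewrite -[2 * delta]mulr1; apply: (indist_depends ind Vk).
  by move=> x x' e; rewrite (dep _ _ e).
by move=> x; case: (F x); rewrite ?normr1 ?normr0.
Qed.

Lemma card_subcube_real V z : (#|subcube V z|%:R : R) = 2 ^+ m / 2 ^+ #|V|.
Proof.
have Vm : (#|V| <= m)%N by rewrite -[X in (_ <= X)%N]card_ord max_card.
by rewrite card_subcube natrX -exprB ?unitfE ?pnatr_eq0.
Qed.

Lemma prob_subcube1 V z : prob D1 (subcube V z) <= R0 / 2 ^+ #|V|.
Proof.
apply: le_trans (prob_card _) _; rewrite card_subcube_real mulrA divfK //.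
by rewrite expf_neq0 // pnatr_eq0.
Qed.

Lemma prob_subcube2 V z : (#|V| <= k)%N ->
  prob D2 (subcube V z) <= R0 / 2 ^+ #|V| + 2 * delta.
Proof.
move=> Vk; have := gap_depends Vk (@depends_subcube V z).
rewrite /gap ler_norml => /andP[h _]; have := prob_subcube1 V z; lra.
Qed.

(* The strictness comes from D1 being close to its maximum on the whole
   subcube as soon as the subcube has probability close to R0 / 2 ^+ k. *)
Lemma gap_sub_subcube V z F (q : nat) : (q <= k)%N -> (q <= #|V|)%N ->
  (forall x, F x -> subcube V z x) -> gap F < R0 / 2 ^+ q + 2 * delta.
Proof.
move=> qk qV FV.
pose V' := [set i in take q (enum V)].
have V'q : #|V'| = q.
  rewrite cardsE (card_uniqP _) ?take_uniq ?enum_uniq //.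
  by rewrite size_takel // -cardE.
have FV' x : F x -> subcube V' z x.
  move=> /FV /forall_inP h; apply/forall_inP => i; rewrite inE => /mem_take.
  by rewrite mem_enum; apply: h.
have d0 := delta_ge0; have R1 := R0_ge1.
have m0 : 0 < 2 ^+ m :> R by rewrite exprn_gt0.
have q0 : 0 < 2 ^+ q :> R by rewrite exprn_gt0.
have c0 : 0 < R0 / 2 ^+ m by rewrite divr_gt0 //; lra.
have e0 : 0 < R0 / 2 ^+ q by rewrite divr_gt0 //; lra.
have hT : gap (subcube V' z) <= 2 * delta.
  by apply: (@gap_depends V'); rewrite ?V'q //; apply: depends_subcube.
have cT : (#|subcube V' z|%:R : R) = 2 ^+ m / 2 ^+ q by rewrite card_subcube_real V'q.
have cTe : R0 / 2 ^+ m * (#|subcube V' z|%:R) = R0 / 2 ^+ q.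
  by rewrite cT mulrA divfK // gt_eqF.
case: (posnP #|F|) => F0.
  have Ff x : F x = false by apply/negbTE/negP => Fx; have := card0_eq F0 x; rewrite unfold_in Fx.
  by rewrite /gap !prob0 // subrr normr0; lra.
have FT : (#|F| <= #|subcube V' z|)%N by apply: subset_leq_card; apply/subsetP => x; apply: FV'.
have F1 : (1 : R) <= #|F|%:R by rewrite ler1n.
case: (ltnP #|F| #|subcube V' z|) => cmp; last first.
  have eF : F =1 subcube V' z.
    have /subset_cardP h : #|F| = #|subcube V' z| by apply/eqP; rewrite eqn_leq FT.
    move=> x; have := h _ x; rewrite !unfold_in; apply.
    by apply/subsetP => y; apply: FV'.
  by rewrite (eq_gap eF); lra.
have cmp' : (#|F|%:R : R) + 1 <= #|subcube V' z|%:R by rewrite natr1 ler_nat.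
move: hT; rewrite /gap ler_norml => /andP[hT1 hT2].
have hF1 := prob_card F.
have hTF : prob D1 (predD (subcube V' z) F) <= R0 / 2 ^+ m * (#|subcube V' z|%:R - #|F|%:R).
  apply: le_trans (prob_card _) _; rewrite ler_pM2l // lerBrDr -natrD ler_nat.
  rewrite -(cardID F (subcube V' z)) addnC leq_add //.
  apply: subset_leq_card; apply/subsetP => x Fx; rewrite inE Fx andbT; exact: FV'.
rewrite prob_predD // in hTF.
have hF2 : prob D2 F <= prob D2 (subcube V' z) by apply: prob_le.
have p1 := prob_ge0 D1 F; have p2 := prob_ge0 D2 F.
have hs1 : R0 / 2 ^+ m * #|F|%:R < R0 / 2 ^+ q by rewrite -cTe ltr_pM2l //; lra.
have hs2 : R0 / 2 ^+ m * (#|subcube V' z|%:R - #|F|%:R) < R0 / 2 ^+ q.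
  by rewrite -cTe ltr_pM2l //; lra.
rewrite ltr_norml; apply/andP; split; lra.
Qed.

Definition conj_lits (W : {set 'I_m * bool}) : pred (bits m) :=
  fun x => [forall a in W, x a.1 == a.2].

Lemma conj_litsP W :
  (forall x, conj_lits W x = false) \/
  exists V z, conj_lits W =1 subcube V z.
Proof.
case: (boolP [exists i, ((i, true) \in W) && ((i, false) \in W)]).
  move=> /existsP[i /andP[h1 h0]]; left=> x; apply/negbTE/forall_inPn.
  by case E: (x i); [exists (i, false)|exists (i, true)]; rewrite //= E.
move=> /existsPn hW; right.
exists [set i | ((i, true) \in W) || ((i, false) \in W)], [ffun i => (i, true) \in W] => x.
apply/forall_inP/forall_inP => [h i|h [i c] iW].
  rewrite inE ffunE => /orP[] iW; have /= := h _ iW; first by rewrite iW.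
  by have := hW i; rewrite iW andbT => /negbTE ->.
have := h i; rewrite inE ffunE /=; have := hW i.
by case: c iW => iW; rewrite iW ?orbT ?andbT /= => hi /(_ isT) // ; rewrite (negbTE hi).
Qed.

Lemma gap_conj W q : (q <= k)%N -> gap (conj_lits W) < R0 / 2 ^+ q + 2 * delta.
Proof.
move=> qk; have d0 := delta_ge0; have R1 := R0_ge1.
have e0 : 0 < R0 / 2 ^+ q by rewrite divr_gt0 ?exprn_gt0 //; lra.
case: (conj_litsP W) => [h|[V [z h]]].
  by rewrite /gap !prob0 // subrr normr0; lra.
rewrite (eq_gap h); case: (leqP q #|V|) => Vq.
  exact: (gap_sub_subcube (V := V) (z := z)).
apply: le_lt_trans (gap_depends _ (@depends_subcube V z)) _; last by lra.
by apply: leq_trans (ltnW Vq) qk.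
Qed.

(** If [W] amounts to a subcube of codimension at least [k], the event lies inside it. Otherwise its
    probability is that of [W], known up to [2 * delta], minus that of the conjunction
    [W :|: W']. *)
Lemma gap_conj_diff W W' :
  gap (fun x => conj_lits W x && ~~ conj_lits W' x) < R0 / 2 ^+ k + 4 * delta.
Proof.
have d0 := delta_ge0; have R1 := R0_ge1.
have e0 : 0 < R0 / 2 ^+ k by rewrite divr_gt0 ?exprn_gt0 //; lra.
case: (conj_litsP W) => [h|[V [z h]]].
  by rewrite /gap !prob0 ?subrr ?normr0 => [|x|x]; rewrite ?h //; lra.
case: (leqP k #|V|) => Vk.
  apply: (@lt_le_trans _ _ (R0 / 2 ^+ k + 2 * delta)); last by lra.
  by apply: (gap_sub_subcube (V := V) (z := z)) => // x /andP[]; rewrite h.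
have eU D : prob D (fun x => conj_lits W x && ~~ conj_lits W' x) =
    prob D (conj_lits W) - prob D (conj_lits (W :|: W')).
  rewrite -prob_predD => [|x]; last first.
    by move=> /forall_inP hx; apply/forall_inP => a aW; apply: hx; rewrite inE aW.
  apply: eq_prob => x /=; have -> : conj_lits (W :|: W') x = conj_lits W x && conj_lits W' x.
    apply/forall_inP/andP => [hx|[/forall_inP h1 /forall_inP h2] a].
      by split; apply/forall_inP => a aW; apply: hx; rewrite inE aW ?orbT.
    by rewrite inE => /orP[]; [apply: h1|apply: h2].
  by case: (conj_lits W x); rewrite ?andbF ?andbT.
have g1 : gap (conj_lits W) <= 2 * delta.
  by rewrite (eq_gap h); apply: (gap_depends (ltnW Vk)); apply: depends_subcube.
have g2 := gap_conj (W :|: W') (leqnn k).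
move: g1 g2; rewrite /gap !eU ler_norml ltr_norml => /andP[a1 a2] /andP[a3 a4].
by rewrite ltr_norml; apply/andP; split; lra.
Qed.

End Indist.
End Subcubes.

(** * Very small circuits, expanded into conjunctions *)

Section Gaps.
Variables (R : realType) (m : nat) (delta R0 : R) (D1 D2 : dist R (bits m)) (k : nat).
Hypothesis D1_le : forall x, D1 x <= R0 / 2 ^+ m.
Hypothesis delta_ge0 : 0 <= delta.
Hypothesis ind : almost_indist k delta D1 D2.
Hypothesis k_gt0 : (0 < k)%N.

Notation dgap := (gap D1 D2).

Section NormalFormGaps.
Variables (J : finType) (A : J -> {set (('I_m + J) * bool)%type}).
Variables (g : J -> bits m -> bool) (d : nat) (dep : J -> nat).
Hypothesis nf : normal_form d A g dep.

Lemma gap_input i b : dgap (lit_eval g (inl i, b)) <= 2 * delta.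
Proof.
apply: (gap_depends ind (V := [set i])); first by rewrite cards1.
by move=> x x' e; rewrite /lit_eval /= e // inE.
Qed.

Lemma gap_gate j b : dgap (lit_eval g (inr j, b)) = dgap (predC (g j)).
Proof.
rewrite gap_predC; case: b; last by apply: eq_gap => x; rewrite /lit_eval /= addbF.
by rewrite -[RHS]gap_predC; apply: eq_gap => x; rewrite /lit_eval /= addbT.
Qed.

(** The literal [(inl i, b)] is false exactly when [x i = b], so [conj_lits (input_lits j)] says
    that no input literal of gate [j] is true. *)
Definition input_lits (j : J) : {set 'I_m * bool} := [set a | (inl a.1, a.2) \in A j].

Lemma predC_gate j x : ~~ g j x = conj_lits (input_lits j) x &&
  [forall a : J * bool, ((inr a.1, a.2) \in A j) ==> (g a.1 x == a.2)].
Proof.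
rewrite (nf_eval nf) negb_exists; apply/forallP/andP => [h|[/forall_inP h1 /forallP h2] [[i|j'] c]].
- split; first apply/forall_inP => -[i c]; rewrite ?inE /=.
    move=> iA; have := h (inl i, c); rewrite iA /lit_eval /=.
    by case: (x i); case: c {iA}.
  apply/forallP => -[j' c] /=; apply/implyP => jA.
  by have := h (inr j', c); rewrite jA /lit_eval /=; case: (g j' x); case: c {jA}.
- rewrite negb_and -implybE; apply/implyP => iA.
  have /= := h1 (i, c); rewrite inE => /(_ iA) /eqP e; by rewrite /lit_eval /= e addbb.
rewrite negb_and -implybE; apply/implyP => jA.
have /= := h2 (j', c); rewrite jA => /eqP e; by rewrite /lit_eval /= e addbb.
Qed.

Lemma conj_litsU (W W' : {set 'I_m * bool}) x :
  conj_lits (W :|: W') x = conj_lits W x && conj_lits W' x.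
Proof.
apply/forall_inP/andP => [hx|[/forall_inP h1 /forall_inP h2] a].
  by split; apply/forall_inP => a aW; apply: hx; rewrite inE aW ?orbT.
by rewrite inE => /orP[]; [apply: h1|apply: h2].
Qed.

(* For s = 2 we have log s = 1, so that k has no constant factor to spare. *)
Lemma gap_two_gates out : (#|J| <= 2)%N ->
  dgap (lit_eval g out) < R0 / 2 ^+ k + 4 * delta.
Proof.
move=> J2; have d0 := delta_ge0; have R1 := R0_ge1 D1_le.
have e0 : 0 < R0 / 2 ^+ k by rewrite divr_gt0 ?exprn_gt0 //; lra.
case: out => -[i|j] b; first by have := gap_input i b; lra.
rewrite gap_gate.
have conjlt W : dgap (conj_lits W) < R0 / 2 ^+ k + 4 * delta.
  by have := gap_conj D1_le delta_ge0 ind W (leqnn k); lra.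
case: (pickP (fun a : J * bool => (inr a.1, a.2) \in A j)) => [[j' c0] /= j'A|none]; last first.
  rewrite (eq_gap _ _ (G := conj_lits (input_lits j))) // => x /=.
  by rewrite predC_gate (_ : [forall a, _]) ?andbT //; apply/forallP => a; rewrite none.
have dj' := nf_dep nf j'A.
have only j'' : (dep j'' < dep j)%N -> j'' = j'.
  move=> h; apply/eqP/negPn/negP => ne.
  have : uniq [:: j; j'; j''].
    rewrite /= !inE negb_or [j' == _]eq_sym ne andbT /= andbT.
    by apply/andP; split; apply/eqP => e; [move: dj'|move: h]; rewrite -e ltnn.
  by move=> /card_uniqP /= e3; have := max_card (mem [:: j; j'; j'']); rewrite e3 leqNgt ltnS J2.
have gj' x : g j' x = ~~ conj_lits (input_lits j') x.
  apply/negb_inj; rewrite negbK predC_gate (_ : [forall a, _]) ?andbT //.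
  apply/forallP => -[j'' c] /=; apply/implyP => h.
  have h1 := nf_dep nf h; have h2 := only _ (ltn_trans h1 dj').
  by rewrite h2 ltnn in h1.
(* The only gate below [j] is an OR of inputs, so the negation of [g j] is false, a conjunction, or
   a conjunction minus another one, according to the signs with which [j'] is read. *)
have eqH x : ~~ g j x = [&& conj_lits (input_lits j) x,
    ((inr j', false) \in A j) ==> conj_lits (input_lits j') x &
    ((inr j', true) \in A j) ==> ~~ conj_lits (input_lits j') x].
  rewrite predC_gate; congr (_ && _); apply/forallP/andP => [h|[h1 h2] [j'' c] /=].
    have := h (j', false); have := h (j', true); rewrite /= gj'.
    by rewrite eqb_id eqbF_neg negbK => -> ->.
  apply/implyP => h; have ej := only _ (nf_dep nf h); move: h; rewrite ej gj'.
  by case: c => h; [move: h2|move: h1]; rewrite h /= ?eqb_id // eqbF_neg negbK.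
case: (boolP ((inr j', false) \in A j)) => hf; case: (boolP ((inr j', true) \in A j)) => ht.
- rewrite /gap !prob0 ?subrr ?normr0 => [|x|x]; rewrite /= ?eqH ?hf ?ht /= ?andbN ?andbF //.
  by lra.
- rewrite (eq_gap _ _ (G := conj_lits (input_lits j :|: input_lits j'))) // => x /=.
  by rewrite eqH hf (negbTE ht) /= andbT conj_litsU.
- rewrite (eq_gap _ _ (G := fun x => conj_lits (input_lits j) x && ~~ conj_lits (input_lits j') x)).
    exact: (gap_conj_diff D1_le delta_ge0 ind).
  by move=> x /=; rewrite eqH ht (negbTE hf).
- by move: j'A; case: c0 => h; [move: ht|move: hf]; rewrite h.
Qed.

Lemma gate_determined x x' :
  (forall j, conj_lits (input_lits j) x = conj_lits (input_lits j) x') ->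
  forall j, g j x = g j x'.
Proof.
move=> e; have gen n : forall j, (dep j < n)%N -> g j x = g j x'.
  elim: n => // n IH j hj; apply/negb_inj; rewrite !predC_gate e; congr (_ && _).
  apply: eq_forallb => a; case: (boolP (_ \in A j)) => //= h.
  by rewrite IH //; apply: leq_trans (nf_dep nf h) hj.
by move=> j; apply: gen (ltnSn _).
Qed.

Lemma conj_bigcup (W : J -> {set 'I_m * bool}) (B : {set J}) x :
  (conj_lits (\bigcup_(j in B) W j) x)%:R =
  \prod_j (if j \in B then (conj_lits (W j) x)%:R else 1 : R).
Proof.
case: (boolP (conj_lits _ x)) => [/forall_inP h|/forall_inPn[a /bigcupP[j jB aW] na]].
  rewrite big1 // => j _; case: ifP => // jB; rewrite (_ : conj_lits _ _) //.
  by apply/forall_inP => a aW; apply: h; apply/bigcupP; exists j.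
rewrite (bigD1 j) //= jB (_ : conj_lits _ _ = false) ?mul0r //.
by apply/negbTE/forall_inPn; exists a.
Qed.

(** By [gate_determined] the output is a function of one bit per gate, [conj_lits (input_lits j)].
    There are [2 ^ #|J|] patterns of these bits, and the indicator of each is a signed sum of at
    most [2 ^ #|J|] conjunctions. *)
Lemma gap_inclusion_exclusion out q : (q <= k)%N ->
  dgap (lit_eval g out) <= 4 ^+ #|J| * (R0 / 2 ^+ q + 2 * delta).
Proof.
move=> qk; have d0 := delta_ge0; have R1 := R0_ge1 D1_le.
have e0 : 0 < R0 / 2 ^+ q by rewrite divr_gt0 ?exprn_gt0 //; lra.
have E0 : 0 <= R0 / 2 ^+ q + 2 * delta by lra.
case: out => -[i|j] b.
  apply: (@le_trans _ _ (1 * (R0 / 2 ^+ q + 2 * delta))).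
    by have := gap_input i b; lra.
  by apply: ler_wpM2r => //; rewrite exprn_ege1 ?ler1n.
rewrite gap_gate gap_predC.
pose tv (x : bits m) : {ffun J -> bool} := [ffun j => conj_lits (input_lits j) x].
(* The value of the gate on the pattern [c], read at any input with that pattern; unattained
   patterns get 0. *)
pose Psi (c : {ffun J -> bool}) : R :=
  if [pick x | tv x == c] is Some x then (g j x)%:R else 0.
have Psi1 c : `|Psi c| <= 1.
  rewrite /Psi; case: pickP => [x _|_]; rewrite ?normr0 //.
  by case: (g j x); rewrite ?normr1 ?normr0.
(* Coefficients in the expansion of the product over the gates of y or 1 - y, according to [c j]. *)
pose co (c : {ffun J -> bool}) (B : {set J}) : R :=
  \prod_j (if j \in B then (if c j then 1 else -1) else (if c j then 0 else 1)).
have co1 c B : `|co c B| <= 1.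
  rewrite normr_prod; apply: prodr_ile1 => i; rewrite normr_ge0 /=.
  by case: ifP => _; case: ifP => _; rewrite ?normrN ?normr1 ?normr0.
have ind_tv (c : {ffun J -> bool}) x : (tv x == c)%:R = \sum_B co c B *
    (conj_lits (\bigcup_(j in B) input_lits j) x)%:R.
  transitivity (\prod_i ((if c i then 1 else -1) * (conj_lits (input_lits i) x)%:R +
     (if c i then 0 else 1) : R)).
    case: eqP => [<-|ne].
      rewrite big1 // => i _; rewrite ffunE.
      by case: (conj_lits _ x); rewrite ?mulr1 ?mulr0 ?addr0 ?add0r.
    have [i nei] : exists i, tv x i != c i.
      apply/existsP; case: (boolP [exists i, tv x i != c i]) => // /existsPn h.
      case: ne; apply/ffunP=> i; by apply/eqP; move: (h i); rewrite negbK.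
    rewrite (bigD1 i) //= (_ : _ + _ = 0) ?mul0r //.
    move: nei; rewrite ffunE; case: (conj_lits _ x); case: (c i) => // _;
      rewrite ?mulr1 ?mulr0 ?addr0 //.
    by rewrite addNr.
  rewrite bigA_distr; apply: eq_bigr => B _; rewrite conj_bigcup /co -big_split.
  by apply: eq_bigr => i _ /=; case: (i \in B); rewrite ?mulr1.
have eP D : prob D (g j) = \sum_c \sum_B Psi c * co c B *
    prob D (conj_lits (\bigcup_(j in B) input_lits j)).
  rewrite /prob (@eq_expectation _ _ _ _ (fun x => \sum_c \sum_B Psi c * co c B *
    (conj_lits (\bigcup_(j in B) input_lits j) x)%:R)).
    rewrite expectation_sum; apply: eq_bigr => c _; rewrite expectation_sum.
    by apply: eq_bigr => B _; rewrite expectationZ.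
  move=> x; rewrite (bigD1 (tv x)) //= [X in _ + X]big1 ?addr0 => [|c nc].
    under eq_bigr => B _ do rewrite -mulrA.
    rewrite -mulr_sumr -ind_tv eqxx mulr1 /Psi.
    case: pickP => [y /eqP e|/(_ x)]; last by rewrite eqxx.
    congr ((nat_of_bool _)%:R); apply: gate_determined => i.
    by have := congr1 (fun f : {ffun J -> bool} => f i) e; rewrite !ffunE.
  under eq_bigr => B _ do rewrite -mulrA.
  by rewrite -mulr_sumr -ind_tv eq_sym (negbTE nc) mulr0.
rewrite /gap !eP -sumrB; apply: le_trans (ler_norm_sum _ _ _) _.
apply: (@le_trans _ _ (\sum_(c : {ffun J -> bool}) \sum_(B : {set J}) (R0 / 2 ^+ q + 2 * delta))).
  apply: ler_sum => c _; rewrite -sumrB; apply: le_trans (ler_norm_sum _ _ _) _.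
  apply: ler_sum => B _; rewrite -mulrBr normrM -[leRHS]mul1r.
  apply: ler_pM => //; last exact/ltW/(gap_conj D1_le delta_ge0 ind).
  by rewrite normrM mulr_ile1.
have ct : #|{set J}| = (2 ^ #|J|)%N.
  by rewrite -[LHS]cardsT -powersetT card_powerset cardsT.
rewrite !sumr_const card_ffun card_bool ct -mulrnA -expnMn -[leLHS]mulr_natl.
by rewrite natrX.
Qed.

End NormalFormGaps.
End Gaps.

Lemma leq_exp_base (x y n : nat) : (x <= y)%N -> (x ^ n <= y ^ n)%N.
Proof. by case: n => // n h; rewrite leq_exp2r. Qed.

(** * Choice of the parameters *)

Section ParameterBounds.
Variables (b d L : nat).
Hypotheses (b2 : (2 <= b)%N) (d1 : (1 <= d)%N) (L1 : (1 <= L)%N).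

Lemma leq_scale i j c x : (c <= 2 ^ i)%N -> (x <= b ^ j)%N -> (c * x <= b ^ (i + j))%N.
Proof.
by move=> h xj; rewrite expnD leq_mul // (leq_trans h) // leq_exp_base.
Qed.

Lemma leq_scaleL i j c x :
  (c <= 2 ^ i)%N -> (x <= b ^ j * L)%N -> (c * x <= b ^ (i + j) * L)%N.
Proof.
by move=> h xj; rewrite expnD -mulnA leq_mul // (leq_trans h) // leq_exp_base.
Qed.

Lemma leq_expL i j x : (i <= j)%N -> (x <= b ^ i * L)%N -> (x <= b ^ j * L)%N.
Proof.
move=> ij h; apply: leq_trans h _; rewrite leq_mul2r; apply/orP; right.
by rewrite leq_pexp2l // ltnW.
Qed.

Lemma leq_cst_exp i j c : (c <= 2 ^ i)%N -> (i <= j)%N -> (c <= b ^ j)%N.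
Proof.
move=> h ij; apply: leq_trans h _; apply: (@leq_trans (b ^ i)).
  exact: leq_exp_base.
by rewrite leq_pexp2l // ltnW.
Qed.

Lemma leq_double x y z : (x <= z)%N -> (y <= z)%N -> (x + y <= 2 * z)%N.
Proof. lia. Qed.

(** The left-hand side is what [k] must exceed: twice the degree [k' = 2 * (t * T ^ d + K)], to pass
    from [m.+1] to [m], with room for the trimmed width and for [2 ^ b <= m ^ b]. The main factor is
    [n0 <= b ^ (22 * d.+2) <= b ^ (66 * d)]; with [e] every summand is at most
    [b ^ (76 * d + 10) * L], and the final factor 32 leads to [76 * d + 15 <= 91 * d]. *)
Lemma parameters_le (T t l w n0 u e K : nat) :
  T = (8 * (b + 3).+1 * (b + 4))%N -> t = (L + 5)%N -> l = (2 * b + 5)%N ->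
  w = ((2 * T + 1) * l)%N -> n0 = ((128 * w) ^ d.+2)%N ->
  u = (t * ((b + 3 + 3) * (2 * T) ^ d + 3))%N ->
  e = (2 * u + (L + 4) + d.+2 + t * l)%N -> K = (n0 * e)%N ->
  (2 * (2 * (t * T ^ d + K)) + L + 2 * b + 10 <= b ^ (91 * d) * L)%N.
Proof.
move=> eT et el ew en eu ee eK.
have b_ge := b2; have d_ge := d1; have L_ge := L1.
have be1 : (b <= b ^ 1)%N by rewrite expn1.
have b4 : (b + 4 <= b ^ 3)%N.
  apply: (@leq_trans (4 * b)); first by clear -b_ge; lia.
  exact: (@leq_scale 2 1).
have h6 : (b + 3 + 3 <= b ^ 3)%N.
  apply: (@leq_trans (4 * b)); first by clear -b_ge; lia.
  exact: (@leq_scale 2 1).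
have hl : (l <= b ^ 4)%N.
  rewrite el; apply: (@leq_trans (8 * b)); first by clear -b_ge; lia.
  exact: (@leq_scale 3 1).
have hT : (T <= b ^ 9)%N.
  rewrite eT -addnS -mulnA; apply: (@leq_scale 3 6) => //.
  by rewrite (expnD b 3 3) leq_mul.
have h2T : (2 * T <= b ^ 10)%N by apply: (@leq_scale 1 9).
have h2T1 : (2 * T + 1 <= b ^ 11)%N.
  apply: (@leq_trans (2 * b ^ 10)); last exact: (@leq_scale 1 10).
  by apply: leq_double => //; rewrite expn_gt0 ltnW.
have hw : (128 * w <= b ^ 22)%N.
  apply: (@leq_scale 7 15) => //; rewrite ew (expnD b 11 4); exact: leq_mul.
have hn0 : (n0 <= b ^ (66 * d))%N.
  rewrite en; apply: leq_trans (leq_exp_base _ hw) _.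
  by rewrite -expnM leq_pexp2l ?(ltnW b_ge) //; clear -d_ge; lia.
have hTd : (T ^ d <= b ^ (9 * d))%N by rewrite expnM; apply: leq_exp_base.
have h2Td : ((2 * T) ^ d <= b ^ (10 * d))%N by rewrite expnM; apply: leq_exp_base.
have ht : (t <= b ^ 3 * L)%N.
  rewrite et; apply: (@leq_trans (8 * L)); first by clear -L_ge; lia.
  by rewrite leq_mul2r (@leq_cst_exp 3) ?orbT.
have hin : ((b + 3 + 3) * (2 * T) ^ d + 3 <= b ^ (1 + (3 + 10 * d)))%N.
  apply: (@leq_trans (2 * b ^ (3 + 10 * d))); last exact: leq_scale.
  apply: leq_double; first by rewrite expnD; apply: leq_mul.
  exact: (@leq_cst_exp 2).
have hu : (u <= b ^ (3 + (1 + (3 + 10 * d))) * L)%N.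
  by rewrite eu expnD mulnAC; apply: leq_mul.
have htl : (t * l <= b ^ (3 + 4) * L)%N by rewrite expnD mulnAC; apply: leq_mul.
have hd : (d.+2 <= b ^ d.+2)%N.
  by apply: (@leq_cst_exp d.+2) => //; apply: ltnW; apply: ltn_expl.
have he : (e <= b ^ (2 + (10 * d + 8)) * L)%N.
  apply: (@leq_trans (4 * (b ^ (10 * d + 8) * L))); last exact: leq_scaleL.
  rewrite ee -[4%N]/(1 + 1 + 1 + 1)%N !mulnDl !mul1n.
  apply: leq_add; [apply: leq_add; [apply: leq_add|]|].
  - apply: leq_expL (leq_scaleL (i := 1) _ hu) => //; clear; lia.
  - apply: (@leq_expL 3); first by clear; lia.
    apply: (@leq_trans (8 * L)); first by clear -L_ge; lia.
    by rewrite leq_mul2r (@leq_cst_exp 3) ?orbT.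
  - apply: (@leq_expL d.+2); first by clear; lia.
    by apply: leq_trans hd _; rewrite leq_pmulr.
  - apply: leq_expL htl; clear; lia.
set X := (b ^ (76 * d + 10) * L)%N.
have hK : (K <= X)%N.
  rewrite eK; apply: (@leq_expL (66 * d + (2 + (10 * d + 8)))%N); first by clear; lia.
  by rewrite expnD -mulnA; apply: leq_mul.
have htT : (t * T ^ d <= X)%N.
  apply: (@leq_expL (3 + 9 * d)%N); first by clear; lia.
  by rewrite expnD mulnAC; apply: leq_mul.
have hX : (32 * X <= b ^ (91 * d) * L)%N.
  apply: leq_expL (leq_scaleL (i := 5) _ (leqnn X)) => //; clear -d_ge; lia.
have hb : (b <= X)%N.
  apply: (@leq_expL 1); first by clear; lia.
  by apply: leq_trans be1 _; rewrite leq_pmulr.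
have hL : (L <= X)%N by rewrite /X leq_pmull // expn_gt0 ltnW.
have h10 : (10 <= X)%N.
  apply: (@leq_trans (b ^ (76 * d + 10))); last by rewrite leq_pmulr.
  by apply: (@leq_cst_exp 4) => //; clear; lia.
by apply: leq_trans hX; clear -hK htT hb hL h10; lia.
Qed.
End ParameterBounds.

Lemma leq_mul3_exp4 x1 x2 x3 y1 y2 y3 l :
  (x1 <= 2 ^ y1 -> x2 <= 2 ^ y2 -> x3 <= 2 ^ y3 -> 2 + y1 + y2 + y3 <= 2 * l ->
  4 * (x1 * x2 * x3) <= 4 ^ l)%N.
Proof.
move=> h1 h2 h3 hl; apply: (@leq_trans (2 ^ (2 + y1 + y2 + y3))).
  rewrite (expnD _ _ y3) (expnD _ _ y2) (expnD _ _ y1) !mulnA.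
  exact: leq_mul (leq_mul (leq_mul _ h1) h2) h3.
by rewrite -[4%N]/(2 ^ 2)%N -expnM leq_exp2l.
Qed.

(** * Depth at least 1, in the two regimes of L *)

Section MainGap.
Variables (R : realType) (m : nat) (delta R0 : R) (D1 D2 : dist R (bits m)) (k : nat).
Hypothesis D1_le : forall x, D1 x <= R0 / 2 ^+ m.
Hypothesis delta_ge0 : 0 <= delta.
Hypothesis ind : almost_indist k delta D1 D2.
Variables (J : finType) (A : J -> {set (('I_m + J) * bool)%type}).
Variables (g : J -> bits m -> bool) (d : nat) (dep : J -> nat).
Hypothesis nf : normal_form d A g dep.
Variables (b L : nat).
Hypotheses (b2 : (2 <= b)%N) (d1 : (1 <= d)%N) (L1 : (1 <= L)%N) (m2 : (2 <= m)%N).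
Hypotheses (Jb : (#|J| <= 2 ^ b)%N) (k_large : (b ^ (91 * d) * L <= k)%N).

(** Here [#|J| <= L], so [k] can afford the expansion: in [q] the extra [2 * #|J| + 1] pays for
    [4 ^+ #|J|] and leaves half of [R0 / 2 ^+ L], while [4 ^+ #|J| <= 2 ^+ k <= m%:R ^+ k]. *)
Lemma gap_large_L out : (2 ^ b < L)%N ->
  gap D1 D2 (lit_eval g out) < R0 / 2 ^+ L + 4 * m%:R ^+ k * delta.
Proof.
move=> bL; have d0 := delta_ge0; have R1 := R0_ge1 D1_le.
have e0 : 0 < R0 / 2 ^+ L by rewrite divr_gt0 ?exprn_gt0 //; lra.
have JL : (#|J| <= L)%N by apply: leq_trans Jb (ltnW bL).
have k4 : (4 * L <= k)%N.
  apply: leq_trans k_large; rewrite leq_mul2r; apply/orP; right.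
  apply: (@leq_trans (2 ^ (91 * d))); last exact: leq_exp_base.
  by apply: (@leq_trans (2 ^ 2)) => //; rewrite leq_exp2l //; move: d1; lia.
pose q := (L + 2 * #|J| + 1)%N.
have L_ge := L1.
have qk : (q <= k)%N by apply: leq_trans k4; rewrite /q; lia.
have k0 : (0 < k)%N by apply: leq_trans k4; lia.
have := gap_inclusion_exclusion D1_le delta_ge0 ind k0 nf out qk.
have E4 : 4 ^+ #|J| = 2 ^+ (2 * #|J|) :> R by rewrite exprM expr2 -natrM.
have p0 i : 0 < 2 ^+ i :> R by rewrite exprn_gt0.
have -> : 4 ^+ #|J| * (R0 / 2 ^+ q + 2 * delta) = R0 / 2 ^+ L / 2 + 2 * (4 ^+ #|J| * delta).
  have -> : R0 / 2 ^+ q = R0 / 2 ^+ L / 4 ^+ #|J| / 2.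
    by rewrite /q addn1 exprS exprD -E4 !invfM; ring.
  have y0 : 4 ^+ #|J| != 0 :> R by rewrite E4 gt_eqF.
  by move: (4 ^+ #|J|) (R0 / 2 ^+ L) y0 => y x y0; field.
have : 4 ^+ #|J| * delta <= m%:R ^+ k * delta.
  apply: ler_wpM2r => //; rewrite E4.
  apply: (@le_trans _ _ (2 ^+ k)).
    by apply: ler_weXn2l; rewrite ?ler1n //; apply: leq_trans k4; lia.
  by apply: lerXn2r; rewrite ?nnegrE ?ler0n // ler_nat.
have : 0 <= m%:R ^+ k * delta by rewrite mulr_ge0 ?exprn_ge0 ?ler0n.
lra.
Qed.

Lemma inv_expr_ge (n e' : nat) : (0 < n)%N -> (2 : R) ^+ e' <= (1 + n%:R^-1) ^+ (n * e').
Proof.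
move=> n0; rewrite exprM; apply: lerXn2r; rewrite ?nnegrE ?exprn_ge0 ?addr_ge0 ?invr_ge0 //.
have := bernoulli n (_ : 0 <= n%:R^-1 :> R); rewrite mulfV ?pnatr_eq0 -?lt0n //.
by apply; rewrite invr_ge0.
Qed.

(** The parameters are variables tied by equations, which keeps the arithmetic from unfolding them.
    Fooling the trimmed circuit costs [R0 / 2 ^+ L / 4], and trimming costs [R0 / 2 ^+ L / 16] under
    each distribution, besides the terms in [delta]. *)
Lemma gap_small_L_params out (T t l w n0 u e K k' : nat) :
  T = (8 * (b + 3).+1 * (b + 4))%N -> t = (L + 5)%N -> l = (2 * b + 5)%N ->
  w = ((2 * T + 1) * l)%N -> n0 = ((128 * w) ^ d.+2)%N ->
  u = (t * ((b + 3 + 3) * (2 * T) ^ d + 3))%N ->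
  e = (2 * u + (L + 4) + d.+2 + t * l)%N -> K = (n0 * e)%N ->
  k' = (2 * (t * T ^ d + K))%N -> (L <= 2 ^ b)%N ->
  gap D1 D2 (lit_eval g out) < R0 / 2 ^+ L + 4 * m%:R ^+ k * delta.
Proof.
move=> eT et el ew en eu ee eK ek' Lb.
have hpar := leq_trans (parameters_le b2 d1 L1 eT et el ew en eu ee eK) k_large.
rewrite -ek' in hpar.
have d0 := delta_ge0; have R1 := R0_ge1 D1_le; have b_ge := b2.
have p0 i : 0 < 2 ^+ i :> R by rewrite exprn_gt0.
have e0 : 0 < R0 / 2 ^+ L by rewrite divr_gt0 //; lra.
(* A union bound over at most [2 ^ b] wide gates, each failing on a subcube of codimension [w0],
   leaves [R0 / 2 ^+ L / 16]. *)
have [w0 ew0] : exists w0, w0 = (L + b + 4)%N by exists (L + b + 4)%N.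
have [A' [g' [V [z [bb [nf' cA' Vw0 hg']]]]]] := trim w0 nf.
have b_exp : (b.+1 <= 2 ^ b)%N by exact: ltn_expl.
have eb c : (2 ^ (b + c) = 2 ^ c * 2 ^ b)%N by rewrite expnD mulnC.
have cA j : (#|A' j| <= 2 ^ (b + 3))%N.
  by apply: leq_trans (cA' j) _; rewrite ew0 eb; move: Lb Jb b_exp; clear -b_ge; lia.
have T0 : (0 < T)%N by rewrite eT !muln_gt0 /= addn4.
have l0 : (0 < l)%N by rewrite el addnS.
have wpos : (0 < 128 * w)%N by rewrite ew !muln_gt0 addn1.
pose p : R := (128 * w)%:R^-1.
have hp : 128 * w%:R * p <= 1 by rewrite -natrM mulfV // pnatr_eq0 -lt0n.
have p01 : 0 <= p < 1.
  rewrite invr_ge0 ler0n /= invf_lt1 ?ltr0n // ltr1n.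
  by move: wpos; case: (w) => // w' _; rewrite mulnS.
have pd : p ^+ d.+2 = n0%:R^-1 by rewrite /p exprVn -natrX en.
have n00 : (0 < n0)%N by rewrite en expn_gt0 wpos.
(* [e] is the total exponent on the left, and [(1 + 1 / n0) ^+ n0 >= 2], so [K = n0 * e] is
   enough. *)
have hK : ((2 : R) ^+ u) ^+ 2 * 2 ^+ (L + 4) * (2 ^+ d.+2 * 2 ^+ (t * l)) <= (1 + p ^+ d.+2) ^+ K.
  rewrite pd eK; apply: le_trans (inv_expr_ge e n00).
  by rewrite ee -exprM (mulnC u) -!exprD addnA.
have hl : (4 * (t.+1 * #|J|.+1 * T) <= 4 ^ l)%N.
  apply: (@leq_mul3_exp4 _ _ _ (b + 2) (b + 1) (2 * b + 5)).
  - by rewrite eb et; move: Lb b_exp; clear -b_ge; lia.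
  - by rewrite eb; move: Jb b_exp; clear; lia.
  - have h4 : (b + 4 <= 2 ^ (b + 1))%N by rewrite eb; move: b_exp; clear -b_ge; lia.
    rewrite eT -addnS (_ : 2 * b + 5 = 3 + (b + 1) + (b + 1))%N; last by clear; lia.
    rewrite (expnD 2 (3 + _)) (expnD 2 3); exact: leq_mul (leq_mul _ h4) h4.
  - by rewrite el; clear; lia.
have key out' : prob D1 (lit_eval g' out') - prob D2 (lit_eval g' out') <=
    R0 / 2 ^+ L / 4 + 4 * delta * (m.+1 ^ k')%:R.
  rewrite ek' et eT.
  apply: (fool_normal_form (l := l) (w := w) (p := p) (U := 2 ^+ u) out' nf' cA) D1_le _.
  - by rewrite addn4.
  - by rewrite (expnD 2 b 4) mulnC; apply: leq_mul Jb _.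
  - exact: l0.
  - by rewrite -eT ew.
  - by rewrite -et -eT.
  - exact: p01.
  - exact: hp.
  - by rewrite -et -eT -eu.
  - by rewrite -et.
  - exact: R1.
  - rewrite -et -eT -ek'; apply: almost_indist_le ind; apply: leq_trans hpar.
    by clear; lia.
have w0k : (w0 <= k)%N by apply: leq_trans hpar; rewrite ew0; clear; lia.
pose Z := fun x => [exists j, bb j && subcube (V j) (z j) x].
have sm : #|J|%:R <= 2 ^+ b :> R by rewrite -natrX ler_nat.
have hw0 : 2 ^+ b * (R0 / 2 ^+ w0) = R0 / 2 ^+ L / 16.
  rewrite ew0 !exprD (_ : 2 ^+ 4 = 16 :> R); last by rewrite -natrX.
  by field; rewrite !gt_eqF.
have q0 : 0 <= R0 / 2 ^+ w0 by rewrite divr_ge0 ?(ltW (p0 _)) //; lra.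
have Z1 : prob D1 Z <= R0 / 2 ^+ L / 16.
  have h : forall j, bb j -> prob D1 (subcube (V j) (z j)) <= R0 / 2 ^+ w0.
    by move=> j /Vw0 <-; apply: prob_subcube1.
  rewrite -hw0; apply: le_trans (prob_exists q0 h) _.
  exact: ler_wpM2r.
have Z2 : prob D2 Z <= R0 / 2 ^+ L / 16 + 2 ^+ b * (2 * delta).
  have q2 : 0 <= R0 / 2 ^+ w0 + 2 * delta by lra.
  have h : forall j, bb j -> prob D2 (subcube (V j) (z j)) <= R0 / 2 ^+ w0 + 2 * delta.
    by move=> j /Vw0 e1; rewrite -e1; apply: (prob_subcube2 D1_le ind); rewrite e1.
  rewrite -hw0 -mulrDr; apply: le_trans (prob_exists q2 h) _.
  exact: ler_wpM2r.
have trans (D : dist R (bits m)) o : (prob D (lit_eval g o) <= prob D (lit_eval g' o) + prob D Z) /\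
    (prob D (lit_eval g' o) <= prob D (lit_eval g o) + prob D Z).
  have eqo x : ~~ Z x -> lit_eval g o x = lit_eval g' o x.
    move=> /existsPn nZ; case: o => -[i|j] c //; rewrite /lit_eval /= hg' // => j' bj'.
    by have := nZ j'; rewrite bj' /= => /forall_inPn.
  have pt (c1 c2 c3 : bool) : (~~ c3 -> c1 = c2) -> (c1%:R <= c2%:R + c3%:R :> R).
    by case: c3 => [_|->//]; [case: c1; case: c2|case: c2]; rewrite -natrD ler_nat.
  split; rewrite /prob -expectationD; apply: ler_expectation => x.
    exact: (pt _ _ (Z x) (@eqo x)).
  exact: (pt _ _ (Z x) (fun h => esym (@eqo x h))).
(* The second term comes from the wide gates under [D2], whose subcubes are controlled only through
   [D1], up to [2 * delta] each. *)
have mk : 4 * delta * (m.+1 ^ k')%:R + 2 ^+ b * (2 * delta) <= 4 * m%:R ^+ k * delta.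
  suff h : ((m.+1 ^ k' + 2 ^ b)%N%:R : R) <= m%:R ^+ k.
    have h2 : 2 ^+ b * delta <= 2 * (2 ^+ b * delta).
      by rewrite ler_peMl ?ler1n ?mulr_ge0 ?(ltW (p0 _)).
    have := ler_wpM2r d0 h; rewrite natrD (natrX _ 2 b); lra.
  rewrite -natrX ler_nat; have m_ge := m2.
  have m1 : (m.+1 ^ k' <= m ^ (2 * k'))%N.
    rewrite expnM; apply: leq_exp_base; rewrite expnS expn1.
    apply: (@leq_trans (2 * m)); last by rewrite leq_mul2r m2 orbT.
    by rewrite mul2n -addnn -addn1 leq_add2l ltnW.
  have m3 : (2 ^ b <= m ^ b)%N by apply: leq_exp_base.
  have m4 i j : (i <= j)%N -> (m ^ i <= m ^ j)%N by move=> ij; rewrite leq_pexp2l // ltnW.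
  apply: (@leq_trans (2 * m ^ (2 * k' + b))).
    rewrite [leqRHS]mul2n -addnn; apply: leq_add.
      by apply: leq_trans m1 (m4 _ _ _); rewrite leq_addr.
    by apply: leq_trans m3 (m4 _ _ _); rewrite leq_addl.
  apply: (@leq_trans (m ^ (2 * k' + b).+1)); first by rewrite expnS leq_mul2r m2 orbT.
  apply: m4; apply: leq_trans hpar; clear; lia.
pose out' := (out.1, ~~ out.2).
have neg (D : dist R (bits m)) h : prob D (lit_eval h out') = 1 - prob D (lit_eval h out).
  rewrite -prob_predC; apply: eq_prob => x; rewrite /lit_eval /=.
  by case: out.1 => [i|j]; case: out.2; rewrite ?addbT ?addbF ?negbK.
have k1 := key out; have := key out'; rewrite !neg => k2.
have [t1 t2] := trans D1 out; have [t3 t4] := trans D2 out.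
by rewrite /gap ltr_norml; apply/andP; split; lra.
Qed.

Lemma gap_small_L out : (L <= 2 ^ b)%N ->
  gap D1 D2 (lit_eval g out) < R0 / 2 ^+ L + 4 * m%:R ^+ k * delta.
Proof. exact: (gap_small_L_params out erefl erefl erefl erefl erefl erefl erefl erefl erefl). Qed.

End MainGap.

(** * Logarithms and rounding *)

Section Logarithms.
Variable R : realType.

Lemma nat_ceil (x : R) : 0 <= x ->
  exists n : nat, [/\ n%:Z = Num.ceil x, x <= n%:R & n%:R < x + 1].
Proof.
move=> x0; have c0 : 0 <= Num.ceil x by rewrite ceil_ge0; lra.
have e : `|Num.ceil x|%N%:Z = Num.ceil x by apply: gez0_abs.
exists `|Num.ceil x|%N; split=> //; first by rewrite pmulrn e ceil_ge.
by rewrite pmulrn e; have := ceilB1_lt x; rewrite intrB; lra.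
Qed.

Lemma ln2_gt0 : 0 < ln (2 : R).
Proof. by rewrite ln_gt0 // ltr1n. Qed.

Lemma log2_nat_ge1 (s : nat) : (2 <= s)%N -> 1 <= log2 (s%:R : R).
Proof.
move=> s2; rewrite /log2 ler_pdivlMr ?ln2_gt0 // mul1r ler_ln ?posrE ?ltr0n ?ler_nat //.
exact: ltnW.
Qed.

(** Because [2 ^ 3 <= 3 ^ 2]. A bound away from 1 lets powers of [log2 s] absorb constants. *)
Lemma log2_nat_ge (s : nat) : (3 <= s)%N -> 3 / 2 <= log2 (s%:R : R).
Proof.
move=> s3; have s0 : 0 < (s%:R : R) by rewrite ltr0n; apply: leq_trans s3.
have l2 := ln2_gt0; rewrite /log2 ler_pdivlMr //.
have : ln ((2 : R) ^+ 3) <= ln ((s%:R : R) ^+ 2).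
  rewrite ler_ln ?posrE ?exprn_gt0 //; apply: (@le_trans _ _ (3 ^+ 2)).
    by rewrite -!natrX ler_nat.
  by apply: lerXn2r; rewrite ?nnegrE ?ler0n // ler_nat.
by rewrite !lnXn // -(mulr_natl (ln 2)) -(mulr_natl (ln s%:R)); lra.
Qed.

(** With [y = log2 s], the rounded logarithm is at most [y + 1], and [y + 1 <= y ^+ 3] for
    [y >= 3 / 2]. *)
Lemma up_log_le (s : nat) : (3 <= s)%N ->
  (up_log 2 s)%:R <= log2 (s%:R : R) ^+ 3.
Proof.
move=> s3; have h := log2_nat_ge s3; have l2 := ln2_gt0.
have s1 : (1 < s)%N by apply: ltnW.
have s0 : 0 < (s%:R : R) by rewrite ltr0n ltnW.
have : ln ((2 : R) ^+ (up_log 2 s).-1) <= ln (s%:R : R).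
  by rewrite ler_ln ?posrE ?exprn_gt0 // -natrX ler_nat ltnW // up_log_gtn.
rewrite lnXn // -(mulr_natl (ln 2)) => hl.
have hb : (up_log 2 s).-1%:R <= log2 (s%:R : R) by rewrite /log2 ler_pdivlMr.
have eb : (up_log 2 s)%:R = (up_log 2 s).-1%:R + 1 :> R.
  by rewrite natr1 prednK // up_log_gt0.
rewrite eb; move: hb h; move: (log2 _) => y hb h.
rewrite !exprS expr0 mulr1; have : 9 / 4 <= y * y by nra.
nra.
Qed.

Lemma eps_ge (r eps : R) (L : nat) : 0 < eps -> r + log2 eps^-1 <= L%:R ->
  2 `^ r / 2 ^+ L <= eps.
Proof.
move=> e0 h; have l2 := ln2_gt0.
have r0 : 0 < (2 : R) `^ r by rewrite powR_gt0.
have p0 : 0 < (2 : R) ^+ L by rewrite exprn_gt0.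
rewrite -ler_ln ?posrE ?divr_gt0 //.
rewrite ln_div ?posrE // ln_powR lnXn // -(mulr_natl (ln 2)).
move: h; rewrite /log2 lnV ?posrE // => h.
have : (r + - ln eps / ln 2) * ln 2 <= L%:R * ln 2 by rewrite ler_wpM2r // ltW.
by rewrite mulrDl divfK ?gt_eqF //; lra.
Qed.

Lemma min_entropy_le (m : nat) (r : R) (D : dist R (bits m)) :
  min_entropy_ge (m%:R - r) D -> forall x, D x <= 2 `^ r / 2 ^+ m.
Proof.
move=> h x; apply: le_trans (h x) _.
by rewrite opprB powRB ?powR_mulrn // pnatr_eq0 implybT.
Qed.

(* The exponent 91 d of [parameters_le], with b <= (log s)^3 and L at most
   twice r + log (1 / eps). *)
Lemma k_large_enough (s d L k : nat) (x : R) : (3 <= s)%N -> (1 <= d)%N -> 1 <= x ->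
  L%:R <= x + 1 -> log2 (s%:R : R) ^+ (275 * d) * x <= k%:R ->
  (up_log 2 s ^ (91 * d) * L <= k)%N.
Proof.
move=> s3 d1 x1 Lx hk; rewrite -(ler_nat R) natrM natrX; apply: le_trans hk.
have h := log2_nat_ge s3; have hb := up_log_le s3.
set y := log2 _ in h hb *; have y1 : 1 <= y by lra.
(* The factor [y ^+ 2 >= 9 / 4] absorbs [L <= x + 1 <= 2 * x], and [3 * 91 * d + 2 <= 275 * d]. *)
apply: (@le_trans _ _ ((y ^+ 3) ^+ (91 * d) * (y ^+ 2 * x))).
  apply: ler_pM; rewrite ?ler0n ?exprn_ge0 ?ler0n //.
    by apply: lerXn2r; rewrite ?nnegrE ?ler0n ?exprn_ge0 //; lra.
  apply: le_trans Lx _; have : 9 / 4 <= y ^+ 2 by rewrite expr2; nra.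
  nra.
rewrite mulrA -exprM -exprD; apply: ler_wpM2r; first by lra.
by apply: ler_weXn2l => //; move: d1; lia.
Qed.

End Logarithms.

(* The asymptotic expression for k is read where both of its factors are at
   least 1, namely log s >= 1 and r + log (1/eps) >= 1; the latter holds
   whenever r >= 0 and eps <= 1/2. *)
Theorem lemma3p10 (R : realType) :
  exists C : nat,
  forall (s d : nat) (r eps : R),
    (2 <= s)%N -> 0 < eps -> 1 <= r + log2 eps^-1 ->
  exists2 k : nat, k_form C s d r eps k &
  forall (m : nat) (delta : R) (D1 D2 : dist R (bits m)),
    almost_indist k delta D1 D2 ->
    min_entropy_ge (m%:R - r) D1 ->
  forall c : circuit m,
    (circuit_size c <= s)%N -> (circuit_depth c <= d)%N ->
    ~ distinguishes (circuit_eval c) D1 D2 (eps + 4 * m%:R ^+ k * delta).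
Proof.
exists 275%N => s d r eps s2 eps0; set x := r + log2 eps^-1 => x1.
have ls := log2_nat_ge1 R s2.
have y1 : 1 <= log2 (s%:R : R) ^+ (275 * d) by rewrite exprn_ege1.
have yx : x <= log2 (s%:R : R) ^+ (275 * d) * x by rewrite ler_peMl //; lra.
have [|k [kE kge _]] := nat_ceil (x := log2 (s%:R : R) ^+ (275 * d) * x); first by lra.
exists k; first by exists (275 * d)%N.
have [|L [LE Lge Llt]] := nat_ceil (x := x); first by lra.
have L1 : (1 <= L)%N by rewrite -(ltr_nat R); lra.
have Lk : (L <= k)%N.
  by rewrite -lez_nat kE LE; apply: le_ceil.
have k0 : (0 < k)%N by apply: leq_trans Lk.
move=> m delta D1 D2 ind /min_entropy_le hD1 c csize cdepth.
have d0 := indist_delta_ge0 ind; have R1 := R0_ge1 hD1.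
have e0 := eps_ge eps0 Lge.
set R0 := 2 `^ r in hD1 R1 e0.
have mk0 : 0 <= m%:R ^+ k * delta by rewrite mulr_ge0 ?exprn_ge0 ?ler0n.
rewrite /distinguishes; apply/negP; rewrite -ltNge -/(prob _ _) -/(prob _ _) -/(gap _ _ _).
(* For [m = 0] the term in [delta] vanishes, since [k > 0], but there is only one input. *)
case: (posnP m) => [m0|mpos].
  have -> : gap D1 D2 (circuit_eval c) = 0.
    have dep : depends_on set0 (circuit_eval c).
      move=> y y' _; congr circuit_eval; apply/ffunP => -[i hi].
      by exfalso; move: hi; rewrite m0.
    apply/eqP; rewrite /gap normr_eq0 subr_eq0; apply/eqP.
    pose y0 : bits m := [ffun=> false].
    have cst (D : dist R (bits m)) : prob D (circuit_eval c) = (circuit_eval c y0)%:R.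
      transitivity (\sum_y D y * (circuit_eval c y0)%:R).
        by apply: eq_bigr => y _; rewrite (dep y y0) // => i; rewrite inE.
      by rewrite -mulr_suml pmf_sum1 mul1r.
    by rewrite !cst.
  lra.
have m1 : 1 <= m%:R ^+ k :> R by rewrite exprn_ege1 // ler1n.
have dm : delta <= m%:R ^+ k * delta by rewrite ler_peMl.
(* If [m <= k], the set of all bits may be used in [almost_indist]. Otherwise [m] is at least 2, so
   that [m%:R ^+ k] dominates [2 ^+ k]. *)
case: (leqP m k) => mk.
  have : gap D1 D2 (circuit_eval c) <= 2 * delta.
    apply: (gap_depends ind (V := setT)); first by rewrite cardsT card_ord.
    by move=> y y' e; congr circuit_eval; apply/ffunP => i; apply: e; rewrite inE.
  lra.
have m2 : (2 <= m)%N by apply: leq_ltn_trans mk.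
have [J [A [g [dep [out [Jc nf eqF]]]]]] := circuit_normal_form cdepth.
rewrite (eq_gap _ _ eqF).
have Js : (#|J| <= s)%N by apply: leq_trans Jc csize.
(* At depth 0 no AND or OR gate is available, and the output is an input or its negation. *)
case: (posnP d) => [dz|dpos].
  case: out eqF => -[i|j] b eqF; last by have := nf_depth nf j; rewrite dz.
  by have := gap_input ind k0 g i b; lra.
case: (leqP s 2) => s3.
  have J2 : (#|J| <= 2)%N by apply: leq_trans Js s3.
  have h := gap_two_gates hD1 d0 ind k0 nf out J2.
  have : R0 / 2 ^+ k <= R0 / 2 ^+ L.
    rewrite ler_wpM2l //; first by lra.
    by rewrite lef_pV2 ?posrE ?exprn_gt0 // ler_weXn2l ?ler1n.
  lra.
have b2 : (2 <= up_log 2 s)%N.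
  by apply: leq_trans (leq_up_log 2 s3); rewrite (@up_log_eq 2 1).
have Jb : (#|J| <= 2 ^ up_log 2 s)%N by apply: leq_trans Js (up_logP _ _).
have kb := k_large_enough s3 dpos x1 (ltW Llt) kge.
have : gap D1 D2 (lit_eval g out) < R0 / 2 ^+ L + 4 * m%:R ^+ k * delta.
  case: (leqP L (2 ^ up_log 2 s)) => Lb.
    exact: (gap_small_L hD1 d0 ind nf b2 dpos L1 m2 Jb kb out Lb).
  exact: (gap_large_L hD1 d0 ind nf b2 dpos L1 m2 Jb kb out Lb).
lra.
Qed.
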